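(* Let $F=\alpha^2/\beta$ be a Kropina metric on a product manifold $M=\mathbb{R}\times\widetilde M$ of dimension $n\ge2$, where $$\alpha^2:=(y^1)^2+h^2(x^1)\,\widetilde\alpha^2,\qquad \beta:=y^1,$$ $h\neq0$ is a smooth function on $\mathbb{R}$ and $\widetilde\alpha$ is a Riemannian metric on the $(n-1)$-dimensional manifold $\widetilde M$. Then $F$ is locally projectively flat if and only if $\widetilde\alpha$ is locally flat. In this case, the flag curvature $K$ of $F$ is given by $$K=-\Big(\frac{\beta}{\alpha}\Big)^6\Big\{\frac{h''}{h}+3(h')^2\Big(\frac{\widetilde\alpha}{\alpha}\Big)^2\Big\}.$$
   Context: $x^1$ is the coordinate on $\mathbb{R}$ and $y^1$ the corresponding fibre coordinate (so $\beta=dx^1$ as a $1$-form); $h$ is nowhere zero; $\widetilde\alpha^2=\widetilde a_{AC}y^Ay^C$ with $A,C=2,\dots,n$, in local coordinates $\{x^A\}$ of $\widetilde M$. A Kropina metric $F=\alpha^2/\beta$ is a singular Finsler metric considered where $\beta>0$. For a Finsler metric $F$: $g_{ij}=\frac12[F^2]_{y^iy^j}$, $G^i=\frac14 g^{il}\{[F^2]_{x^ky^l}y^k-[F^2]_{x^l}\}$, and $R^i_{\ k}=2\frac{\partial G^i}{\partial x^k}-y^j\frac{\partial^2G^i}{\partial x^j\partial y^k}+2G^j\frac{\partial^2G^i}{\partial y^j\partial y^k}-\frac{\partial G^i}{\partial y^j}\frac{\partial G^j}{\partial y^k}$. $F$ is locally projectively flat if around every point there are local coordinates in which $G^i=Py^i$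 for some $P=P(x,y)$ with $P(x,\lambda y)=\lambda P(x,y)$ for $\lambda>0$; then $F$ is of scalar flag curvature, i.e. $R^i_{\ k}=KF^2(\delta^i_k-F^{-2}y^i\ell_k)$ with $\ell_k=(F^2/2)_{y^iy^k}y^i$, and the function $K=K(x,y)$ is its flag curvature. *)

(* Defs.v *)
From HB Require Import structures.
From mathcomp Require Import all_boot all_order all_algebra.
From mathcomp Require Import all_classical all_reals all_analysis.
Set Implicit Arguments.
Unset Strict Implicit.
Unset Printing Implicit Defensive.
Import Order.TTheory GRing.Theory Num.Theory.
Import numFieldNormedType.Exports.
Local Open Scope classical_set_scope.
Local Open Scope ring_scope.

Section Smooth.
Context {R : realType} {V W : normedModType R}.

Fixpoint class_C (k : nat) (U : set V) (f : V -> W) : Prop :=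
  if k is k'.+1 then
    (forall x, U x -> differentiable f x) /\ (forall v, class_C k' U ('D_v f))
  else forall x, U x -> {for x, continuous f}.

Definition smooth_on (U : set V) (f : V -> W) : Prop :=
  forall k, class_C k U f.

End Smooth.

Section Manifold.
Context {R : realType}.

Record chart (M : topologicalType) (n : nat) := Chart {
  chart_dom : set M;
  coord : M -> 'rV[R]_n;
  point : 'rV[R]_n -> M;
  chart_dom_open : open chart_dom;
  chart_cod_open : open (coord @` chart_dom);
  coordK : forall p, chart_dom p -> point (coord p) = p;
  coord_continuous : forall p, chart_dom p -> {for p, continuous coord};
  point_continuous :
    forall x, (coord @` chart_dom) x -> {for x, continuous point} }.

Definition chart_cod M n (c : chart M n) : set 'rV[R]_n :=
  coord c @` chart_dom c.

Definition transition M n (c c' : chart M n) : 'rV[R]_n -> 'rV[R]_n :=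
  coord c' \o point c.

Definition overlap M n (c c' : chart M n) : set 'rV[R]_n :=
  coord c @` (chart_dom c `&` chart_dom c').

Definition compatible M n (c c' : chart M n) : Prop :=
  smooth_on (overlap c c') (transition c c') /\
  smooth_on (overlap c' c) (transition c' c).

Record manifold (n : nat) := Manifold {
  carrier :> topologicalType;
  atlas : set (chart carrier n);
  manifold_hausdorff : hausdorff_space carrier;
  manifold_second_countable : @second_countable carrier;
  atlas_cover : forall p, exists c, atlas c /\ chart_dom c p;
  atlas_compatible : forall c c', atlas c -> atlas c' -> compatible c c' }.

(* The maximal atlas. *)
Definition local_coordinates n (M : manifold n) : set (chart M n) :=
  [set c | forall c', atlas c' -> compatible c c'].

Definition chart_at n (M : manifold n) (p : M) : chart M n :=
  sval (cid (atlas_cover p)).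

(* Components of the metric in all local coordinates; the last field is the
   transformation law of a covariant 2-tensor. *)
Record riemannian_metric n (M : manifold n) := RiemannianMetric {
  metric :> chart M n -> 'rV[R]_n -> 'M[R]_n;
  metric_smooth : forall c, local_coordinates c -> forall i j,
    smooth_on (chart_cod c) (fun x => metric c x i j : R^o);
  metric_sym : forall c, local_coordinates c -> forall x, chart_cod c x ->
    (metric c x)^T = metric c x;
  metric_posdef : forall c, local_coordinates c -> forall x, chart_cod c x ->
    forall v : 'rV[R]_n, v != 0 -> 0 < (v *m metric c x *m v^T) 0 0;
  metric_transition : forall c c',
    local_coordinates c -> local_coordinates c' ->
    forall x, overlap c c' x -> forall u v : 'rV[R]_n,
    u *m metric c x *m v^T =
    'D_u (transition c c') x *m metric c' (transition c c' x) *m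
      ('D_v (transition c c') x)^T }.

Definition locally_flat n (M : manifold n) (a : riemannian_metric M) : Prop :=
  forall p : M, exists c, [/\ local_coordinates c, chart_dom c p &
    forall x, chart_cod c x -> a c x = 1%:M].

(* The squared a-norm of the tangent vector df_x(y); by metric_transition it
   does not depend on the chart used around f x. *)
Definition sqnorm_diff n (M : manifold n) (a : riemannian_metric M)
    (V : normedModType R) (f : V -> M) (x y : V) : R :=
  let c := chart_at (f x) in
  let w := 'D_y (coord c \o f) x in
  (w *m a c (coord c (f x)) *m w^T) 0 0.

(* A function on the tangent bundle, through its expressions in the charts:
   [f c x y] is the value at the vector of components y at the point of
   coordinates x. *)
Definition tangent_fun n (M : manifold n) (T : Type) :=
  chart M n -> 'rV[R]_n -> 'rV[R]_n -> T.

End Manifold.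

Section SmoothLemmas.
Context {R : realType}.

Lemma near_eq_differentiable (V W : normedModType R) (f g : V -> W) (x : V) :
  {near x, f =1 g} -> differentiable f x -> differentiable g x.
Proof.
move=> fg df; have fgx : f x = g x := nbhs_singleton fg.
have E : g \o shift x = cst (g x) + 'd f x +o_ 0 id.
  apply/eqaddoP => _/posnumP[e].
  have /eqaddoP/(_ e%:num)/(_ [gt0 of e%:num]) := diff_locally df.
  apply: filter_app; near=> z.
  have zE : f (z + x) = g (z + x).
    near: z; move: fg; rewrite [X in X -> _](near_shift 0 x).
    by apply: filterS => z; rewrite /= subr0.
  by rewrite !fctE /= zE fgx.
have cdf : continuous ('d f x) by exact: diff_continuous.
by apply/diff_locallyP; rewrite (diff_unique cdf E).
Unshelve. all: by end_near. Qed.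

Lemma class_C_ext (V W : normedModType R) k (U : set V) (f g : V -> W) :
  open U -> (forall x, U x -> f x = g x) -> class_C k U f -> class_C k U g.
Proof.
move=> oU; elim: k f g => [|k ih] f g fg /=.
  move=> cf x Ux; rewrite /prop_for /continuous_at -(fg x Ux).
  apply: cvg_trans (cf x Ux); apply: near_eq_cvg.
  by near=> z; apply/fg; near: z; exact: open_nbhs_nbhs.
have nfg x : U x -> {near x, f =1 g}.
  by move=> Ux; near=> z; apply/fg; near: z; exact: open_nbhs_nbhs.
move=> [df cdf]; split=> [x Ux|v].
  by apply: near_eq_differentiable (nfg x Ux) (df x Ux).
apply: ih (cdf v) => x Ux; apply: near_eq_derive.
by near=> z; apply/fg; near: z; exact: open_nbhs_nbhs.
Unshelve. all: by end_near. Qed.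

Lemma class_C_cst (V W : normedModType R) k (U : set V) (w : W) :
  class_C k U (fun _ : V => w).
Proof.
elim: k w => [|k ih] w /=; first by move=> x _; exact: cvg_cst.
split=> [x _|v]; first exact: differentiable_cst.
have -> : 'D_v (fun _ : V => w) = (fun _ => 0) :> (V -> W).
  by apply/funext => x; rewrite deriveE ?diff_cst//; exact: differentiable_cst.
exact: ih.
Qed.

Lemma class_C_linear (V W : normedModType R) k (U : set V)
    (L : {linear V -> W}) : continuous L -> class_C k U L.
Proof.
move=> cL; case: k => [|k] /=; first by move=> x _; exact: cL.
split=> [x _|v]; first exact: linear_differentiable.
have -> : 'D_v L = (fun _ => L v) :> (V -> W).
  apply/funext => x.
  by rewrite deriveE ?diff_lin//; exact: linear_differentiable.
exact: class_C_cst.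
Qed.

Lemma class_C_add (V W : normedModType R) k (U : set V) (f g : V -> W) :
  open U -> class_C k U f -> class_C k U g -> class_C k U (f + g).
Proof.
move=> oU; elim: k f g => [|k ih] f g /=.
  by move=> cf cg x Ux; apply: cvgD; [exact: cf|exact: cg].
move=> [df cf] [dg cg]; split=> [x Ux|v].
  by apply: differentiableD; [exact: df|exact: dg].
apply: class_C_ext (ih _ _ (cf v) (cg v)) => // x Ux.
by rewrite deriveD//; apply: diff_derivable; [exact: df|exact: dg].
Qed.

Lemma class_C_comp_linear (V V' W W' : normedModType R) k
    (U : set V) (U' : set V') (A : {linear V -> V'}) (f : V' -> W)
    (B : {linear W -> W'}) :
  open U -> continuous A -> continuous B -> (forall x, U x -> U' (A x)) ->
  class_C k U' f -> class_C k U (B \o f \o A).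
Proof.
move=> oU cA cB UU'; elim: k f => [|k ih] f /=.
  move=> cf x Ux; apply: (@continuous_comp _ _ _ (f \o A) B); last exact: cB.
  by apply: (@continuous_comp _ _ _ A f); [exact: cA|exact/cf/UU'].
move=> [df cf]; have dfA x : U x -> differentiable (f \o A) x.
  move=> Ux; apply: differentiable_comp; first exact: linear_differentiable.
  exact/df/UU'.
have dBfA x : U x -> differentiable (B \o f \o A) x.
  move=> Ux; apply: (@differentiable_comp _ _ _ _ (f \o A) B); first exact: dfA.
  exact: linear_differentiable.
split=> // v.
apply: class_C_ext (ih _ (cf (A v))) => // x Ux.
rewrite (deriveE _ (dBfA x Ux)).
rewrite (@diff_comp _ _ _ _ (f \o A) B) /=; [|exact: dfA|].
  rewrite diff_lin// (@diff_comp _ _ _ _ A f) /=; last exact/df/UU'.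
    by rewrite diff_lin// deriveE//; exact/df/UU'.
  exact: linear_differentiable.
exact: linear_differentiable.
Qed.

Lemma open_rsubmx n1 n2 (A : set 'rV[R]_n2) :
  open A -> open [set x : 'rV[R]_(n1 + n2) | A (rsubmx x)].
Proof.
apply: (@open_comp _ _ (rsubmx : 'rV[R]_(n1 + n2) -> 'rV[R]_n2) A) => x _.
exact: continuous_rsubmx.
Qed.

Lemma continuous_row_mx0 m n1 n2 :
  continuous (fun v : 'M[R]_(m, n1) => row_mx v (0 : 'M[R]_(m, n2))).
Proof.
move=> u A /nbhs_ballP[e /= e0 eA]; apply/nbhs_ballP; exists e => //= v [_ uv].
apply: eA; split=> // i j; rewrite !mxE.
case: (fintype.split j) => k; first exact: uv.
exact: ballxx.
Qed.

Lemma continuous_row_0mx m n1 n2 :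
  continuous (fun v : 'M[R]_(m, n2) => row_mx (0 : 'M[R]_(m, n1)) v).
Proof.
move=> u A /nbhs_ballP[e /= e0 eA]; apply/nbhs_ballP; exists e => //= v [_ uv].
apply: eA; split=> // i j; rewrite !mxE.
case: (fintype.split j) => k; last exact: uv.
exact: ballxx.
Qed.

End SmoothLemmas.

Lemma hausdorff_prod (T U : topologicalType) :
  hausdorff_space T -> hausdorff_space U -> hausdorff_space (T * U)%type.
Proof.
move=> hT hU [a b] [c d] cl; congr pair.
- apply: hT => A B nA nB.
  have [] := cl (A `*` setT) (B `*` setT).
  + by exists (A, setT) => //; split=> //; exact: filterT.
  + by exists (B, setT) => //; split=> //; exact: filterT.
  + by move=> [x y] [[/= Ax _] [/= Bx _]]; exists x.
- apply: hU => A B nA nB.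
  have [] := cl (setT `*` A) (setT `*` B).
  + by exists (setT, A) => //; split=> //; exact: filterT.
  + by exists (setT, B) => //; split=> //; exact: filterT.
  + by move=> [x y] [[/= _ Ay] [/= _ By]]; exists y.
Qed.

Lemma second_countable_prod (T U : topologicalType) :
  @second_countable T -> @second_countable U ->
  @second_countable (T * U)%type.
Proof.
move=> [B cB [oB bB]] [C cC [oC bC]].
exists ((fun p => p.1 `*` p.2) @` (B `*` C)).
  exact/(sub_countable (card_image_le _ _))/countableX.
split=> [_ [[X Y] [/= BX CY] <-]|[x y]].
  rewrite openE => -[a b] [/= Xa Yb]; exists (X, Y) => //=.
  by split; apply: open_nbhs_nbhs; split=> //; [exact: oB|exact: oC].
move=> A [[P Q] [/= nP nQ] PQA].
have [X [BX Xx] XP] := bB x P nP.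
have [Y [CY Yy] YQ] := bC y Q nQ.
exists (X `*` Y); first by split=> //; exists (X, Y).
by move=> [a b] [/= Xa Yb]; apply: PQA; split; [exact: XP|exact: YQ].
Qed.

Lemma second_countable_real (R : realType) : @second_countable R.
Proof.
exists ((fun p : rat * rat => `]ratr p.1, ratr p.2[%classic : set R) @` setT).
  exact/(sub_countable (card_image_le _ _))/countableP.
split=> [_ [p _ <-]|x]; first exact: interval_open.
move=> A /nbhs_ballP[e /= e0 eA].
have /rat_in_itvoo[q /itvP qx] : x - e < x by rewrite gtrBl.
have /rat_in_itvoo[r /itvP rx] : x < x + e by rewrite ltrDl.
exists `]ratr q, ratr r[%classic.
  by split; [exists (q, r)|rewrite /= in_itv /= qx rx].
move=> y /=; rewrite in_itv /= => /andP[qy yr]; apply: eA.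
rewrite /ball /= distrC ltr_distl (lt_trans _ qy) ?qx//=.
by rewrite (lt_trans yr)// rx.
Qed.

Section LineProduct.
Context {R : realType}.

Definition line_point n (M : topologicalType) (c : @chart R M n)
    (x : 'rV[R]_(1 + n)) : R * M :=
  (lsubmx x 0 0, point c (rsubmx x)).

Definition line_coord n (M : topologicalType) (c : @chart R M n)
    (p : R * M) : 'rV[R]_(1 + n) :=
  row_mx p.1%:M (coord c p.2).

Definition line_dom n (M : topologicalType) (c : @chart R M n) : set (R * M) :=
  [set p | chart_dom c p.2].

Lemma line_image n (M : topologicalType) (c : @chart R M n) (A : set M) :
  line_coord c @` [set p | A p.2] =
  [set x | (coord c @` A) (rsubmx x)].
Proof.
apply/seteqP; split=> [_ [[t p] /= Ap <-]|x [p Ap px]] /=.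
  by exists p => //; rewrite /line_coord row_mxKr.
exists (lsubmx x 0 0, p) => //; rewrite /line_coord /= px.
by rewrite -mx11_scalar hsubmxK.
Qed.

Lemma line_dom_open n (M : topologicalType) (c : @chart R M n) :
  open (line_dom c).
Proof.
by apply: open_comp (chart_dom_open c) => p _; exact: cvg_snd.
Qed.

Lemma line_cod_open n (M : topologicalType) (c : @chart R M n) :
  open (line_coord c @` line_dom c).
Proof.
rewrite (line_image c (chart_dom c)).
exact/open_rsubmx/chart_cod_open.
Qed.

Lemma line_coordK n (M : topologicalType) (c : @chart R M n) p :
  line_dom c p -> line_point c (line_coord c p) = p.
Proof.
case: p => t p /= cp; rewrite /line_point /line_coord row_mxKl row_mxKr.
by rewrite /= coordK// mxE eqxx mulr1n.
Qed.

Lemma line_coord_continuous n (M : topologicalType) (c : @chart R M n) p :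
  line_dom c p -> {for p, continuous (line_coord c)}.
Proof.
case: p => t p /= cp A /nbhs_ballP[e /= e0 eA].
have cc := coord_continuous cp; rewrite /prop_for /continuous_at in cc.
exists (ball t e, coord c @^-1` ball (coord c p) e).
  by split; [exact: nbhsx_ballx|apply: cc; exact: nbhsx_ballx].
move=> [s q] [/= ts [_ pq]]; apply: eA; split=> // i j; rewrite !mxE.
case: (fintype.split j) => k /=; last exact: pq.
by rewrite !mxE (ord1 i) (ord1 k) eqxx !mulr1n.
Qed.

Lemma line_point_continuous n (M : topologicalType) (c : @chart R M n) x :
  (line_coord c @` line_dom c) x -> {for x, continuous (line_point c)}.
Proof.
rewrite (line_image c (chart_dom c)) => /= cx.
have c1 : {for x, continuous (fun y : 'rV[R]_(1 + n) => lsubmx y 0 0 : R)}.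
  apply: (@continuous_comp _ _ _ lsubmx (fun y : 'rV[R]_1 => y 0 0)).
    exact: continuous_lsubmx.
  exact: matrix_normedtype.coord_continuous.
have c2 : {for x, continuous (fun y : 'rV[R]_(1 + n) => point c (rsubmx y))}.
  apply: (@continuous_comp _ _ _ rsubmx (point c)).
    exact: continuous_rsubmx.
  exact: point_continuous.
exact: (cvg_pair c1 c2).
Qed.

(* The chart (t, p) |-> (t, x^A(p)) of the product of R and M; the coordinate
   on R has index 0. *)
Definition line_chart n (M : topologicalType) (c : @chart R M n) :
    chart (R * M)%type (1 + n) :=
  Chart (@line_dom_open _ _ c) (@line_cod_open _ _ c) (fun p cp => line_coordK cp)
    (fun p cp => line_coord_continuous cp)
    (fun x cx => line_point_continuous cx).

Lemma line_compatible n (M : topologicalType) (c c' : @chart R M n) :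
  compatible c c' -> compatible (line_chart c) (line_chart c').
Proof.
suff H (a b : chart M n) : smooth_on (overlap a b) (transition a b) ->
    smooth_on (overlap (line_chart a) (line_chart b))
      (transition (line_chart a) (line_chart b)).
  by move=> [cc' c'c]; split; exact: H.
move=> sab k.
have ovE : overlap (line_chart a) (line_chart b) =
    [set x | overlap a b (rsubmx x)].
  exact: (line_image a (chart_dom a `&` chart_dom b)).
have o_ab : open (overlap a b).
  have -> : overlap a b = chart_cod a `&` point a @^-1` chart_dom b.
    apply/seteqP; split=> [_ [p [ap bp] <-]|_ [[p ap <-]]] /=.
      by split; [exists p|rewrite /= coordK].
    by rewrite coordK// => bp; exists p.
  rewrite openE => x [ax bx]; apply: filterI.
    by apply: open_nbhs_nbhs; split=> //; exact: chart_cod_open.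
  apply: (point_continuous ax).
  by apply: open_nbhs_nbhs; split=> //; exact: chart_dom_open.
have o_L : open (overlap (line_chart a) (line_chart b)).
  by rewrite ovE; exact: open_rsubmx.
have lin1 : linear (fun x : 'rV[R]_(1 + n) =>
    row_mx (lsubmx x) (0 : 'rV[R]_n)).
  by move=> l u v; rewrite linearP /= scale_row_mx add_row_mx scaler0 addr0.
have lin2 : linear (fun x : 'rV[R]_n => row_mx (0 : 'rV[R]_1) x).
  by move=> l u v; rewrite scale_row_mx add_row_mx scaler0 addr0.
pose L1 : {linear 'rV[R]_(1 + n) -> 'rV[R]_(1 + n)} :=
  HB.pack (fun x : 'rV[R]_(1 + n) => row_mx (lsubmx x) (0 : 'rV[R]_n))
    (GRing.isLinear.Build _ _ _ _ _ lin1).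
pose L2 : {linear 'rV[R]_n -> 'rV[R]_(1 + n)} :=
  HB.pack (fun x : 'rV[R]_n => row_mx (0 : 'rV[R]_1) x)
    (GRing.isLinear.Build _ _ _ _ _ lin2).
have -> : transition (line_chart a) (line_chart b) =
    (L1 : _ -> _) + (L2 \o transition a b \o (rsubmx : 'rV[R]_(1 + n) -> _)).
  apply/funext => x; rewrite fctE /= add_row_mx addr0 add0r.
  by rewrite /transition /= /line_coord /line_point /= -mx11_scalar.
apply: class_C_add => //.
  apply: class_C_linear => x.
  apply: (@continuous_comp _ _ _ lsubmx
    (fun y : 'rV[R]_1 => row_mx y (0 : 'rV[R]_n))).
    exact: continuous_lsubmx.
  exact: continuous_row_mx0.
apply: (@class_C_comp_linear _ _ _ _ _ _ _ (overlap a b)) => //.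
- exact: continuous_rsubmx.
- exact: continuous_row_0mx.
- by move=> x; rewrite ovE.
Qed.

Definition line_atlas n (M : @manifold R n) : set (chart (R * M)%type (1 + n)) :=
  [set line_chart c | c in @atlas _ _ M].

Lemma line_atlas_cover n (M : @manifold R n) (p : R * M) :
  exists c, line_atlas c /\ chart_dom c p.
Proof.
have [c [ac cp]] := atlas_cover p.2.
by exists (line_chart c); split=> //; exists c.
Qed.

Lemma line_atlas_compatible n (M : @manifold R n) c c' :
  @line_atlas n M c -> @line_atlas n M c' -> compatible c c'.
Proof.
by move=> [a aa <-] [b ab <-]; exact/line_compatible/atlas_compatible.
Qed.

Definition line_product n (M : @manifold R n) : @manifold R (1 + n) :=
  Manifold
    (hausdorff_prod (@Rhausdorff R) (@manifold_hausdorff _ _ M))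
    (second_countable_prod (@second_countable_real R)
       (@manifold_second_countable _ _ M))
    (@line_atlas_cover n M) (@line_atlas_compatible n M).

End LineProduct.

Section Finsler.
Context {R : realType} {n : nat}.
Implicit Types (f F : 'rV[R]_n -> 'rV[R]_n -> R) (x y : 'rV[R]_n).

Definition dx (k : 'I_n) f : 'rV[R]_n -> 'rV[R]_n -> R :=
  fun x y => 'D_(delta_mx 0 k) (fun z => f z y : R^o) x.

Definition dy (k : 'I_n) f : 'rV[R]_n -> 'rV[R]_n -> R :=
  fun x y => 'D_(delta_mx 0 k) (f x : 'rV[R]_n -> R^o) y.

Definition sq F : 'rV[R]_n -> 'rV[R]_n -> R := fun x y => F x y ^+ 2.

Definition fundamental_tensor F x y : 'M[R]_n :=
  \matrix_(i, j) (2^-1 * dy j (dy i (sq F)) x y).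

Definition spray F (i : 'I_n) x y : R :=
  4^-1 * \sum_l invmx (fundamental_tensor F x y) i l *
    (\sum_k dy l (dx k (sq F)) x y * y 0 k - dx l (sq F) x y).

Definition riemann_curvature F (i k : 'I_n) x y : R :=
  2 * dx k (spray F i) x y
  - \sum_j y 0 j * dy k (dx j (spray F i)) x y
  + 2 * \sum_j spray F j x y * dy k (dy j (spray F i)) x y
  - \sum_j dy j (spray F i) x y * dy k (spray F j) x y.

Definition ell F (k : 'I_n) x y : R :=
  \sum_i fundamental_tensor F x y i k * y 0 i.

End Finsler.

(* Below, D is the open conic domain of TM on which F is considered. *)

Definition locally_projectively_flat {R : realType} n (M : @manifold R n)
    (D : tangent_fun M Prop) (F : tangent_fun M R) : Prop :=
  forall p : M, exists c, [/\ local_coordinates c, chart_dom c p &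
    exists P : 'rV[R]_n -> 'rV[R]_n -> R,
    forall x y, chart_cod c x -> D c x y ->
      (forall i, spray (F c) i x y = P x y * y 0 i) /\
      (forall l : R, 0 < l -> P x (l *: y) = l * P x y)].

Definition is_flag_curvature {R : realType} n (M : @manifold R n)
    (D : tangent_fun M Prop) (F K : tangent_fun M R) : Prop :=
  forall c x y, local_coordinates c -> chart_cod c x -> D c x y ->
  forall i k, riemann_curvature (F c) i k x y =
    K c x y * F c x y ^+ 2 *
      ((i == k)%:R - (F c x y ^+ 2)^-1 * y 0 i * ell (F c) k x y).

Section Kropina.
Context {R : realType} {d : nat} {N : @manifold R d}.
Variables (a : riemannian_metric N) (h : R -> R).

(* Here y is a tangent vector of R * N given by its components in an arbitrary
   chart c of the product: beta is dx^1(y), and alpha_tilde_sq is the squared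
   a-norm of the projection of y to TN. In a product chart they are y^1 and
   a_AC y^A y^C: see beta_line_chart and alpha_tilde_sq_line_chart. *)

Definition x1 (c : chart (line_product N) (1 + d)) (x : 'rV[R]_(1 + d)) : R :=
  (point c x).1.

Definition beta : tangent_fun (line_product N) R := fun c x y =>
  'D_y (x1 c : 'rV[R]_(1 + d) -> R^o) x.

Definition alpha_tilde_sq : tangent_fun (line_product N) R := fun c x y =>
  sqnorm_diff a (fun z => (point c z).2 : N) x y.

Definition alpha_sq : tangent_fun (line_product N) R := fun c x y =>
  beta c x y ^+ 2 + h (x1 c x) ^+ 2 * alpha_tilde_sq c x y.

Definition alpha_tilde : tangent_fun (line_product N) R := fun c x y =>
  Num.sqrt (alpha_tilde_sq c x y).

Definition alpha : tangent_fun (line_product N) R := fun c x y =>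
  Num.sqrt (alpha_sq c x y).

Definition kropina : tangent_fun (line_product N) R := fun c x y =>
  alpha c x y ^+ 2 / beta c x y.

Definition kropina_domain : tangent_fun (line_product N) Prop := fun c x y =>
  0 < beta c x y.

Lemma beta_line_chart (c : chart N d) x y :
  beta (line_chart c) x y = lsubmx y 0 0.
Proof.
pose L (z : 'rV[R]_(1 + d)) : R^o := lsubmx z 0 0.
have linL : linear L by move=> l u v; rewrite /L !mxE.
pose LL : {linear 'rV[R]_(1 + d) -> R^o} :=
  HB.pack L (GRing.isLinear.Build _ _ _ _ _ linL).
have cL : continuous LL.
  move=> z; apply: (@continuous_comp _ _ _ lsubmx (fun y : 'rV[R]_1 => y 0 0)).
    exact: continuous_lsubmx.
  exact: matrix_normedtype.coord_continuous.
rewrite /beta -[x1 _]/(LL : _ -> _) deriveE ?diff_lin//.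
exact: linear_differentiable.
Qed.

Lemma alpha_tilde_sq_line_chart (c : chart N d) x y :
  local_coordinates c -> chart_cod c (rsubmx x) ->
  alpha_tilde_sq (line_chart c) x y =
  (rsubmx y *m a c (rsubmx x) *m (rsubmx y)^T) 0 0.
Proof.
move=> lc cx; rewrite /alpha_tilde_sq /sqnorm_diff /= /line_point /=.
rewrite /chart_at; case: cid => c0 /= [ac0 c0x].
have lc0 : local_coordinates c0.
  by move=> c1 ac1; exact: (atlas_compatible ac0 ac1).
have ov : overlap c c0 (rsubmx x).
  by case: cx c0x => p cp <-; rewrite coordK// => c0p; exists p.
rewrite (metric_transition a lc lc0 ov).
suff -> : 'D_y (coord c0 \o (fun z => point c (rsubmx z))) x =
    'D_(rsubmx y) (transition c c0) (rsubmx x) by [].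
rewrite /derive.
set f := (X in lim (X @ _)); set g := (X in _ = lim (X @ _)).
suff -> : f = g by [].
by apply/funext => t; rewrite /f /g /transition /= linearP.
Qed.

End Kropina.

(* Main.v *)
Require Import Defs.
From HB Require Import structures.
From mathcomp Require Import all_boot all_order all_algebra.
From mathcomp Require Import all_classical all_reals all_analysis.
From mathcomp Require Import ring lra.
Import Defs.
Set Implicit Arguments.
Unset Strict Implicit.
Unset Printing Implicit Defensive.
Import Order.TTheory GRing.Theory Num.Theory.
Import numFieldNormedType.Exports.
Local Open Scope classical_set_scope.
Local Open Scope ring_scope.

(** Let [sig] be a primitive of [h^-2] and put [s = sig(x1)], [b = ds(y)],
    [q = alpha_tilde^2]. Since [beta = h^2 b], the metric is [F = k b + q / b]
    with [k = h^2] a function of [s] alone: only an exact one-form and a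
    quadratic form that annihilates [d/dx1] are left.

    If [u^A] are flat coordinates of the factor, the geodesics of [F] are
    straight lines in the coordinates [(s, u^A)]: the spray is [G = P y] with
    [P = k'(s) b^2 / (2 F)], because the field
    [S = y^i d/dx^i - 2 G^i d/dy^i] satisfies [S F = 0] and
    [S (F_(y^l)) = F_(x^l)], hence the Euler-Lagrange equations of [F^2]
    ([spray_euler_lagrange]), whose solution is unique as the fundamental tensor
    is nondegenerate ([kropina_hessian_unit]). In an arbitrary chart this
    becomes [adapted_spray], and the Jacobi endomorphism of such a spray is [Xi (delta^i_k - y^i F_(y^k) / F)] with
    [Xi = - S P - P^2] ([J_jacobi], [jacobi_form_kropina],
    [jacobi_trace_kropina]); expressing [k' , k''] by [h, h', h''] gives the
    flag curvature. It is the only one, because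
    [delta^i_k - F^-2 y^i l_k] is not the zero matrix in dimension at least 2.

    Conversely, suppose [G = P y] in some chart of the product. The Hamel
    equation [F_(x^k y^l) y^k = F_(x^l)] ([hamel_equation]), after clearing
    denominators, is polynomial in [y] and free of [k] ([hamel_polynomial]).
    Evaluated on the kernel of [q] it gives [2 q D^2 s = b Dq], so the Hessian
    of [s] vanishes on [ker ds] and equals [psi ds + ds psi] for a one-form
    [psi] ([weyl_hessian]); then
    [D_z q(u, v) = 2 psi(z) q(u, v) + psi(u) q(z, v) + psi(v) q(z, u)]
    ([weyl_form]). Equality of mixed derivatives forces [D psi = psi psi]
    ([weyl_riccati]). These equations integrate explicitly along segments from a
    point [z0] ([psi_along], [level_function_along], [form_along]): after the
    projective change of variables [w / (1 - psi0(w))], [w = z - z0], the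
    function [s] becomes affine and the form [q] constant. The slice [x1 = 0],
    a copy of the factor, is thereby mapped to an affine hyperplane on which
    [alpha_tilde] is Euclidean; this is the flat chart ([developed_chart]). *)

(** * Smooth functions and mixed derivatives *)

Section SmoothCalculus.
Context {R : realType}.
Implicit Types V W : normedModType R.

Lemma class_CS V W k (U : set V) (f : V -> W) :
  class_C k.+1 U f -> class_C k U f.
Proof.
elim: k f => [|k ih] f [df cf].
  by move=> x Ux; apply: differentiable_continuous; exact: df.
by split=> // v; apply: ih; exact: cf.
Qed.

Lemma class_C_sub V W k (U U' : set V) (f : V -> W) :
  U' `<=` U -> class_C k U f -> class_C k U' f.
Proof.
move=> UU; elim: k f => [|k ih] f; first by move=> cf x /UU; exact: cf.
by move=> [df cf]; split=> [x /UU|v]; [exact: df|apply: ih; exact: cf].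
Qed.

Lemma class_C_local V W k (U : set V) (f : V -> W) :
  (forall x, U x -> exists2 B, B x & class_C k B f) -> class_C k U f.
Proof.
elim: k f => [|k ih] f H /=; first by move=> x /H[B Bx cf]; exact: cf.
split=> [x /H[B Bx [df _]]|v]; first exact: df.
by apply: ih => x /H[B Bx [_ cf]]; exists B => //; exact: cf.
Qed.

Lemma class_C_mul V k (U : set V) (f g : V -> R^o) : open U ->
  class_C k U f -> class_C k U g -> class_C k U (fun x => f x * g x : R^o).
Proof.
move=> oU; elim: k f g => [|k ih] f g.
  by move=> cf cg x Ux; apply: cvgM; [exact: cf|exact: cg].
move=> cf cg; have [[df cdf] [dg cdg]] := (cf, cg); split=> [x Ux|v].
  by apply: differentiableM; [exact: df|exact: dg].
apply: (class_C_ext oU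
  (f := (fun x => f x * 'D_v g x : R^o) + (fun x => g x * 'D_v f x : R^o))).
  by move=> x Ux; rewrite deriveM//; apply: diff_derivable; [exact: df|exact: dg].
exact: (class_C_add oU (ih _ _ (class_CS cf) (cdg v)) (ih _ _ (class_CS cg) (cdf v))).
Qed.

Lemma class_C_inv V k (U : set V) (f : V -> R^o) : open U ->
  (forall x, U x -> f x != 0) ->
  class_C k U f -> class_C k U (fun x => (f x)^-1 : R^o).
Proof.
move=> oU f0; elim: k => [|k ih].
  by move=> cf x Ux; apply: cvgV; [exact: f0|exact: cf].
move=> cf; have [df cdf] := cf; split=> [x Ux|v].
  by apply: differentiableV; [exact: df|exact: f0].
have ci := ih (class_CS cf).
apply: (class_C_ext oU
  (f := fun x => (-1 : R) * ((f x)^-1 * (f x)^-1 * 'D_v f x) : R^o)).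
  move=> x Ux; rewrite deriveV ?f0//; last exact/diff_derivable/df.
  by rewrite mulN1r scaleNr /GRing.scale /= expr2 invfM.
apply: class_C_mul => //; first exact: class_C_cst.
exact: (class_C_mul oU (class_C_mul oU ci ci) (cdf v)).
Qed.

Lemma derive_comp V W W' (g : V -> W) (f : W -> W') x v :
  differentiable g x -> differentiable f (g x) ->
  'D_v (f \o g) x = 'D_('D_v g x) f (g x).
Proof.
move=> dg df; rewrite !deriveE//; last exact: differentiable_comp.
by rewrite diff_comp.
Qed.

Lemma derive_row m W (f : 'rV[R]_m -> W) x v : differentiable f x ->
  'D_v f x = \sum_j v 0 j *: 'D_(delta_mx 0 j) f x.
Proof.
move=> df; rewrite deriveE// [in LHS](row_sum_delta v) linear_sum.
by apply: eq_bigr => j _; rewrite linearZ deriveE.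
Qed.

Lemma derive_entry m V (g : V -> 'rV[R]_m) x v j : differentiable g x ->
  'D_v (fun z => g z 0 j : R^o) x = 'D_v g x 0 j.
Proof. by move=> dg; rewrite derive_mx ?mxE//; exact: diff_derivable. Qed.

Lemma class_C_entry m V k (U : set V) (g : V -> 'rV[R]_m) j : open U ->
  class_C k U g -> class_C k U (fun x => g x 0 j : R^o).
Proof.
move=> oU cg.
have lin : linear (fun y : 'rV[R]_m => y 0 j : R^o) by move=> l u v; rewrite !mxE.
pose L : {linear 'rV[R]_m -> R^o} :=
  HB.pack (fun y : 'rV[R]_m => y 0 j : R^o) (GRing.isLinear.Build _ _ _ _ _ lin).
apply: (@class_C_comp_linear _ _ _ _ _ _ _ U idfun g L) => //.
  by move=> x; exact: cvg_id.
exact: matrix_normedtype.coord_continuous.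
Qed.

Lemma class_C_sum V W k (U : set V) n (f : 'I_n -> V -> W) : open U ->
  (forall i, class_C k U (f i)) -> class_C k U (fun x => \sum_i f i x).
Proof.
move=> oU cf; have -> : (fun x => \sum_i f i x) = \sum_i f i.
  by apply/funext => x; rewrite fct_sumE.
elim/big_ind: _ => // [|F G]; first exact: class_C_cst.
exact: class_C_add.
Qed.

Lemma class_C_scalel V W k (U : set V) (f : V -> R^o) (w : W) : open U ->
  class_C k U f -> class_C k U (fun x => f x *: w).
Proof.
move=> oU cf.
have lin : linear (fun r : R^o => r *: w) by move=> l u v; rewrite scalerDl scalerA.
pose L : {linear R^o -> W} :=
  HB.pack (fun r : R^o => r *: w) (GRing.isLinear.Build _ _ _ _ _ lin).
apply: (@class_C_comp_linear _ _ _ _ _ _ _ U idfun f L) => //.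
  by move=> x; exact: cvg_id.
exact: scalel_continuous.
Qed.

Lemma class_C_row m V k (U : set V) (g : V -> 'rV[R]_m) : open U ->
  (forall j, class_C k U (fun x => g x 0 j : R^o)) -> class_C k U g.
Proof.
move=> oU cg; have -> : g = fun x => \sum_j g x 0 j *: delta_mx 0 j.
  by apply/funext => x; rewrite -row_sum_delta.
by apply: class_C_sum => // i; apply: class_C_scalel.
Qed.

(** By induction, since the derivative of [f \o g] is the sum of the products of
    the components of the derivative of [g] with the partial derivatives of [f]
    along [g]. *)
Lemma class_C_comp m V k (U : set V) (U' : set 'rV[R]_m) (g : V -> 'rV[R]_m)
    (f : 'rV[R]_m -> R^o) : open U -> (forall x, U x -> U' (g x)) ->
  class_C k U g -> class_C k U' f -> class_C k U (f \o g).
Proof.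
move=> oU UU'; elim: k f g UU' => [|k ih] f g UU'.
  move=> cg cf x Ux; apply: continuous_comp; first exact: cg.
  exact/cf/UU'.
move=> cg cf; have [[dg cdg] [df cdf]] := (cg, cf); split=> [x Ux|v].
  by apply: differentiable_comp; [exact: dg|exact/df/UU'].
apply: (class_C_ext oU (f := fun x =>
    \sum_j ('D_v g x 0 j * 'D_(delta_mx 0 j) f (g x)))).
  move=> x Ux; have dfx := df _ (UU' x Ux).
  by rewrite (derive_comp v (dg x Ux) dfx) derive_row.
apply: class_C_sum => // j; apply: class_C_mul => //.
  exact: (class_C_entry j oU (cdg v)).
exact: (ih _ _ UU' (class_CS cg) (cdf _)).
Qed.

Lemma class_C_comp1 V k (U : set V) (U' : set R) (g : V -> R^o)
    (f : R -> R^o) : open U -> (forall x, U x -> U' (g x)) ->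
  class_C k U g -> class_C k U' f -> class_C k U (fun x => f (g x)).
Proof.
move=> oU UU'; elim: k f g UU' => [|k ih] f g UU'.
  move=> cg cf x Ux; apply: (@continuous_comp _ _ _ g f); first exact: cg.
  exact/cf/UU'.
move=> cg cf; have [[dg cdg] [df cdf]] := (cg, cf); split=> [x Ux|v].
  by apply: (@differentiable_comp _ _ _ _ g f); [exact: dg|exact/df/UU'].
apply: (class_C_ext oU (f := fun x => ('D_v g x * 'D_1 f (g x)))).
  move=> x Ux; rewrite (@derive_comp _ _ _ g f); [|exact: dg|exact/df/UU'].
  rewrite ['D_('D_v g x) f _]deriveE ?['D_1 f _]deriveE; [|exact/df/UU'..].
  by rewrite -[in RHS](mulr1 ('D_v g x)) [in RHS]linearZ.
exact: (class_C_mul oU (cdg v) (ih _ _ UU' (class_CS cg) (cdf 1))).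
Qed.

End SmoothCalculus.

Section MeanValue.
Context {R : realType}.
Implicit Types V : normedModType R.

Lemma normB_le_split (e A C D : R) :
  `|C - D| < e / 2 -> `|A - D| < e / 2 -> `|A - C| <= e.
Proof.
move=> CD AD; rewrite -[A - C](subrKA D) (le_trans (ler_normD _ _))//.
by rewrite [leRHS]splitr lerD ?ltW// distrC.
Qed.

Lemma is_derive_line V (f : V -> R^o) x u (t : R) : differentiable f (x + t *: u) ->
  is_derive t 1 (fun s : R => f (x + s *: u)) ('D_u f (x + t *: u)).
Proof.
move=> df; pose g : R^o -> V := cst x + (fun s : R^o => s *: u).
have dg : differentiable g t.
  by apply: differentiableD; [exact: differentiable_cst|exact: differentiableZl].
have E : 'D_(1 : R^o) g t = u.
  have dz : differentiable (fun s : R^o => s *: u) t by exact: differentiableZl.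
  rewrite deriveD; [|exact: derivable_cst|exact: diff_derivable].
  by rewrite derive_cst add0r deriveE// diffZl// diff_val scale1r.
apply: DeriveDef; first exact/diff_derivable/(@differentiable_comp _ _ _ _ g f).
by rewrite (@derive_comp _ _ _ _ g f)// E.
Qed.

Lemma mean_value_line V (f : V -> R^o) x u (h : R) : 0 < h ->
  (forall t, 0 <= t <= h -> differentiable f (x + t *: u)) ->
  exists2 t, 0 < t < h & f (x + h *: u) - f x = 'D_u f (x + t *: u) * h.
Proof.
move=> h0 df.
have [|||t] := @MVT R (fun s : R => f (x + s *: u)) (fun s : R => 'D_u f (x + s *: u)) 0 h.
- by [].
- move=> s; rewrite in_itv /= => /andP[s0 sh]; apply: is_derive_line.
  by apply: df; rewrite !ltW.
- apply: derivable_within_continuous => s; rewrite in_itv /= => sh.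
  by have [] := is_derive_line (df s sh).
by rewrite in_itv /= scale0r addr0 subr0 => th E; exists t.
Qed.

(** The mean value theorem is used twice: along [u] for
    [z |-> f (z + h v) - f z], then along [v] for [D_u f]. *)
Lemma second_difference V (f : V -> R^o) x u v (h : R) : 0 < h ->
  (forall s t : R, 0 <= s <= h -> 0 <= t <= h ->
     differentiable f (x + s *: u + t *: v) /\
     differentiable ('D_u f) (x + s *: u + t *: v)) ->
  exists st : R * R, [/\ 0 <= st.1 <= h, 0 <= st.2 <= h &
    f (x + h *: u + h *: v) - f (x + h *: u) - (f (x + h *: v) - f x) =
    'D_v ('D_u f) (x + st.1 *: u + st.2 *: v) * h * h].
Proof.
move=> h0 df; have hh : 0 <= h <= h by rewrite lexx ltW.
have h00 : 0 <= (0 : R) <= h by rewrite lexx ltW.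
pose sh z : V := z + h *: v.
have dsh z : differentiable sh z.
  by apply: differentiableD; [|exact: differentiable_cst].
have Dsh z : 'D_u sh z = u.
  by rewrite deriveD ?derive_cst ?addr0 ?derive_id//; exact: derivable_cst.
pose g := (f \o sh) - f.
have dfh s : 0 <= s <= h -> differentiable (f \o sh) (x + s *: u).
  by move=> sh'; apply: differentiable_comp => //; case: (df s h sh' hh).
have df0 s : 0 <= s <= h -> differentiable f (x + s *: u).
  by move=> sh'; have [] := df s 0 sh' h00; rewrite scale0r addr0.
have dg s : 0 <= s <= h -> differentiable g (x + s *: u).
  by move=> sh'; apply: differentiableB; [exact: dfh|exact: df0].
have [s s01 Es] := mean_value_line h0 dg.
have sh' : 0 <= s <= h by case/andP: s01 => a b; rewrite !ltW.
have df1 t : 0 <= t <= h -> differentiable ('D_u f) (x + s *: u + t *: v).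
  by move=> th; case: (df s t sh' th).
have [t t01 Et] := mean_value_line h0 df1.
have th : 0 <= t <= h by case/andP: t01 => a b; rewrite !ltW.
exists (s, t); split => //=; rewrite -Et.
have Eg z : g z = f (z + h *: v) - f z by [].
rewrite -!Eg Es; congr (_ * _).
rewrite deriveB; [|exact/diff_derivable/dfh|exact/diff_derivable/df0].
by rewrite (@derive_comp _ _ _ _ sh f)// ?Dsh//; case: (df s h sh' hh).
Qed.

(** The second difference of [f] on the parallelogram of sides [h u], [h v] is
    symmetric in [u] and [v]; [second_difference] identifies it, up to [h^2],
    with each of the two mixed derivatives at some point of the parallelogram,
    and both are continuous at [x]. *)
Lemma derive_swap V (U : set V) (f : V -> R^o) u v x : open U ->
  class_C 2 U f -> U x -> 'D_u ('D_v f) x = 'D_v ('D_u f) x.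
Proof.
move=> oU [df cf] Ux; apply/eqP; rewrite -subr_eq0 -normr_le0.
apply/ler_addgt0Pl => e e0; rewrite addr0.
have e2 : 0 < e / 2 by rewrite divr_gt0.
have cuv a b : {for x, continuous ('D_a ('D_b f))}.
  by case: (cf b) => _ /(_ a); exact.
have nx : \forall y \near x, U y /\
    (`|'D_u ('D_v f) x - 'D_u ('D_v f) y| < e / 2 /\
     `|'D_v ('D_u f) x - 'D_v ('D_u f) y| < e / 2).
  apply: filterI; first exact: open_nbhs_nbhs.
  by apply: filterI; apply: (cvgr_dist_lt (F := nbhs x)) => //; exact: cuv.
have [r /= r0 rP] := (nbhs_ballP _ _).1 nx.
(* Small enough for the parallelogram to lie in the ball of radius [r]. *)
pose h := r / (1 + `|u| + `|v|).
have D0 : 0 < 1 + `|u| + `|v| by rewrite -addrA ltr_pwDl// addr_ge0.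
have h0 : 0 < h by rewrite divr_gt0.
have B a b (s t : R) : `|a| + `|b| = `|u| + `|v| -> 0 <= s <= h -> 0 <= t <= h ->
    ball x r (x + s *: a + t *: b).
  move=> ab /andP[s0 sh] /andP[t0 th]; rewrite -ball_normE /=.
  rewrite -addrA opprD addrA subrr sub0r normrN.
  apply: (le_lt_trans (ler_normD _ _)); rewrite !normrZ !ger0_norm//.
  apply: (@le_lt_trans _ _ (h * (`|u| + `|v|))).
    by rewrite -ab mulrDr lerD// ler_wpM2r.
  by rewrite /h mulrAC ltr_pdivrMr// ltr_pM2l// -addrA ltrDr.
have dif a b : `|a| + `|b| = `|u| + `|v| -> forall s t : R, 0 <= s <= h -> 0 <= t <= h ->
     differentiable f (x + s *: a + t *: b) /\
     differentiable ('D_a f) (x + s *: a + t *: b).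
  move=> ab s t sh th; have [Uy _] := rP _ (B a b s t ab sh th).
  by split; [exact: df|case: (cf a) => + _; exact].
have vu : `|v| + `|u| = `|u| + `|v| by rewrite addrC.
have [[s t] /= [sh th E1]] := second_difference h0 (dif u v erefl).
have [[s' t'] /= [sh' th' E2]] := second_difference h0 (dif v u vu).
have [_ [_ H1]] := rP _ (B u v s t erefl sh th).
have [_ [H2 _]] := rP _ (B v u s' t' vu sh' th').
have E : 'D_v ('D_u f) (x + s *: u + t *: v) = 'D_u ('D_v f) (x + s' *: v + t' *: u).
  have aux (a b c l A B' : R) : a - b - (c - l) = A * h * h ->
      a - c - (b - l) = B' * h * h -> A = B'.
    by move=> Ea Eb; apply: (mulIf (lt0r_neq0 h0)); apply: (mulIf (lt0r_neq0 h0));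
      rewrite -Ea -Eb; ring.
  apply: aux E1 _; rewrite [x + h *: u + _]addrAC.
  exact: E2.
rewrite -E in H2.
exact: normB_le_split H1 H2.
Qed.

End MeanValue.

(** * The ring of smooth functions on an open set *)

Record domain {R : realType} (V : normedModType R) := Domain {
  domain_set :> V -> Prop;
  domain_open : open (domain_set : set V) }.

Section SmoothFunctions.
Context {R : realType} {V : normedModType R}.
Implicit Type U : domain V.

(** Functions vanish outside [U], so that agreement on [U] is equality and the
    smooth functions on [U] form a commutative ring on which the directional
    derivatives are commuting derivations: differential identities become
    algebra. The ring is trivial when [U] is empty. *)
Record smfun U := SFun {
  smfun_val :> V -> R;
  smfun_smooth : smooth_on U (smfun_val : V -> R^o);
  smfun_out : forall x, ~ U x -> smfun_val x = 0 }.

Lemma smfunP U (f g : smfun U) : (forall x, U x -> f x = g x) -> f = g.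
Proof.
case: f g => f sf fo [g sg go] /= fg; have E : f = g.
  apply/funext => x; have [/fg//|nx] := pselect (U x).
  by rewrite fo ?go.
by rewrite E in sf fo *; congr SFun; exact: Prop_irrelevance.
Qed.

Definition restr (U : set V) (f : V -> R) (x : V) : R := if x \in U then f x else 0.

Lemma restrE (U : set V) f x : U x -> restr U f x = f x.
Proof. by move=> Ux; rewrite /restr mem_set. Qed.

Lemma restr_out (U : set V) f x : ~ U x -> restr U f x = 0.
Proof. by move=> Ux; rewrite /restr memNset. Qed.

Lemma smooth_restr U (f : V -> R) :
  smooth_on U (f : V -> R^o) -> smooth_on U (restr U f : V -> R^o).
Proof.
move=> sf k; apply: class_C_ext (sf k); first exact: domain_open.
by move=> x Ux; rewrite restrE.
Qed.

Fact to_smfun_subproof U f (sf : smooth_on U (f : V -> R^o)) :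
  {g : smfun U | forall x, U x -> g x = f x}.
Proof.
by exists (SFun (smooth_restr sf) (@restr_out U f)) => x; exact: restrE.
Qed.

Definition to_smfun U f (sf : smooth_on U (f : V -> R^o)) : smfun U :=
  sval (to_smfun_subproof sf).

Lemma to_smfunE U f (sf : smooth_on U (f : V -> R^o)) x : U x -> to_smfun sf x = f x.
Proof. exact: (svalP (to_smfun_subproof sf)). Qed.

HB.instance Definition _ U := gen_eqMixin (smfun U).
HB.instance Definition _ U := gen_choiceMixin (smfun U).

End SmoothFunctions.

(** The ring operations are locked, lest conversion unfold a function to the
    proof that it is smooth. *)
HB.lock Definition smfun_cst {R : realType} {V : normedModType R} (U : domain V)
    (r : R) : smfun U :=
  to_smfun (fun k => @class_C_cst _ _ R^o k U r).

HB.lock Definition smfun_add {R : realType} {V : normedModType R} {U : domain V}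
    (f g : smfun U) : smfun U :=
  to_smfun (f := (f : V -> R^o) + g) (fun k =>
    class_C_add (domain_open U) (smfun_smooth f k) (smfun_smooth g k)).

HB.lock Definition smfun_mul {R : realType} {V : normedModType R} {U : domain V}
    (f g : smfun U) : smfun U :=
  to_smfun (fun k =>
    class_C_mul (domain_open U) (smfun_smooth f k) (smfun_smooth g k)).

HB.lock Definition smfun_opp {R : realType} {V : normedModType R} {U : domain V}
    (f : smfun U) : smfun U := smfun_mul (smfun_cst U (-1)) f.

HB.lock Definition sD {R : realType} {V : normedModType R} {U : domain V}
    (v : V) (f : smfun U) : smfun U :=
  to_smfun (f := 'D_v (f : V -> R^o)) (fun k => (smfun_smooth f k.+1).2 v).

Section SmoothFunctionRing.
Context {R : realType} {V : normedModType R}.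
Implicit Type U : domain V.

Lemma smfun_cstE U r x : U x -> smfun_cst U r x = r.
Proof. by rewrite unlock; exact: to_smfunE. Qed.
Let cstE := smfun_cstE.
Let addE U (f g : smfun U) x : U x -> smfun_add f g x = f x + g x.
Proof. by rewrite unlock; exact: to_smfunE. Qed.
Let mulE U (f g : smfun U) x : U x -> smfun_mul f g x = f x * g x.
Proof. by rewrite unlock; exact: to_smfunE. Qed.

Let oppE U (f : smfun U) x : U x -> smfun_opp f x = - f x.
Proof. by move=> Ux; rewrite unlock mulE// cstE// mulN1r. Qed.

Let addA U : associative (@smfun_add _ _ U).
Proof. by move=> f g h; apply: smfunP => x Ux; rewrite !addE// addrA. Qed.
Let addC U : commutative (@smfun_add _ _ U).
Proof. by move=> f g; apply: smfunP => x Ux; rewrite !addE// addrC. Qed.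
Let add0 U : left_id (smfun_cst U 0) (@smfun_add _ _ U).
Proof. by move=> f; apply: smfunP => x Ux; rewrite addE// cstE// add0r. Qed.
Let addN U : left_inverse (smfun_cst U 0) (@smfun_opp _ _ U) (@smfun_add _ _ U).
Proof.
move=> f; apply: smfunP => x Ux.
by rewrite addE// oppE// cstE// addNr.
Qed.

HB.instance Definition _ U :=
  GRing.isZmodule.Build (smfun U) (@addA U) (@addC U) (@add0 U) (@addN U).

Let mulA U : associative (@smfun_mul _ _ U).
Proof. by move=> f g h; apply: smfunP => x Ux; rewrite !mulE// mulrA. Qed.
Let mulC U : commutative (@smfun_mul _ _ U).
Proof. by move=> f g; apply: smfunP => x Ux; rewrite !mulE// mulrC. Qed.
Let mul1 U : left_id (smfun_cst U 1) (@smfun_mul _ _ U).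
Proof. by move=> f; apply: smfunP => x Ux; rewrite mulE// cstE// mul1r. Qed.
Let mulD U : left_distributive (@smfun_mul _ _ U) (@smfun_add _ _ U).
Proof. by move=> f g h; apply: smfunP => x Ux; rewrite mulE// !addE// !mulE// mulrDl. Qed.

HB.instance Definition _ U := GRing.Zmodule_isComPzRing.Build (smfun U)
  (@mulA U) (@mulC U) (@mul1 U) (@mulD U).

(** Evaluation as a ring morphism: sums, numerals and determinants of functions
    are evaluated through it. *)
Definition at_pt U (p : {x | U x}) (f : smfun U) : R := f (sval p).

Let at_pt_zmod U p : zmod_morphism (@at_pt U p).
Proof.
case: p => x Ux f g; apply: etrans (addE f (smfun_opp g) Ux) _; congr (_ + _).
exact: oppE.
Qed.
HB.instance Definition _ U p := GRing.isZmodMorphism.Build _ _ (@at_pt U p) (@at_pt_zmod U p).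

Let at_pt_monoid U p : monoid_morphism (@at_pt U p).
Proof. by case: p => x Ux; split=> [|f g]; [exact: cstE|exact: mulE]. Qed.
HB.instance Definition _ U p := GRing.isMonoidMorphism.Build _ _ (@at_pt U p) (@at_pt_monoid U p).

Lemma smfun_diff U (f : smfun U) x : U x -> differentiable (f : V -> R^o) x.
Proof. by move=> Ux; exact: (smfun_smooth f 1).1. Qed.

Lemma sDE U v (f : smfun U) x : U x -> sD v f x = 'D_v (f : V -> R^o) x.
Proof. by rewrite unlock; exact: to_smfunE. Qed.

Lemma derive_agree U (f : smfun U) (g : V -> R^o) v x : U x ->
  (forall x, U x -> g x = f x) -> 'D_v g x = sD v f x.
Proof.
move=> Ux gf; rewrite sDE//; apply: near_eq_derive.
by near=> z; apply: gf; near: z; apply: open_nbhs_nbhs; split=> //; exact: domain_open.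
Unshelve. all: by end_near. Qed.

Let derivf U (f : smfun U) x v : U x -> derivable (f : V -> R^o) x v.
Proof. by move=> Ux; exact/diff_derivable/smfun_diff. Qed.

Lemma smfun_addE U (f g : smfun U) x : U x -> (f + g) x = f x + g x.
Proof. exact: addE. Qed.

Lemma smfun_mulE U (f g : smfun U) x : U x -> (f * g) x = f x * g x.
Proof. exact: mulE. Qed.

Lemma smfun_subE U (f g : smfun U) x : U x -> (f - g) x = f x - g x.
Proof. by move=> Ux; exact: (raddfB (at_pt (exist _ x Ux))). Qed.

Lemma smfun_oppE U (f : smfun U) x : U x -> (- f) x = - f x.
Proof. by move=> Ux; exact: (raddfN (at_pt (exist _ x Ux))). Qed.

Lemma smfun_natE U k x : U x -> (k%:R : smfun U) x = k%:R.
Proof. by move=> Ux; exact: (rmorph_nat (at_pt (exist _ x Ux))). Qed.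

Lemma smfun_sumE U (I : Type) (r : seq I) (P : pred I) (f : I -> smfun U) x : U x ->
  (\sum_(i <- r | P i) f i) x = \sum_(i <- r | P i) f i x.
Proof. by move=> Ux; exact: (raddf_sum (at_pt (exist _ x Ux))). Qed.

Lemma sD_add U v (f g : smfun U) : sD v (f + g) = sD v f + sD v g.
Proof.
apply: smfunP => x Ux.
have E : 'D_v ((f : V -> R^o) + (g : V -> R^o)) x = sD v (f + g) x.
  by apply: derive_agree => // z Uz; rewrite [RHS]smfun_addE.
apply: etrans (esym E) _; rewrite smfun_addE// !sDE//.
by rewrite deriveD; [|exact: derivf..].
Qed.

Lemma sD_mul U v (f g : smfun U) : sD v (f * g) = sD v f * g + f * sD v g.
Proof.
apply: smfunP => x Ux.
have E : 'D_v ((f : V -> R^o) * (g : V -> R^o)) x = sD v (f * g) x.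
  by apply: derive_agree => // z Uz; rewrite [RHS]smfun_mulE.
apply: etrans (esym E) _; rewrite smfun_addE// !smfun_mulE// !sDE//.
have := deriveM (@derivf U f x v Ux) (@derivf U g x v Ux).
by move=> ->; rewrite addrC /GRing.scale /= [X in X + _]mulrC.
Qed.

Lemma sD_swap U u v (f : smfun U) : sD u (sD v f) = sD v (sD u f).
Proof.
apply: smfunP => x Ux.
have E a b : 'D_a ('D_b (f : V -> R^o)) x = sD a (sD b f) x.
  by apply: derive_agree => // z Uz; rewrite [RHS]sDE.
apply: etrans (esym (E u v)) _; apply: etrans _ (E v u).
exact: (derive_swap u v (domain_open U) (smfun_smooth f 2) Ux).
Qed.

Lemma sD_dir U (f : smfun U) u v a : sD (a *: u + v) f = smfun_cst U a * sD u f + sD v f.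
Proof.
apply: smfunP => x Ux; rewrite smfun_addE// smfun_mulE// !sDE// cstE//.
by rewrite !deriveE; [rewrite linearP|exact: smfun_diff..].
Qed.

Lemma smfun_inv U (f : smfun U) : (forall x, U x -> f x != 0) -> exists g, f * g = 1.
Proof.
move=> f0; exists (to_smfun (fun k => class_C_inv (domain_open U) f0 (smfun_smooth f k))).
by apply: smfunP => x Ux; rewrite smfun_mulE// to_smfunE// divff ?f0// [RHS]cstE.
Qed.

End SmoothFunctionRing.

(** * Sprays in a commutative ring with derivations *)

(** On the tangent bundle all computations take place in a commutative ring with
    commuting derivations [dX], [dY], the partial derivatives in positions and
    velocities, and elements [y], the velocities. *)
Record derivation (A : comPzRingType) := Derivation {
  der :> A -> A;
  derD : forall f g, der (f + g) = der f + der g;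
  derM : forall f g, der (f * g) = der f * g + f * der g }.

Section Derivations.
Context {A : comPzRingType}.
Implicit Types (D : derivation A) (f g : A).

Lemma der0 D : D 0 = 0.
Proof. by apply: (addrI (D 0)); rewrite -derD !addr0. Qed.

Lemma der1 D : D 1 = 0.
Proof. by apply: (addrI (D 1)); rewrite addr0 -[in RHS](mulr1 1) derM mulr1 mul1r. Qed.

Lemma derN D f : D (- f) = - D f.
Proof. by apply: (addrI (D f)); rewrite -derD !subrr der0. Qed.

Lemma derB D f g : D (f - g) = D f - D g.
Proof. by rewrite derD derN. Qed.

Lemma der_sum D (I : Type) (r : seq I) (p : pred I) (F : I -> A) :
  D (\sum_(i <- r | p i) F i) = \sum_(i <- r | p i) D (F i).
Proof.
by elim/big_rec2: _ => [|i x z _ <-]; rewrite ?der0 ?derD.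
Qed.

Lemma der_nat D n : D n%:R = 0.
Proof. by elim: n => [|n ih]; rewrite ?der0// -natr1 derD ih der1 addr0. Qed.

Lemma derMn D n f : D (n%:R * f) = n%:R * D f.
Proof. by rewrite derM der_nat mul0r add0r. Qed.

Lemma der_unit D (n : nat) f : n%:R * f = 1 -> D f = 0.
Proof.
move=> nf; have E : n%:R * D f = 0 by rewrite -derMn nf der1.
by rewrite -[D f]mul1r -nf mulrAC E mul0r.
Qed.

Lemma der_inv D f g : f * g = 1 -> D f = - (f * f) * D g.
Proof.
move=> fg; have /eqP := congr1 D fg; rewrite derM der1 addr_eq0 => /eqP E.
by rewrite -[D f]mulr1 -fg (mulrC f g) mulrA E; ring.
Qed.

Definition der_add (D E : derivation A) : derivation A.
Proof.
exists (fun f => D f + E f) => f g; first by rewrite !derD addrACA.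
by rewrite !derM; ring.
Defined.

Definition der_comb n (a : 'I_n -> A) (D : 'I_n -> derivation A) : derivation A.
Proof.
exists (fun f => \sum_i a i * D i f) => f g.
  by rewrite -big_split; apply: eq_bigr => i _; rewrite derD mulrDr.
rewrite mulr_suml mulr_sumr -big_split; apply: eq_bigr => i _ /=.
by rewrite derM; ring.
Defined.

End Derivations.

Section TangentAlgebra.
Context {A : comPzRingType} {n : nat}.
Context {dX dY : 'I_n -> derivation A} {y : 'I_n -> A}.
Hypothesis XX : forall i j f, dX i (dX j f) = dX j (dX i f).
Hypothesis XY : forall i j f, dX i (dY j f) = dY j (dX i f).
Hypothesis YY : forall i j f, dY i (dY j f) = dY j (dY i f).
Hypothesis Xy : forall i j, dX i (y j) = 0.
Hypothesis Yy : forall i j, dY i (y j) = (i == j)%:R.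

(** The field [y^i d/dx^i], the geodesic field of the flat spray. *)
Definition along := der_comb y dX.
Definition euler := der_comb y dY.

Lemma alongE f : along f = \sum_j y j * dX j f.
Proof. by []. Qed.

Lemma along_y i : along (y i) = 0.
Proof. by rewrite /= big1// => j _; rewrite Xy mulr0. Qed.

Lemma sum_delta (a : 'I_n -> A) k : \sum_j (k == j)%:R * a j = a k.
Proof.
rewrite (bigD1 k)//= eqxx mul1r big1 ?addr0// => j jk.
by rewrite eq_sym (negPf jk) mul0r.
Qed.

Lemma dY_along k f : dY k (along f) = dX k f + along (dY k f).
Proof.
rewrite /= der_sum -(sum_delta (fun j => dX j f) k) -big_split /=.
by apply: eq_bigr => j _; rewrite derM Yy -XY.
Qed.

Lemma dX_along k f : dX k (along f) = along (dX k f).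
Proof.
by rewrite /= der_sum; apply: eq_bigr => j _; rewrite derM Xy mul0r add0r XX.
Qed.

Lemma dY_euler k f : dY k (euler f) = dY k f + euler (dY k f).
Proof.
rewrite /= der_sum -[X in _ = X + _](sum_delta (fun j => dY j f) k) -big_split /=.
by apply: eq_bigr => j _; rewrite derM Yy YY.
Qed.

Lemma dY_linear (s : 'I_n -> A) k : (forall i j, dY i (s j) = 0) ->
  dY k (\sum_i s i * y i) = s k.
Proof.
move=> s0; rewrite der_sum -[RHS]sum_delta; apply: eq_bigr => i _.
by rewrite derM s0 Yy mul0r add0r mulrC.
Qed.

Lemma dX_linear (s : 'I_n -> A) k :
  (forall i j, dX i (s j) = dX j (s i)) ->
  dX k (\sum_i s i * y i) = along (s k).
Proof.
by move=> sC; rewrite der_sum; apply: eq_bigr => i _; rewrite derM Xy mulr0 addr0 sC mulrC.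
Qed.

Section Homogeneous.
Variable F : A.
Hypothesis FH : euler F = F.

(** The covector whose image under a quarter of the inverse fundamental tensor
    is the spray of [F]. *)
Definition euler_lagrange l := along (dY l (F * F)) - dX l (F * F).

Lemma euler_hessian l : euler (dY l (F * F)) = 2 * (F * dY l F).
Proof.
have /(congr1 (dY l)) : euler (F * F) = 2 * (F * F) by rewrite derM FH; ring.
rewrite dY_euler derMn => /(canRL (addKr _)) ->.
by rewrite derM; ring.
Qed.

Lemma euler_lagrangeE l : euler_lagrange l =
  2 * (along F * dY l F + F * (along (dY l F) - dX l F)).
Proof. by rewrite /euler_lagrange !derM derD !derM; ring. Qed.

(** The contraction is [y^i d/dx^i] applied to [euler F - F]. *)
Lemma hamel_contract : \sum_l y l * (along (dY l F) - dX l F) = 0.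
Proof.
under eq_bigr do rewrite mulrBr.
rewrite big_split /= sumrN; apply/eqP; rewrite subr_eq0; apply/eqP.
transitivity (along (euler F)); last by rewrite FH.
have -> : euler F = \sum_l y l * dY l F by [].
rewrite der_sum.
by apply: eq_bigr => l _; rewrite derM along_y mul0r add0r.
Qed.

End Homogeneous.

Section KropinaHamel.
Variables (s : 'I_n -> A) (k k1 b c q : A).
Hypothesis sY : forall i j, dY i (s j) = 0.
Hypothesis sX : forall i j, dX i (s j) = dX j (s i).
Hypothesis kY : forall i, dY i k = 0.
Hypothesis kX : forall i, dX i k = k1 * s i.
Hypothesis bE : b = \sum_i s i * y i.
Hypothesis bc : b * c = 1.
Hypothesis qH : euler q = 2 * q.

Let cb : c * b = 1. Proof. by rewrite mulrC. Qed.

Lemma dY_b l : dY l b = s l. Proof. by rewrite bE dY_linear. Qed.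

Lemma dX_b l : dX l b = along (s l). Proof. by rewrite bE dX_linear. Qed.

Lemma euler_b : euler b = b.
Proof. by rewrite /= [RHS]bE; apply: eq_bigr => i _; rewrite dY_b mulrC. Qed.

Lemma along_k : along k = k1 * b.
Proof. by rewrite /= bE mulr_sumr; apply: eq_bigr => i _; rewrite kX; ring. Qed.

Lemma euler_k : euler k = 0.
Proof. by rewrite /= big1// => i _; rewrite kY mulr0. Qed.

Lemma euler_kropina : euler (k * b + q * c) = k * b + q * c.
Proof.
rewrite derD !derM euler_k euler_b qH (der_inv euler cb) euler_b.
by rewrite mulNr -[c * c * b]mulrA cb; ring.
Qed.

Lemma dY_kropina l : dY l (k * b + q * c) = k * s l + dY l q * c - q * (c * c) * s l.
Proof. by rewrite derD !derM kY dY_b (der_inv (dY l) cb) dY_b; ring. Qed.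

Lemma dX_kropina l : dX l (k * b + q * c) =
  k1 * b * s l + k * along (s l) + dX l q * c - q * (c * c) * along (s l).
Proof. by rewrite derD !derM kX dX_b (der_inv (dX l) cb) dX_b; ring. Qed.

Lemma hessian_kropina i l :
  dY i (dY l ((k * b + q * c) * (k * b + q * c))) =
  2 * (dY i (k * b + q * c) * dY l (k * b + q * c) +
    (k * b + q * c) * (dY i (dY l q) * c - (c * c) * (dY l q * s i + dY i q * s l)
      + 2 * (q * (c * c * c)) * (s i * s l))).
Proof.
rewrite derM derD !derM.
have -> : dY i (dY l (k * b + q * c)) = dY i (dY l q) * c
    - (c * c) * (dY l q * s i + dY i q * s l) + 2 * (q * (c * c * c)) * (s i * s l).
  rewrite dY_kropina derB derD !derM kY sY (der_inv (dY i) cb) dY_b; ring.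
ring.
Qed.

(** The denominators disappear on multiplying by powers of [b]. The terms in
    [k] cancel, because [k b], the rate of a function of [s], satisfies the
    Hamel equation by itself. *)
Lemma hamel_polynomial l :
  along (dY l (k * b + q * c)) = dX l (k * b + q * c) ->
  s l * (2 * q * along b - b * along q) =
  b * (dY l q * along b + b * dX l q - b * along (dY l q)).
Proof.
rewrite dY_kropina dX_kropina derB derD !derM along_k (der_inv along cb).
move/eqP; rewrite -subr_eq0 => /eqP H.
apply/eqP; rewrite -subr_eq0; apply/eqP.
set ab := along b in H *; set aq := along q in H *.
set al := along (dY l q) in H *; set xq := dX l q in H *.
transitivity (2 * q * ab * s l * (b * c) ^+ 3 - b * aq * s l * (b * c) ^+ 2
  - b * dY l q * ab * (b * c) ^+ 2 - b * b * xq * (b * c) + b * b * al * (b * c)).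
  by rewrite bc; ring.
by rewrite -[RHS](mulr0 (b * b * b)) -H; ring.
Qed.

End KropinaHamel.

Section Spray.
Variables (m : nat) (J : 'I_m -> 'I_n -> A) (half P : A) (G : 'I_n -> A).
Hypothesis half2 : 2 * half = 1.
Hypothesis JY : forall a i j, dY i (J a j) = 0.
Hypothesis JX : forall a i j, dX i (J a j) = dX j (J a i).

(** [J] is the Jacobian matrix of functions [w^a] of the position, [speed] their
    rate along a curve of velocity [y]. The hypothesis on [G] that follows says
    that the geodesics [x'' = - 2 G] satisfy [(w^a)'' = - 2 P (w^a)']: they are
    straight lines in the variables [w]. *)
Definition speed a := \sum_i J a i * y i.
Local Notation Y := speed.

Hypothesis JG : forall a, \sum_i J a i * G i = P * Y a + half * along (Y a).

Definition spray_field := der_add along (der_comb (fun i => - (2 * G i)) dY).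
Local Notation S := spray_field.

Lemma spray_fieldE f : S f = along f - 2 * \sum_i G i * dY i f.
Proof.
by rewrite /= mulr_sumr -sumrN; congr (_ + _); apply: eq_bigr => i _; ring.
Qed.

Lemma spray_base f : (forall i, dY i f = 0) -> S f = along f.
Proof.
by move=> f0; rewrite spray_fieldE big1 ?mulr0 ?subr0// => i _; rewrite f0 mulr0.
Qed.

Lemma dY_speed a k : dY k (Y a) = J a k.
Proof. exact: dY_linear. Qed.

Lemma dX_speed a k : dX k (Y a) = along (J a k).
Proof. exact: dX_linear. Qed.

Lemma spray_J a k : S (J a k) = dX k (Y a).
Proof. by rewrite dX_speed spray_base. Qed.

Lemma spray_speed a : S (Y a) = - (2 * (P * Y a)).
Proof.
rewrite spray_fieldE; under eq_bigr => i _ do rewrite dY_speed mulrC.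
by rewrite JG mulrDr mulrA [2 * (half * _)]mulrA half2; ring.
Qed.

Lemma spray_dX k f : S (dX k f) = dX k (S f) + 2 * \sum_i dX k (G i) * dY i f.
Proof.
rewrite !spray_fieldE derB dX_along derMn der_sum.
under [X in along _ - 2 * X + _]eq_bigr => i _ do rewrite derM XY.
by rewrite big_split /=; ring.
Qed.

Lemma spray_dY k f : S (dY k f) = dY k (S f) - dX k f + 2 * \sum_i dY k (G i) * dY i f.
Proof.
rewrite !spray_fieldE derB dY_along derMn der_sum.
under [X in _ - 2 * X - _ + _]eq_bigr => i _ do rewrite derM YY.
by rewrite big_split /=; ring.
Qed.

Definition connection i k := dY k (G i).
Local Notation N := connection.

(** The Riemann curvature of the spray [G], written with the field [S] and the
    nonlinear connection [N]. *)
Definition jacobi i k := 2 * dX k (G i) - S (N i k) - \sum_j N i j * N j k.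

Lemma J_connection a k :
  \sum_i J a i * N i k = Y a * dY k P + P * J a k + dX k (Y a).
Proof.
have := congr1 (dY k) (JG a); rewrite der_sum derD !derM dY_speed dY_along dY_speed.
rewrite (der_unit (dY k) half2) -dX_speed mul0r add0r.
under eq_bigr => i _ do rewrite derM JY mul0r add0r.
move=> ->; rewrite -[X in _ = _ + X](mul1r) -half2; ring.
Qed.

Definition jacobi_trace := - (S P + P * P).
Definition jacobi_form k := P * dY k P - S (dY k P) + 2 * dX k P
  - \sum_j dY j P * N j k.

(** The terms with second derivatives of [w] are those of a change of
    coordinates and cancel; what is left is the curvature of the spray [P y]. *)
Theorem J_jacobi a k :
  \sum_i J a i * jacobi i k = Y a * jacobi_form k + jacobi_trace * J a k.
Proof.
have SN : \sum_i J a i * S (N i k) =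
    S (Y a * dY k P + P * J a k + dX k (Y a)) - \sum_i dX i (Y a) * N i k.
  rewrite -J_connection der_sum -sumrB; apply: eq_bigr => i _.
  by rewrite derM spray_J; ring.
have NN : \sum_i J a i * (\sum_j N i j * N j k) =
    Y a * (\sum_j dY j P * N j k) + P * (Y a * dY k P + P * J a k + dX k (Y a))
    + \sum_j dX j (Y a) * N j k.
  under eq_bigr => i _ do rewrite mulr_sumr.
  rewrite exchange_big -J_connection !mulr_sumr -!big_split /=.
  apply: eq_bigr => j _; under eq_bigr => i _ do rewrite mulrA.
  by rewrite -mulr_suml J_connection; ring.
have XG : \sum_i dX k (G i) * dY i (Y a) = \sum_i J a i * dX k (G i).
  by apply: eq_bigr => i _; rewrite dY_speed mulrC.
have -> : \sum_i J a i * jacobi i k = 2 * \sum_i J a i * dX k (G i)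
    - \sum_i J a i * S (N i k) - \sum_i J a i * (\sum_j N i j * N j k).
  by rewrite mulr_sumr -!sumrB; apply: eq_bigr => i _; rewrite /jacobi; ring.
rewrite SN NN derD derD [S (Y a * _)]derM [S (P * _)]derM spray_J spray_dX.
rewrite XG spray_speed derN derMn derM /jacobi_form /jacobi_trace; ring.
Qed.

Section KropinaSpray.
Variables (a0 : 'I_m) (k k1 k2 c : A).
Local Notation b := (Y a0).
Local Notation s := (J a0).
Hypothesis kY : forall i, dY i k = 0.
Hypothesis k1Y : forall i, dY i k1 = 0.
Hypothesis k2Y : forall i, dY i k2 = 0.
Hypothesis kX : forall i, dX i k = k1 * s i.
Hypothesis k1X : forall i, dX i k1 = k2 * s i.
Hypothesis bc : b * c = 1.

(** The part of the metric that does not involve [w^a0]: in flat coordinates of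
    the factor, the square of [alpha_tilde]. *)
Definition transverse := \sum_(a | a != a0) Y a * Y a.
Local Notation q := transverse.
Local Notation F := (k * b + q * c).
Hypothesis PF : 2 * (P * F) = k1 * (b * b).

Let cb : c * b = 1. Proof. by rewrite mulrC. Qed.

Lemma half_cancel (u v : A) : 2 * u = 2 * v -> u = v.
Proof. by move=> uv; rewrite -[u]mul1r -[v]mul1r -half2 mulrAC uv; ring. Qed.

Lemma der_transverse (D : derivation A) :
  D q = 2 * \sum_(a | a != a0) Y a * D (Y a).
Proof.
by rewrite der_sum mulr_sumr; apply: eq_bigr => a _; rewrite derM; ring.
Qed.

Lemma euler_transverse : euler q = 2 * q.
Proof.
rewrite der_transverse; congr (_ * _); apply: eq_bigr => a _; congr (_ * _).
by apply: (euler_b (s := J a)) => // i j; exact: JY.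
Qed.

Lemma spray_b : S b = - (2 * (P * b)). Proof. exact: spray_speed. Qed.

Lemma spray_k : S k = k1 * b.
Proof. by rewrite spray_base// (along_k (s := s) (b := b) kX). Qed.

Lemma spray_k1 : S k1 = k2 * b.
Proof. by rewrite spray_base// (along_k (s := s) (b := b) k1X). Qed.

Lemma spray_c : S c = 2 * (P * c).
Proof.
rewrite (der_inv S cb) spray_b.
transitivity (2 * (P * c) * (c * b)); first by ring.
by rewrite cb mulr1.
Qed.

Lemma spray_transverse : S q = - (4 * (P * q)).
Proof.
rewrite der_transverse; under eq_bigr => a _ do rewrite spray_speed.
rewrite [in RHS]/transverse !mulr_sumr -sumrN.
by apply: eq_bigr => a _; ring.
Qed.

(** [F] is constant along its geodesics; this is where the value
    [k1 b^2 / (2 F)] of [P] comes from. *)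
Lemma spray_kropina : S F = 0.
Proof.
rewrite derD [S (k * _)]derM [S (q * _)]derM.
rewrite spray_k spray_b spray_transverse spray_c.
transitivity (k1 * (b * b) - 2 * (P * F)); first by ring.
by rewrite PF subrr.
Qed.

Lemma spray_dY_transverse l : S (dY l q) = dX l q - 2 * (P * dY l q).
Proof.
rewrite (der_transverse (dY l)) (der_transverse (dX l)) derMn der_sum.
rewrite !mulr_sumr -sumrB.
apply: eq_bigr => a _; rewrite derM spray_speed dY_speed spray_J; ring.
Qed.

Lemma spray_dY_kropina l : S (dY l F) = dX l F.
Proof.
have sY i j : dY i (s j) = 0 by exact: JY.
have sX i j : dX i (s j) = dX j (s i) by exact: JX.
rewrite (dY_kropina q sY kY erefl bc) (dX_kropina q sX kX erefl bc).
rewrite derB derD !derM spray_k spray_J dX_speed spray_dY_transverse.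
by rewrite spray_c spray_transverse -/(speed a0); ring.
Qed.

(** From [S F = 0] and [S (F_(y^l)) = F_(x^l)] one gets
    [S ((F^2)_(y^l)) = (F^2)_(x^l)], which is the Euler-Lagrange equation once
    [S] is expanded. *)
Theorem spray_euler_lagrange l :
  2 * (\sum_i G i * dY i (dY l (F * F))) = euler_lagrange F l.
Proof.
have : S (dY l (F * F)) = dX l (F * F).
  rewrite !derM derD !derM spray_kropina spray_dY_kropina; ring.
by rewrite spray_fieldE /euler_lagrange => <-; ring.
Qed.

(** The horizontal derivative [d/dx^l - N^j_l d/dy^j]. It annihilates [F]
    ([horizontal_kropina]), so applying it to [2 P F = k1 b^2] yields the
    horizontal derivative of [P]. *)
Definition horizontal l := der_add (dX l) (der_comb (fun j => - N j l) dY).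

Lemma horizontalE l f : horizontal l f = dX l f - \sum_j dY j f * N j l.
Proof.
by rewrite /= -sumrN; congr (_ + _); apply: eq_bigr => i _; ring.
Qed.

Lemma horizontal_b l : horizontal l b = - (b * dY l P + P * s l).
Proof.
rewrite horizontalE; under eq_bigr => j _ do rewrite dY_speed.
by rewrite J_connection; ring.
Qed.

Lemma horizontal_speed a l : horizontal l (Y a) = - (Y a * dY l P + P * J a l).
Proof.
rewrite horizontalE; under eq_bigr => j _ do rewrite dY_speed.
by rewrite J_connection; ring.
Qed.

Lemma horizontal_k l : horizontal l k = k1 * s l.
Proof. by rewrite horizontalE kX big1 ?subr0// => j _; rewrite kY mul0r. Qed.

Lemma horizontal_k1 l : horizontal l k1 = k2 * s l.
Proof. by rewrite horizontalE k1X big1 ?subr0// => j _; rewrite k1Y mul0r. Qed.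

Lemma horizontal_transverse l :
  horizontal l q = - (2 * (q * dY l P) + P * dY l q).
Proof.
rewrite !der_transverse; under eq_bigr => a _ do rewrite horizontal_speed.
under [in RHS]eq_bigr => a _ do rewrite dY_speed.
rewrite /transverse mulr_suml !mulr_sumr -big_split -sumrN /=.
by apply: eq_bigr => a _; ring.
Qed.

Lemma dY_PF l : dY l P * F + P * dY l F = k1 * b * s l.
Proof.
apply: half_cancel; have := congr1 (dY l) PF.
by rewrite derMn derM [dY l (k1 * _)]derM derM k1Y dY_speed => ->; ring.
Qed.

Lemma horizontal_kropina l : horizontal l F = 0.
Proof.
have sY i j : dY i (s j) = 0 by exact: JY.
rewrite derD [horizontal l (k * _)]derM [horizontal l (q * _)]derM.
rewrite horizontal_k horizontal_transverse (der_inv (horizontal l) cb) horizontal_b.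
transitivity (k1 * b * s l - (dY l P * F + P * dY l F)
  + (b * c - 1) * (q * c * dY l P)).
  by rewrite (dY_kropina q sY kY erefl bc); ring.
by rewrite dY_PF bc; ring.
Qed.

Lemma horizontal_P l : 2 * (horizontal l P * F) =
  k2 * (b * b) * s l - 2 * (k1 * b * (b * dY l P + P * s l)).
Proof.
have := congr1 (horizontal l) PF.
rewrite derMn derM horizontal_kropina mulr0 addr0 => ->.
by rewrite derM horizontal_k1 derM horizontal_b; ring.
Qed.

Lemma spray_P : 2 * (S P * F) = k2 * (b * b * b) - 4 * (k1 * (b * b) * P).
Proof.
have := congr1 S PF; rewrite derMn derM spray_kropina mulr0 addr0 => ->.
by rewrite derM spray_k1 derM spray_b; ring.
Qed.

Lemma jacobi_formE l :
  jacobi_form l = 3 * horizontal l P + P * dY l P - dY l (S P).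
Proof.
rewrite /jacobi_form spray_dY horizontalE.
have -> : \sum_i dY l (G i) * dY i P = \sum_j dY j P * N j l.
  by apply: eq_bigr => j _; rewrite mulrC.
ring.
Qed.

(** With [J_jacobi] this makes the curvature equal to
    [Xi (delta^i_k - y^i F_(y^k) / F)]: the metric has scalar flag curvature
    [Xi / F^2]. *)
Theorem jacobi_form_kropina l : jacobi_form l * F = - (jacobi_trace * dY l F).
Proof.
apply: half_cancel.
have dSP : 2 * (dY l (S P) * F + S P * dY l F) = 3 * (k2 * (b * b) * s l)
    - 4 * (k1 * (b * b) * dY l P + 2 * (k1 * b * s l * P)).
  rewrite -derM -derMn spray_P derB derMn !derM k1Y k2Y dY_speed; ring.
transitivity (3 * (2 * (horizontal l P * F)) + 2 * (P * (dY l P * F))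
   - 2 * (dY l (S P) * F + S P * dY l F) + 2 * (S P * dY l F)).
  by rewrite jacobi_formE; ring.
rewrite horizontal_P dSP /jacobi_trace.
transitivity (2 * P * (k1 * b * s l) - 2 * (k1 * (b * b)) * dY l P
   + 2 * (P * (dY l P * F)) + 2 * (S P * dY l F)); first by ring.
by rewrite -PF -dY_PF; ring.
Qed.

Theorem jacobi_trace_kropina :
  2 * (jacobi_trace * F) = 3 * (P * (k1 * (b * b))) - k2 * (b * b * b).
Proof.
transitivity (- (2 * (S P * F)) - P * (2 * (P * F))).
  by rewrite /jacobi_trace; ring.
by rewrite spray_P PF; ring.
Qed.

End KropinaSpray.
End Spray.
End TangentAlgebra.

(** * Nondegeneracy of the Kropina fundamental tensor *)

Section PointwiseHessian.
Context {R : realFieldType} {n : nat}.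
Implicit Types (Q : 'M[R]_n) (y s f w : 'rV[R]_n).

Definition bform Q y w : R := (y *m Q *m w^T) 0 0.

Lemma bformD2 Q y w1 w2 (a : R) : bform Q y (w1 + a *: w2) = bform Q y w1 + a * bform Q y w2.
Proof. by rewrite /bform linearD linearZ /= mulmxDr -scalemxAr !mxE. Qed.

Lemma bformD1 Q y1 y2 w (a : R) : bform Q (y1 + a *: y2) w = bform Q y1 w + a * bform Q y2 w.
Proof. by rewrite /bform !mulmxDl -!scalemxAl !mxE. Qed.

Lemma bformC Q y w : Q^T = Q -> bform Q y w = bform Q w y.
Proof.
move=> QT; rewrite /bform -[y *m Q *m w^T]trmxK mxE !trmx_mul trmxK QT.
by rewrite mulmxA.
Qed.

(** The Hessian in [y] of [F^2] for [F = k b + q / b], where [b = s y],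
    [c = 1 / b], [Q] is the matrix of [q] and [f] the differential of [F]: see
    [hessian_kropina]. *)
Definition kropina_hessian (F c q : R) Q y s f : 'M[R]_n :=
  \matrix_(i, l) (2 * (f 0 i * f 0 l + F * (2 * Q i l * c
     - (c * c) * (2 * (y *m Q) 0 l * s 0 i + 2 * (y *m Q) 0 i * s 0 l)
     + 2 * (q * (c * c * c)) * (s 0 i * s 0 l)))).

Lemma dotE (a b : 'rV[R]_n) : (a *m b^T) 0 0 = \sum_i a 0 i * b 0 i.
Proof. by rewrite mxE; apply: eq_bigr => i _; rewrite mxE. Qed.

Lemma kropina_hessianE F c q Q y s f : kropina_hessian F c q Q y s f =
  2 *: (f^T *m f + F *: ((2 * c) *: Q - (2 * c * c) *: (s^T *m (y *m Q) + (y *m Q)^T *m s)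
    + (2 * (q * (c * c * c))) *: (s^T *m s))).
Proof.
apply/matrixP => i l; rewrite !mxE !big_ord1 !mxE; ring.
Qed.

(** On a vector [w] the Hessian takes the value
    [2 (f w)^2 + 4 F c Q(w - m y)] with [m = (s w) / b]. Both terms are
    nonnegative; they vanish only when [w = m y] and [f w = m F] is zero. *)
Lemma kropina_hessian_unit F c q Q y s f b :
  0 < F -> 0 < b -> b * c = 1 -> Q^T = Q -> bform Q y y = q ->
  (s *m y^T) 0 0 = b -> (f *m y^T) 0 0 = F ->
  (forall w, 0 <= bform Q w w) ->
  (forall w, bform Q w w = 0 -> (s *m w^T) 0 0 = 0 -> w = 0) ->
  kropina_hessian F c q Q y s f \in unitmx.
Proof.
move=> F0 b0 bc QT qE sy fy Qp Qd; rewrite -row_free_unit -kermx_eq0.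
apply/eqP/row_matrixP => i; rewrite row0.
set w := row i _; have : w *m kropina_hessian F c q Q y s f = 0.
  by rewrite /w -row_mul mulmx_ker row0.
move: w => w {i} wH; pose m := (s *m w^T) 0 0 * c.
have E : bform (kropina_hessian F c q Q y s f) w w =
    2 * ((f *m w^T) 0 0 ^+ 2 + 2 * F * c * bform Q (w - m *: y) (w - m *: y)).
  have fw : (w *m f^T) 0 0 = (f *m w^T) 0 0 by rewrite !dotE; apply: eq_bigr => i _; rewrite mulrC.
  have sw : (w *m s^T) 0 0 = (s *m w^T) 0 0 by rewrite !dotE; apply: eq_bigr => i _; rewrite mulrC.
  have e1 (a b' : 'rV[R]_n) : (w *m (a^T *m b') *m w^T) 0 0 = (w *m a^T) 0 0 * (b' *m w^T) 0 0.
    by rewrite !mulmxA -(mulmxA (w *m a^T)) mxE big_ord1.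
  have -> : bform (kropina_hessian F c q Q y s f) w w = 2 * ((f *m w^T) 0 0 ^+ 2
      + F * (2 * c * bform Q w w - 2 * c * c * (2 * (s *m w^T) 0 0 * bform Q y w)
      + 2 * (q * (c * c * c)) * (s *m w^T) 0 0 ^+ 2)).
    have e2 : (w *m (y *m Q)^T) 0 0 = bform Q y w.
      by rewrite /bform !dotE; apply: eq_bigr => i _; rewrite mulrC.
    have fD M N : bform (M + N) w w = bform M w w + bform N w w.
      by rewrite /bform mulmxDr mulmxDl mxE.
    have fZ a M : bform (a *: M) w w = a * bform M w w.
      by rewrite /bform -scalemxAr -scalemxAl mxE.
    have e3 (a b' : 'rV[R]_n) :
      bform (a^T *m b') w w = (w *m a^T) 0 0 * (b' *m w^T) 0 0 by exact: e1.
    rewrite kropina_hessianE -scaleNr !(fZ, fD) !e3 e2 fw sw -/(bform Q y w).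
    ring.
  have -> : w - m *: y = w + (- m) *: y by rewrite scaleNr.
  rewrite !(bformD1, bformD2) (bformC w y QT) qE /m.
  transitivity (2 * ((f *m w^T) 0 0 ^+ 2 + 2 * F * c * (bform Q w w -
     2 * (s *m w^T) 0 0 * c * bform Q y w + q * c ^+ 2 * (s *m w^T) 0 0 ^+ 2))); ring.
have c0 : 0 < c by rewrite -(pmulr_rgt0 _ b0) bc.
have : bform (kropina_hessian F c q Q y s f) w w = 0 by rewrite /bform wH mul0mx mxE.
rewrite E; set u := w - _ => /eqP; rewrite mulf_eq0 pnatr_eq0 /=.
have Fc : 0 < 2 * F * c by rewrite !mulr_gt0.
have Fq := mulr_ge0 (ltW Fc) (Qp u).
rewrite paddr_eq0 ?sqr_ge0// => /andP[].
rewrite sqrf_eq0 mulf_eq0 (gt_eqF Fc) /= => /eqP fw0 /eqP /Qd u0.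
have wy : w = m *: y.
  apply/eqP; rewrite -subr_eq0; apply/eqP/u0.
  rewrite linearB linearZ /= mulmxBr -scalemxAr mxE [X in _ + X]mxE [X in _ - X]mxE.
  by rewrite sy /m -mulrA [c * b]mulrC bc mulr1 subrr.
move: fw0; rewrite wy linearZ /= -scalemxAr mxE fy => /eqP.
by rewrite mulf_eq0 (gt_eqF F0) orbF => /eqP ->; rewrite scale0r.
Qed.

End PointwiseHessian.

(** * Functions of positions and velocities *)

Section DeriveAlongLines.
Context {R : realType}.
Implicit Types V W : normedModType R.

(** A directional derivative depends only on the values along the line, so it can
    be computed after any reparametrization that is affine on that line. *)
Lemma derive_line W V V' (f : V -> W) (g : V' -> W) x v x' v' :
  (forall t : R, f (x + t *: v) = g (x' + t *: v')) -> 'D_v f x = 'D_v' g x'.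
Proof.
move=> fg; rewrite /derive.
set F := (X in lim (X @ _)); set G := (X in _ = lim (X @ _)).
suff -> : F = G by [].
apply/funext => t; rewrite /F /G /= [t *: v + x]addrC [t *: v' + x']addrC !fg.
by have := fg 0; rewrite !scale0r !addr0 => ->.
Qed.

Lemma derive_affine W V (f : V -> W) x v a :
  (forall t : R, f (x + t *: v) = f x + t *: a) -> 'D_v f x = a.
Proof.
move=> fx; pose g : R^o -> W := cst (f x) + (fun t : R^o => t *: a).
rewrite (@derive_line W V R^o f g x v 0 1); last first.
  by move=> t; rewrite fx /g fctE /= add0r /GRing.scale /= mulr1.
have da : differentiable (fun t : R^o => t *: a) 0 by exact: differentiableZl.
rewrite deriveD; [|exact: derivable_cst|exact: diff_derivable].
by rewrite derive_cst add0r deriveE// diffZl// diff_val scale1r.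
Qed.

Lemma derive_const_line W V (f : V -> W) x v :
  (forall t : R, f (x + t *: v) = f x) -> 'D_v f x = 0.
Proof. by move=> fx; apply: derive_affine => t; rewrite scaler0 addr0. Qed.

End DeriveAlongLines.

Section TangentSmoothness.
Context {R : realType} {n : nat}.
Local Notation V := 'rV[R]_n.
Local Notation T := 'rV[R]_(n + n).
Variables (B : domain V) (U : domain T).
Hypothesis UB : forall z, U z -> B (lsubmx z).

Lemma smooth_base (f : smfun B) :
  smooth_on U ((fun z => f (lsubmx z)) : T -> R^o).
Proof.
move=> k; apply: (@class_C_comp_linear _ _ _ _ _ k U B lsubmx (f : V -> R^o) idfun) => //.
- exact: domain_open.
- exact: continuous_lsubmx.
- by move=> x; exact: cvg_id.
- exact: smfun_smooth.
Qed.

Lemma smooth_fibre k : smooth_on U ((fun z : T => rsubmx z 0 k) : T -> R^o).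
Proof.
have lin : linear (fun z : T => rsubmx z 0 k : R^o).
  by move=> l u v; rewrite linearP !mxE.
pose L : {linear T -> R^o} :=
  HB.pack (fun z : T => rsubmx z 0 k : R^o) (GRing.isLinear.Build _ _ _ _ _ lin).
move=> m; apply: (@class_C_linear _ _ _ m U L) => z.
apply: (@continuous_comp _ _ _ rsubmx (fun y : V => y 0 k)).
  exact: continuous_rsubmx.
exact: matrix_normedtype.coord_continuous.
Qed.

End TangentSmoothness.

(** A point of the tangent bundle is a vector of length [n + n]: the position,
    then the velocity. *)
HB.lock Definition base {R : realType} {n : nat} {B : domain 'rV[R]_n}
    {U : domain 'rV[R]_(n + n)} (UB : forall z, U z -> B (lsubmx z))
    (f : smfun B) : smfun U := to_smfun (smooth_base UB f).

HB.lock Definition fibre {R : realType} {n : nat} (U : domain 'rV[R]_(n + n))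
    (k : 'I_n) : smfun U := to_smfun (smooth_fibre U k).

HB.lock Definition dirX {R : realType} {n : nat} (U : domain 'rV[R]_(n + n))
    (v : 'rV[R]_n) : derivation (smfun U) :=
  Derivation (@sD_add _ _ U (row_mx v 0)) (@sD_mul _ _ U (row_mx v 0)).

HB.lock Definition dirY {R : realType} {n : nat} (U : domain 'rV[R]_(n + n))
    (v : 'rV[R]_n) : derivation (smfun U) :=
  Derivation (@sD_add _ _ U (row_mx 0 v)) (@sD_mul _ _ U (row_mx 0 v)).

Section TangentFunctions.
Context {R : realType} {n : nat}.
Local Notation V := 'rV[R]_n.
Local Notation T := 'rV[R]_(n + n).
Variables (B : domain V) (U : domain T).
Hypothesis UB : forall z, U z -> B (lsubmx z).
Local Notation base := (base UB).
Local Notation fibre := (fibre U).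
Local Notation dirX := (dirX U).
Local Notation dirY := (dirY U).

Lemma baseE f z : U z -> base f z = f (lsubmx z).
Proof. by rewrite unlock; exact: to_smfunE. Qed.

Lemma fibreE k z : U z -> fibre k z = rsubmx z 0 k.
Proof. by rewrite unlock; exact: to_smfunE. Qed.

Lemma dirXE v f : dirX v f = sD (row_mx v 0) f.
Proof. by rewrite unlock. Qed.

Lemma dirYE v f : dirY v f = sD (row_mx 0 v) f.
Proof. by rewrite unlock. Qed.

Definition sX k := dirX (delta_mx 0 k).
Definition sY k := dirY (delta_mx 0 k).

Lemma dirX_base v f : dirX v (base f) = base (sD v f).
Proof.
rewrite [LHS]dirXE; apply: smfunP => z Uz; have Bz := UB Uz; rewrite baseE// [RHS]sDE//.
have E : 'D_(row_mx v 0) ((fun z => f (lsubmx z)) : T -> R^o) z = 'D_v (f : V -> R^o) (lsubmx z).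
  by apply: derive_line => t; rewrite linearD linearZ /= row_mxKl.
apply: etrans _ E; apply/esym/(derive_agree (f := base f)) => // z' Uz'.
by rewrite baseE.
Qed.

Lemma dirY_base v f : dirY v (base f) = 0.
Proof.
rewrite [LHS]dirYE; apply: smfunP => z Uz; rewrite [LHS]sDE//.
have E : 'D_(row_mx 0 v) ((fun z => f (lsubmx z)) : T -> R^o) z = 0.
  by apply: derive_const_line => t; rewrite linearD linearZ /= row_mxKl scaler0 addr0.
rewrite -sDE// -(derive_agree (g := (fun z => f (lsubmx z))) _ Uz); last first.
  by move=> z' Uz'; rewrite baseE.
by rewrite E [RHS]smfun_cstE.
Qed.

Lemma sX_fibre i j : sX i (fibre j) = 0.
Proof.
rewrite [LHS]dirXE; apply: smfunP => z Uz.
have E : 'D_(row_mx (delta_mx 0 i) 0) ((fun z : T => rsubmx z 0 j) : T -> R^o) z = 0.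
  by apply: derive_const_line => t; rewrite linearD linearZ /= row_mxKr scaler0 addr0.
apply: etrans (esym (derive_agree (f := fibre j) (g := (fun z : T => rsubmx z 0 j)) _ Uz _)) _.
  by move=> z' Uz'; rewrite fibreE.
by rewrite E [RHS]smfun_cstE.
Qed.

Lemma dirY_fibre v j : dirY v (fibre j) = smfun_cst U (v 0 j).
Proof.
rewrite [LHS]dirYE; apply: smfunP => z Uz.
have E : 'D_(row_mx 0 v) ((fun z : T => rsubmx z 0 j) : T -> R^o) z = v 0 j.
  apply: derive_affine => t.
  by rewrite linearD linearZ /= row_mxKr !mxE.
apply: etrans (esym (derive_agree (f := fibre j) (g := (fun z : T => rsubmx z 0 j)) _ Uz _)) _.
  by move=> z' Uz'; rewrite fibreE.
by rewrite E [RHS]smfun_cstE.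
Qed.

Lemma sY_fibre i j : sY i (fibre j) = (i == j)%:R.
Proof.
rewrite [LHS]dirY_fibre mxE eqxx /= eq_sym.
by case: eqP.
Qed.

Lemma sXX i j f : sX i (sX j f) = sX j (sX i f).
Proof.
have E u v : dirX u (dirX v f) = dirX v (dirX u f).
  rewrite (dirXE u (dirX v f)) (dirXE v f) (dirXE v (dirX u f)) (dirXE u f).
  exact: sD_swap.
exact: E.
Qed.
Lemma sXY i j f : sX i (sY j f) = sY j (sX i f).
Proof.
have E u v : dirX u (dirY v f) = dirY v (dirX u f).
  rewrite (dirXE u (dirY v f)) (dirYE v f) (dirYE v (dirX u f)) (dirXE u f).
  exact: sD_swap.
exact: E.
Qed.
Lemma sYY i j f : sY i (sY j f) = sY j (sY i f).
Proof.
have E u v : dirY u (dirY v f) = dirY v (dirY u f).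
  rewrite (dirYE u (dirY v f)) (dirYE v f) (dirYE v (dirY u f)) (dirYE u f).
  exact: sD_swap.
exact: E.
Qed.

(** The Finsler geometry is phrased with functions of two vectors; their
    restrictions to [U] are computed in the ring of smooth functions on [U]. *)
Definition represents (f : V -> V -> R) (g : smfun U) :=
  forall x y, U (row_mx x y) -> f x y = g (row_mx x y).

Lemma represents_dx (k : 'I_n) f g : represents f g -> represents (dx k f) (sX k g).
Proof.
move=> fg x y Uxy; rewrite [sX k g]dirXE.
rewrite -(derive_agree (g := fun z => f (lsubmx z) (rsubmx z)) _ Uxy).
  by apply: derive_line => t; rewrite scale_row_mx add_row_mx row_mxKl row_mxKr scaler0 addr0.
by move=> z; rewrite -{1 4}(hsubmxK z); exact: fg.
Qed.

Lemma represents_dy k f g : represents f g -> represents (dy k f) (sY k g).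
Proof.
move=> fg x y Uxy; rewrite [sY k g]dirYE.
rewrite -(derive_agree (g := fun z => f (lsubmx z) (rsubmx z)) _ Uxy).
  by apply: derive_line => t; rewrite scale_row_mx add_row_mx row_mxKl row_mxKr scaler0 addr0.
by move=> z; rewrite -{1 4}(hsubmxK z); exact: fg.
Qed.

Lemma represents_sq f g : represents f g -> represents (sq f) (g * g).
Proof. by move=> fg x y Uxy; rewrite /sq smfun_mulE// fg// expr2. Qed.

Section SprayRepresentation.
Variables (F : V -> V -> R) (Fs : smfun U).
Hypothesis FsP : represents F Fs.

Local Notation hess x y := (\matrix_(i, l) sY i (sY l (Fs * Fs)) (row_mx x y)).

Lemma fundamental_tensorE x y : U (row_mx x y) ->
  fundamental_tensor F x y = 2^-1 *: (hess x y)^T.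
Proof.
move=> Uxy; apply/matrixP => i j; rewrite !mxE.
by rewrite (represents_dy _ (represents_dy _ (represents_sq FsP))).
Qed.

Lemma sprayE x y i : U (row_mx x y) -> spray F i x y =
  4^-1 * \sum_l invmx (fundamental_tensor F x y) i l *
    euler_lagrange (dX := sX) (dY := sY) (y := fibre) Fs l (row_mx x y).
Proof.
move=> Uxy; rewrite /spray; congr (_ * _); apply: eq_bigr => l _; congr (_ * _).
rewrite (represents_dx _ (represents_sq FsP))//.
rewrite /euler_lagrange smfun_subE// alongE smfun_sumE//; congr (_ - _).
apply: eq_bigr => k _; rewrite smfun_mulE// fibreE// row_mxKr mulrC.
by rewrite (represents_dy l (represents_dx k (represents_sq FsP)) Uxy) sXY.
Qed.

Lemma euler_lagrange_spray x y : U (row_mx x y) -> hess x y \in unitmx ->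
  forall l, euler_lagrange (dX := sX) (dY := sY) (y := fibre) Fs l (row_mx x y) =
    2 * \sum_i spray F i x y * hess x y i l.
Proof.
move=> Uxy Hu l.
have Hu' : fundamental_tensor F x y \in unitmx.
  by rewrite fundamental_tensorE// unitmxZ ?unitfE ?invr_eq0 ?pnatr_eq0// unitmx_tr.
pose E : 'cV[R]_n := \col_l euler_lagrange (dX := sX) (dY := sY) (y := fibre) Fs l (row_mx x y).
have GE : \col_i spray F i x y = 4^-1 *: (invmx (fundamental_tensor F x y) *m E).
  by apply/colP => i; rewrite !mxE sprayE//; congr (_ * _); apply: eq_bigr => k _; rewrite mxE.
have := congr1 (fun M => 4 *: (fundamental_tensor F x y *m M)) GE.
rewrite -scalemxAr scalerA divff ?pnatr_eq0// scale1r mulKVmx// => /colP /(_ l).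
rewrite [RHS]mxE => <-; rewrite fundamental_tensorE// -scalemxAl scalerA !mxE.
have -> : (4 : R) / 2 = 2 by field.
by congr (_ * _); apply: eq_bigr => i _; rewrite !mxE mulrC.
Qed.

(** Both sprays solve the same linear system, whose matrix is the fundamental
    tensor up to a factor. *)
Lemma represents_spray (G : 'I_n -> smfun U) :
  (forall x y, U (row_mx x y) -> hess x y \in unitmx) ->
  (forall l, 2 * (\sum_i G i * sY i (sY l (Fs * Fs))) =
     euler_lagrange (dX := sX) (dY := sY) (y := fibre) Fs l) ->
  forall i, represents (spray F i) (G i).
Proof.
move=> Hu GE i x y Uxy.
have H := euler_lagrange_spray Uxy (Hu x y Uxy).
pose g : 'rV[R]_n := \row_i G i (row_mx x y).
pose g' : 'rV[R]_n := \row_i spray F i x y.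
suff : g' *m hess x y = g *m hess x y.
  move=> /(congr1 (fun M => M *m invmx (hess x y))); rewrite !mulmxK ?Hu//.
  by move=> /rowP /(_ i); rewrite !mxE.
apply/rowP => l; apply: (mulfI (_ : 2 != 0 :> R)); first by rewrite pnatr_eq0.
rewrite !mxE; transitivity (euler_lagrange (dX := sX) (dY := sY) (y := fibre) Fs l (row_mx x y)).
  by rewrite H; congr (_ * _); apply: eq_bigr => k _; rewrite !mxE.
rewrite -GE smfun_mulE// smfun_natE// smfun_sumE//; congr (_ * _).
by apply: eq_bigr => k _; rewrite smfun_mulE// !mxE.
Qed.

End SprayRepresentation.

Lemma represents_jacobi F (G : 'I_n -> smfun U) i k x y :
  (forall i, represents (spray F i) (G i)) -> U (row_mx x y) ->
  riemann_curvature F i k x y =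
  jacobi (dX := sX) (dY := sY) (y := fibre) G i k (row_mx x y).
Proof.
move=> FG Uxy; rewrite /riemann_curvature.
rewrite /jacobi !smfun_subE// smfun_mulE// smfun_natE// (represents_dx _ (FG i))//.
rewrite spray_fieldE alongE smfun_subE// smfun_mulE// smfun_natE//.
rewrite smfun_sumE//.
rewrite smfun_sumE//.
rewrite smfun_sumE//.
have e1 : \sum_j y 0 j * dy k (dx j (spray F i)) x y =
  \sum_(j < n) (fibre j * sX j (connection (dY := sY) G i k)) (row_mx x y).
  apply: eq_bigr => j _; rewrite smfun_mulE// fibreE// row_mxKr.
  by rewrite (represents_dy k (represents_dx j (FG i)) Uxy) /connection (sXY j k (G i)).
have e2 : \sum_j spray F j x y * dy k (dy j (spray F i)) x y =
  \sum_(j < n) (G j * sY j (connection (dY := sY) G i k)) (row_mx x y).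
  apply: eq_bigr => j _; rewrite smfun_mulE// FG//.
  by rewrite (represents_dy k (represents_dy j (FG i)) Uxy) /connection (sYY k j (G i)).
have e3 : \sum_j dy j (spray F i) x y * dy k (spray F j) x y =
  \sum_(j < n) (connection (dY := sY) G i j * connection (dY := sY) G j k) (row_mx x y).
  by apply: eq_bigr => j _; rewrite smfun_mulE// !(represents_dy _ (FG _)).
have aux (a b c d b' c' d' : R) : b = b' -> c = c' -> d = d' ->
    a - b + 2 * c - d = a - (b' - 2 * c') - d' by move=> -> -> ->; ring.
exact: aux e1 e2 e3.
Qed.

End TangentFunctions.

(** * The cone of velocities on which a one-form is positive *)

Section ConeDomain.
Context {R : realType} {n : nat}.
Local Notation V := 'rV[R]_n.
Local Notation T := 'rV[R]_(n + n).
Variable B : domain V.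

Lemma sD_row (f : smfun B) v x : B x ->
  sD v f x = \sum_j v 0 j * sD (delta_mx 0 j) f x.
Proof.
move=> Bx; rewrite sDE// derive_row; last exact: smfun_diff.
by apply: eq_bigr => j _; rewrite sDE.
Qed.

Fact over_subproof : open ([set z | B (lsubmx z)] : set T).
Proof.
apply: (@open_comp _ _ (lsubmx : T -> V) B) => [x _|].
  exact: continuous_lsubmx.
exact: domain_open.
Qed.

Definition over : domain T := Domain over_subproof.

(** The value of the one-form [ds] on the velocity. *)
Definition slope (s : smfun B) : smfun over :=
  \sum_i base (U := over) (fun z Uz => Uz) (sD (delta_mx 0 i) s) * fibre over i.

Lemma slopeE s z : over z -> slope s z = sD (rsubmx z) s (lsubmx z).
Proof.
move=> Uz; rewrite /slope smfun_sumE// sD_row//; apply: eq_bigr => i _.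
by rewrite smfun_mulE// fibreE// baseE// mulrC.
Qed.

Fact cone_subproof (s : smfun B) :
  open ([set z | B (lsubmx z) /\ 0 < sD (rsubmx z) s (lsubmx z)] : set T).
Proof.
rewrite openE => z [Bz sz].
have c : {for z, continuous (slope s : T -> R^o)}.
  exact: (smfun_smooth (slope s) 0 z Bz).
rewrite -slopeE// in sz.
near=> z'.
have Bz' : B (lsubmx z').
  by near: z'; apply: open_nbhs_nbhs; split=> //; exact: over_subproof.
split=> //; rewrite -slopeE//.
near: z'; apply: (cvgr_gt (F := nbhs z) (f := (slope s : T -> R)) (slope s z)) => //.
Unshelve. all: by end_near. Qed.

(** The set on which a Kropina metric with one-form [ds] is a smooth function. *)
Definition cone (s : smfun B) : domain T := Domain (@cone_subproof s).

Lemma cone_over (s : smfun B) z : cone s z -> B (lsubmx z).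
Proof. by case. Qed.

Lemma coneP (s : smfun B) x y : B x -> 0 < sD y s x -> cone s (row_mx x y).
Proof. by move=> Bx sy; split; rewrite row_mxKl ?row_mxKr. Qed.

End ConeDomain.

Section Adapted.
Context {R : realType} {n : nat}.
Local Notation V := 'rV[R]_n.
Local Notation T := 'rV[R]_(n + n).
Variables (B : domain V) (s : smfun B).
Local Notation U := (cone s).
Local Notation lift := (base (@cone_over _ _ B s)).
Local Notation dX := (@sX R n U).
Local Notation dY := (@sY R n U).
Local Notation fib := (@fibre R n U).
Local Notation e i := (delta_mx 0 i : V).

Lemma dX_lift i f : dX i (lift f) = lift (sD (e i) f).
Proof. exact: dirX_base. Qed.

Lemma dY_lift i f : dY i (lift f) = 0.
Proof. exact: dirY_base. Qed.

Lemma liftE f x y : U (row_mx x y) -> lift f (row_mx x y) = f x.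
Proof. by move=> Uxy; rewrite baseE// row_mxKl. Qed.

Lemma fibE i x y : U (row_mx x y) -> fib i (row_mx x y) = y 0 i.
Proof. by move=> Uxy; rewrite fibreE// row_mxKr. Qed.

Definition grad (f : smfun B) i := lift (sD (e i) f).

Lemma dY_grad f i j : dY i (grad f j) = 0.
Proof. exact: dY_lift. Qed.

Lemma dX_grad f i j : dX i (grad f j) = dX j (grad f i).
Proof. by rewrite /grad !dX_lift sD_swap. Qed.

Lemma gradE f i x y : U (row_mx x y) -> grad f i (row_mx x y) = sD (e i) f x.
Proof. exact: liftE. Qed.

Lemma inB x y : U (row_mx x y) -> B x.
Proof. by case; rewrite row_mxKl. Qed.

Lemma along_liftE f x y : U (row_mx x y) ->
  along (dX := dX) (y := fib) (lift f) (row_mx x y) = sD y f x.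
Proof.
move=> Uxy; have Bx := inB Uxy; rewrite alongE smfun_sumE// sD_row//.
by apply: eq_bigr => i _; rewrite smfun_mulE// fibE// dX_lift liftE.
Qed.

Lemma rate_E f x y : U (row_mx x y) ->
  (\sum_i grad f i * fib i) (row_mx x y) = sD y f x.
Proof.
move=> Uxy; have Bx := inB Uxy; rewrite smfun_sumE// sD_row//.
by apply: eq_bigr => i _; rewrite smfun_mulE// fibE// gradE// mulrC.
Qed.

Lemma slope_gt0 x y : U (row_mx x y) -> 0 < sD y s x.
Proof. by case; rewrite row_mxKl row_mxKr. Qed.

Definition rate f := \sum_i grad f i * fib i.

Lemma slope_unit : exists c, rate s * c = 1.
Proof.
apply: smfun_inv => z Uz; rewrite -(hsubmxK z) in Uz *.
by rewrite rate_E// gt_eqF// slope_gt0.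
Qed.

Lemma along_rateE f x y : U (row_mx x y) ->
  along (dX := dX) (y := fib) (rate f) (row_mx x y) = sD y (sD y f) x.
Proof.
move=> Uxy; have Bx := inB Uxy.
rewrite der_sum smfun_sumE// sD_row//; apply: eq_bigr => i _.
rewrite derM along_y; last exact: sX_fibre.
rewrite mulr0 addr0 smfun_mulE// fibE// along_liftE// mulrC.
by rewrite sD_swap.
Qed.

Section KropinaInCone.
Variables (k k1 : smfun B) (c q : smfun U).
Hypothesis k_pos : forall x, B x -> 0 < k x.
Hypothesis kD : forall v, sD v k = k1 * sD v s.
Hypothesis bc : rate s * c = 1.
Hypothesis qH : euler (dY := dY) (y := fib) q = 2 * q.

Definition kropina_fun := lift k * rate s + q * c.

Lemma lift_kX i : dX i (lift k) = lift k1 * grad s i.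
Proof.
rewrite dX_lift kD; apply: smfunP => z Uz; rewrite smfun_mulE// !baseE//.
by rewrite smfun_mulE//; exact: cone_over Uz.
Qed.

Lemma kropina_funE x y : U (row_mx x y) -> kropina_fun (row_mx x y) =
  k x * sD y s x + q (row_mx x y) / sD y s x.
Proof.
move=> Uxy; have := congr1 (fun f : smfun U => f (row_mx x y)) bc.
rewrite smfun_mulE// rate_E// [RHS](smfun_natE 1 Uxy) => bc1.
have b0 := slope_gt0 Uxy.
rewrite smfun_addE// !smfun_mulE// liftE// rate_E//.
by congr (_ + _ * _); apply: (mulfI (lt0r_neq0 b0)); rewrite bc1 divff ?lt0r_neq0.
Qed.

Lemma kropina_fun_gt0 x y : U (row_mx x y) -> 0 <= q (row_mx x y) ->
  0 < kropina_fun (row_mx x y).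
Proof.
move=> Uxy q0; have b0 := slope_gt0 Uxy; rewrite kropina_funE//.
apply: ltr_pwDl; last by rewrite divr_ge0// ltW.
by rewrite mulr_gt0// k_pos//; exact: inB Uxy.
Qed.

Lemma kropina_fun_hessian i l : dY i (dY l (kropina_fun * kropina_fun)) =
  2 * (dY i kropina_fun * dY l kropina_fun + kropina_fun *
    (dY i (dY l q) * c - (c * c) * (dY l q * grad s i + dY i q * grad s l)
     + 2 * (q * (c * c * c)) * (grad s i * grad s l))).
Proof.
exact: (hessian_kropina (@sY_fibre _ _ U) q (dY_grad s)
  (fun i => dY_lift i k) erefl bc).
Qed.

Lemma euler_kropina_fun : euler (dY := dY) (y := fib) kropina_fun = kropina_fun.
Proof.
exact: (euler_kropina (@sY_fibre _ _ U) (dY_grad s) (fun i => dY_lift i k) erefl bc qH).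
Qed.

Local Opaque kropina_fun.

Lemma kropina_fun_hessian_unit x y (Q : 'M[R]_n) : U (row_mx x y) -> Q^T = Q ->
  q (row_mx x y) = bform Q y y ->
  (forall l, dY l q (row_mx x y) = 2 * (y *m Q) 0 l) ->
  (forall i l, dY i (dY l q) (row_mx x y) = 2 * Q i l) ->
  (forall v, 0 <= bform Q v v) ->
  (forall v, bform Q v v = 0 -> sD v s x = 0 -> v = 0) ->
  \matrix_(i, l) dY i (dY l (kropina_fun * kropina_fun)) (row_mx x y) \in unitmx.
Proof.
move=> Uxy QT qE qY qYY Qp Qd; have Bx := inB Uxy.
pose srow : 'rV[R]_n := \row_i sD (e i) s x.
pose f : 'rV[R]_n := \row_i dY i kropina_fun (row_mx x y).
have srowE v : (srow *m v^T) 0 0 = sD v s x.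
  by rewrite dotE sD_row//; apply: eq_bigr => i _; rewrite mxE mulrC.
have b0 := slope_gt0 Uxy.
have FY : (f *m y^T) 0 0 = kropina_fun (row_mx x y).
  rewrite -[X in _ = smfun_val X _]euler_kropina_fun smfun_sumE// dotE; apply: eq_bigr => i _.
  by rewrite smfun_mulE// fibE// mxE mulrC.
have q0 : 0 <= q (row_mx x y) by rewrite qE.
have := @kropina_hessian_unit _ _ (kropina_fun (row_mx x y)) (c (row_mx x y))
  (q (row_mx x y)) Q y srow f (sD y s x) (kropina_fun_gt0 Uxy q0) b0.
have bc1 : sD y s x * c (row_mx x y) = 1.
  by rewrite -rate_E// -smfun_mulE// bc [LHS](smfun_natE 1 Uxy).
move=> /(_ bc1 QT (esym qE) (srowE y) FY Qp).
have Qd' v : bform Q v v = 0 -> (srow *m v^T) 0 0 = 0 -> v = 0.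
  by rewrite srowE; exact: Qd.
move=> /(_ Qd'); set K := kropina_hessian _ _ _ _ _ _ _.
set H := \matrix_(_, _) _; suff -> : H = K by [].
apply/matrixP => i l; rewrite !mxE.
have HE := kropina_fun_hessian i l.
have M f1 f2 := smfun_mulE f1 f2 Uxy; have N2 := smfun_natE 2 Uxy.
have gi := gradE s i Uxy; have gl := gradE s l Uxy.
rewrite HE !M N2 (smfun_addE (dY i kropina_fun * dY l kropina_fun) _ Uxy) !M.
rewrite (smfun_addE (_ - _) _ Uxy) (smfun_subE _ _ Uxy) !M.
rewrite (smfun_addE (dY l q * grad s i) (dY i q * grad s l) Uxy) !M N2.
by rewrite qYY qY qY gi gl !mxE.
Qed.

Local Transparent kropina_fun.

End KropinaInCone.

End Adapted.

(** * Spray and curvature in terms of affine functions *)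

Section CurvatureInAdaptedCoordinates.
Context {R : realType} {n : nat}.
Local Notation V := 'rV[R]_n.
Variables (B : domain V) (w : 'I_n -> smfun B) (a0 : 'I_n).
Local Notation s := (w a0).
Local Notation U := (cone s).
Local Notation lift := (base (@cone_over _ _ B s)).
Local Notation dX := (@sX R n U).
Local Notation dY := (@sY R n U).
Local Notation fib := (@fibre R n U).
Local Notation e i := (delta_mx 0 i : V).
Local Notation J := (fun a => grad s (w a)).

Variables (k k1 k2 : smfun B) (F : V -> V -> R).
Hypothesis k_pos : forall x, B x -> 0 < k x.
Hypothesis kD : forall v, sD v k = k1 * sD v s.
Hypothesis k1D : forall v, sD v k1 = k2 * sD v s.
Hypothesis w_unit : forall x, B x -> \matrix_(a, i) sD (e i) (w a) x \in unitmx.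
Hypothesis FE : forall x y, B x -> 0 < sD y s x ->
  F x y = k x * sD y s x + (\sum_(a | a != a0) sD y (w a) x ^+ 2) / sD y s x.

Let half : smfun U := smfun_cst U 2^-1.

Let half2 : 2 * half = 1.
Proof.
apply: smfunP => z Uz; rewrite smfun_mulE// (smfun_natE 2 Uz) smfun_cstE//.
by rewrite (smfun_natE 1 Uz) divff// pnatr_eq0.
Qed.

Local Notation q := (transverse (y := fib) J a0).

Let speedE a : speed (y := fib) J a = rate s (w a).
Proof. by []. Qed.

Let qE x y : U (row_mx x y) -> q (row_mx x y) = \sum_(a | a != a0) sD y (w a) x ^+ 2.
Proof.
move=> Uxy; rewrite /transverse smfun_sumE//; apply: eq_bigr => a _.
by rewrite speedE smfun_mulE// rate_E// expr2.
Qed.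

Let q_ge0 x y : U (row_mx x y) -> 0 <= q (row_mx x y).
Proof. by move=> Uxy; rewrite qE// sumr_ge0// => a _; exact: sqr_ge0. Qed.

Let JY a i j : dY i (J a j) = 0. Proof. exact: dY_grad. Qed.
Let JX a i j : dX i (J a j) = dX j (J a i). Proof. exact: dX_grad. Qed.

Section WithSlopeInverse.
Variable c : smfun U.
Hypothesis bc : rate s s * c = 1.

Local Notation Fs := (kropina_fun k c q).

Let qH : euler (dY := dY) (y := fib) q = 2 * q.
Proof. exact: (euler_transverse (@sY_fibre _ _ U) JY). Qed.

Lemma represents_F : represents F Fs.
Proof.
move=> x y Uxy; have Bx := inB Uxy; rewrite FE//; last exact: slope_gt0 Uxy.
by rewrite kropina_funE// qE.
Qed.

Lemma adapted_hessian_unit x y : U (row_mx x y) ->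
  \matrix_(i, l) dY i (dY l (Fs * Fs)) (row_mx x y) \in unitmx.
Proof.
move=> Uxy; have Bx := inB Uxy.
pose M : 'M[R]_n := \matrix_(a, i) sD (e i) (w a) x.
pose M' : 'M[R]_n := \matrix_(a, i) (if a == a0 then 0 else M a i).
pose Q := M'^T *m M'.
have QE v : bform Q v v = \sum_(a | a != a0) sD v (w a) x ^+ 2.
  rewrite /bform /Q mulmxA -mulmxA mxE [RHS]big_mkcond; apply: eq_bigr => a _.
  have E : (M' *m v^T) a 0 = if a != a0 then sD v (w a) x else 0.
    rewrite mxE; case: eqP => /= aa.
      by rewrite big1// => j _; rewrite !mxE aa eqxx mul0r.
    rewrite sD_row//; apply: eq_bigr => j _; rewrite !mxE ifN; last exact/eqP.
    by rewrite mulrC.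
  rewrite -[v *m M'^T]trmxK trmx_mul trmxK [_^T _ _]mxE E.
  by case: ifP => _; rewrite ?mulr0// expr2.
have qY l : dY l q = 2 * \sum_(a | a != a0) speed (y := fib) J a * J a l.
  rewrite der_transverse; congr (_ * _); apply: eq_bigr => a _; congr (_ * _).
  exact: (dY_speed (@sY_fibre _ _ U) JY).
apply: (@kropina_fun_hessian_unit _ _ _ _ k c q k_pos bc qH x y Q) => //.
- by rewrite /Q trmx_mul trmxK.
- by rewrite qE// QE.
- move=> l; rewrite qY smfun_mulE// (smfun_natE 2 Uxy) smfun_sumE//; congr (_ * _).
  rewrite /Q mulmxA mxE [LHS]big_mkcond; apply: eq_bigr => a _.
  rewrite [M' a l]mxE [(y *m _) 0 a]mxE; case: eqP => /= aa; first by rewrite mulr0.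
  rewrite smfun_mulE// speedE rate_E// gradE// sD_row// mxE; congr (_ * _).
  apply: eq_bigr => j _; rewrite mxE mxE ifN ?mxE//; exact/eqP.
- move=> i l; rewrite qY derMn der_sum smfun_mulE// (smfun_natE 2 Uxy) smfun_sumE//.
  congr (_ * _); rewrite /Q mxE [LHS]big_mkcond; apply: eq_bigr => a _.
  rewrite mxE mxE [M' a l]mxE; case: eqP => /= aa; first by rewrite mulr0.
  rewrite derM JY mulr0 addr0 (dY_speed (@sY_fibre _ _ U) JY) smfun_mulE//.
  by rewrite !gradE// !mxE.
- by move=> v; rewrite QE sumr_ge0// => a _; exact: sqr_ge0.
- move=> v /eqP; rewrite QE psumr_eq0 => [/allP v0 sv|a _]; last exact: sqr_ge0.
  have Mv : M *m v^T = 0.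
    apply/matrixP => a j; rewrite mxE [RHS]mxE.
    transitivity (sD v (w a) x).
      rewrite sD_row//; apply: eq_bigr => i _; rewrite !mxE (ord1 j); exact: mulrC.
    have [->//|aa] := eqVneq a a0.
    by have := v0 a (mem_index_enum _); rewrite aa /= sqrf_eq0 => /eqP.
  have : v^T = 0 by rewrite -[v^T]mul1mx -(mulVmx (w_unit Bx)) -mulmxA Mv mulmx0.
  by move=> /(congr1 trmx); rewrite trmxK trmx0.
Qed.

Variables (P : smfun U) (G : 'I_n -> smfun U).
Hypothesis PF : 2 * (P * Fs) = lift k1 * (rate s s * rate s s).
Hypothesis JG : forall a, \sum_i J a i * G i = P * speed (y := fib) J a
  + half * along (dX := dX) (y := fib) (speed (y := fib) J a).

Let kY i : dY i (lift k) = 0. Proof. exact: dY_lift. Qed.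
Let k1Y i : dY i (lift k1) = 0. Proof. exact: dY_lift. Qed.
Let k2Y i : dY i (lift k2) = 0. Proof. exact: dY_lift. Qed.
Let kX i : dX i (lift k) = lift k1 * J a0 i. Proof. exact: lift_kX. Qed.
Let k1X i : dX i (lift k1) = lift k2 * J a0 i. Proof. exact: lift_kX. Qed.

Lemma represents_adapted_spray i : represents (spray F i) (G i).
Proof.
apply: (represents_spray represents_F adapted_hessian_unit) => l.
exact: (spray_euler_lagrange (@sX_fibre _ _ U) (@sY_fibre _ _ U) half2 JY JX JG
  kY kX bc PF).
Qed.

Let PE x y : U (row_mx x y) ->
  P (row_mx x y) = k1 x * sD y s x ^+ 2 / (2 * F x y).
Proof.
move=> Uxy; have M f1 f2 := smfun_mulE f1 f2 Uxy.
have Bx := inB Uxy.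
have F0 : F x y != 0.
  by rewrite (represents_F Uxy) gt_eqF// kropina_fun_gt0// q_ge0.
have := congr1 (fun g : smfun U => g (row_mx x y)) PF.
rewrite !M (smfun_natE 2 Uxy) -(represents_F Uxy) (liftE k1 Uxy) (rate_E s Uxy).
by rewrite expr2 => <-; field.
Qed.

Lemma adapted_spray_at x y a : U (row_mx x y) ->
  \sum_i sD (e i) (w a) x * spray F i x y =
  k1 x * sD y s x ^+ 2 / (2 * F x y) * sD y (w a) x + 2^-1 * sD y (sD y (w a)) x.
Proof.
move=> Uxy; have M f1 f2 := smfun_mulE f1 f2 Uxy.
have := congr1 (fun g : smfun U => g (row_mx x y)) (JG a).
rewrite (smfun_sumE _ _ _ Uxy) (smfun_addE (P * _) _ Uxy) !M (smfun_cstE _ Uxy).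
rewrite PE// (along_rateE _ Uxy) (rate_E _ Uxy) => <-.
by apply: eq_bigr => i _; rewrite M (gradE _ _ Uxy) (represents_adapted_spray i Uxy).
Qed.

(** The Jacobian matrix of [w] is invertible, so the identity [J_jacobi] between
    its products determines the curvature. *)
Lemma adapted_curvature_at x y i j : U (row_mx x y) ->
  riemann_curvature F i j x y =
  (3 * k1 x ^+ 2 * sD y s x ^+ 4 / (2 * F x y) - k2 x * sD y s x ^+ 3)
    / (2 * F x y ^+ 3) * F x y ^+ 2 *
    ((i == j)%:R - (F x y ^+ 2)^-1 * y 0 i * ell F j x y).
Proof.
move=> Uxy; have M f1 f2 := smfun_mulE f1 f2 Uxy; have Bx := inB Uxy.
have Fpos : F x y != 0.
  by rewrite (represents_F Uxy) gt_eqF// kropina_fun_gt0// q_ge0.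
have FxE := represents_F Uxy.
rewrite (represents_jacobi i j represents_adapted_spray Uxy).
set rho := jacobi _ _ _; set z := row_mx x y.
pose tau := jacobi_form (dX := dX) (dY := dY) (y := fib) P G j z.
pose Xi := jacobi_trace (dX := dX) (dY := dY) (y := fib) P G z.
have jE : rho z = y 0 i * tau + Xi * (i == j)%:R.
  pose r : 'cV[R]_n := \col_i jacobi (dX := dX) (dY := dY) (y := fib) G i j z.
  pose r' : 'cV[R]_n := \col_i (y 0 i * tau + Xi * (i == j)%:R).
  pose W : 'M[R]_n := \matrix_(a, i) sD (e i) (w a) x.
  suff : W *m r = W *m r'.
    move=> /(congr1 (mulmx (invmx W))); rewrite !mulKmx ?w_unit//.
    by move=> /colP /(_ i); rewrite !mxE.
  apply/colP => a; rewrite !mxE.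
  have := congr1 (fun g : smfun U => g z)
    (J_jacobi (@sXX _ _ U) (@sXY _ _ U) (@sX_fibre _ _ U) (@sY_fibre _ _ U) half2 JY JX JG a j).
  rewrite (smfun_sumE _ _ _ Uxy) (smfun_addE (speed J a * _) _ Uxy) !M => H.
  transitivity (sD y (w a) x * tau + Xi * sD (e j) (w a) x).
    rewrite -(rate_E (w a) Uxy) -(gradE (w a) j Uxy); apply: etrans H.
    by apply: eq_bigr => i' _; rewrite M (gradE _ _ Uxy) !mxE.
  rewrite (sD_row _ _ Bx) mulr_suml.
  under [in RHS]eq_bigr => i' _ do rewrite !mxE mulrDr.
  rewrite big_split /=; congr (_ + _).
    by apply: eq_bigr => i' _; rewrite mulrCA mulrA.
  rewrite -[LHS](sum_delta (fun i' => Xi * sD (e i') (w a) x) j).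
  by apply: eq_bigr => i' _; rewrite [RHS]mulrCA [RHS]mulrA [RHS]mulrC eq_sym.
have tauE : tau * F x y = - (Xi * dY j Fs z).
  have := congr1 (fun g : smfun U => g z)
    (jacobi_form_kropina (@sXY _ _ U) (@sYY _ _ U) (@sX_fibre _ _ U) (@sY_fibre _ _ U) half2
      JY JX JG kY k1Y k2Y kX k1X bc PF j).
  by rewrite M (smfun_oppE _ Uxy) M FxE.
have XiE : 2 * (Xi * F x y) = 3 * (k1 x * sD y s x ^+ 2 / (2 * F x y) *
    (k1 x * sD y s x ^+ 2)) - k2 x * sD y s x ^+ 3.
  have := congr1 (fun g : smfun U => g z)
    (jacobi_trace_kropina (@sY_fibre _ _ U) half2
      JY JG kY k1Y kX k1X bc PF).
  rewrite (smfun_subE _ _ Uxy) !M (smfun_natE 2 Uxy) (smfun_natE 3 Uxy) PE//.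
  by rewrite (liftE k1 Uxy) (liftE k2 Uxy) (rate_E _ Uxy) FxE => ->; ring.
have ellE : ell F j x y = F x y * dY j Fs z.
  have := congr1 (fun g : smfun U => g z)
    (euler_hessian (@sYY _ _ U) (@sY_fibre _ _ U) (euler_kropina_fun k bc qH) j).
  rewrite (smfun_sumE _ _ _ Uxy) !M (smfun_natE 2 Uxy) -FxE => H.
  apply: (mulfI (_ : 2 != 0 :> R)); first by rewrite pnatr_eq0.
  rewrite -H /ell mulr_sumr; apply: eq_bigr => i' _; rewrite M (fibE _ Uxy).
  rewrite (fundamental_tensorE represents_F Uxy) !mxE.
  rewrite -[X in 2 * X]mulrA mulVKf ?pnatr_eq0// (sYY j i' (Fs * Fs)).
  exact: mulrC.
rewrite jE ellE.
have -> : tau = - (Xi * dY j Fs z) / F x y by rewrite -tauE mulfK.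
have -> : Xi = (3 * (k1 x * sD y s x ^+ 2 / (2 * F x y) *
    (k1 x * sD y s x ^+ 2)) - k2 x * sD y s x ^+ 3) / (2 * F x y).
  by rewrite -XiE; field.
set D := dY j Fs z; move: Fpos D (k1 x) (k2 x) (sD y s x) (y 0 i) (i == j)%:R.
move: (F x y) => F0 F0n D k1x k2x sx yi dij.
by field.
Qed.

End WithSlopeInverse.

(** Cramer's rule in the ring of smooth functions solves [J G = P Y + ...]: the
    determinant of [J] is nowhere zero, hence a unit. *)
Lemma adapted_spray_exists : exists c P G,
  [/\ rate s s * c = 1,
      2 * (P * kropina_fun k c q) = lift k1 * (rate s s * rate s s) &
      forall a, \sum_i J a i * G i = P * speed (y := fib) J a
        + half * along (dX := dX) (y := fib) (speed (y := fib) J a)].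
Proof.
have [c bc] := slope_unit s.
have [f Ff] : exists f, kropina_fun k c q * f = 1.
  apply: smfun_inv => z Uz; rewrite -(hsubmxK z) in Uz *.
  by rewrite gt_eqF// kropina_fun_gt0// q_ge0.
pose Jm : 'M[smfun U]_n := \matrix_(a, i) J a i.
have [di Jdi] : exists di, \det Jm * di = 1.
  apply: smfun_inv => z Uz; rewrite -[smfun_val _ _]/(@at_pt _ _ U (exist _ z Uz) _).
  rewrite -det_map_mx -unitfE -[_ \is a GRing.unit]/(_ \in unitmx).
  rewrite -(hsubmxK z) in Uz *; have Bx := inB Uz.
  have := w_unit Bx; set W := \matrix_(_, _) _; set W' := map_mx _ _.
  suff -> : W = W' by [].
  by apply/matrixP => a i; rewrite !mxE; exact/esym/(gradE (w a) i Uz).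
pose P := half * (lift k1 * (rate s s * rate s s)) * f.
pose Y a := P * speed (y := fib) J a
    + half * along (dX := dX) (y := fib) (speed (y := fib) J a).
pose Jinv : 'M[smfun U]_n := di *: \adj Jm.
exists c, P, (fun i => \sum_a Jinv i a * Y a); split => //.
  transitivity ((2 * half) * (kropina_fun k c q * f) * (lift k1 * (rate s s * rate s s))).
    by rewrite /P; ring.
  by rewrite half2 Ff !mul1r.
move=> a; pose v : 'cV[smfun U]_n := \col_a Y a.
have E : Jm *m (Jinv *m v) = v.
  rewrite mulmxA /Jinv -scalemxAr mul_mx_adj.
  by rewrite -[RHS]mul1mx; congr (_ *m _); rewrite scale_scalar_mx mulrC Jdi.
have := congr1 (fun M => fun_of_matrix M a 0) E; rewrite [v a 0]mxE => Ea.
rewrite -[RHS]Ea mxE; apply: eq_bigr => i _; rewrite [Jm a i]mxE mxE; congr (_ * _).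
by apply: eq_bigr => a' _; rewrite [v a' 0]mxE.
Qed.

(** The transformation rule of the spray [P y] under the change of variables
    [w]; it determines the spray of [F] in any chart in terms of the functions
    [w] alone. *)
Theorem adapted_spray x y a : B x -> 0 < sD y s x ->
  \sum_i sD (e i) (w a) x * spray F i x y =
  k1 x * sD y s x ^+ 2 / (2 * F x y) * sD y (w a) x + 2^-1 * sD y (sD y (w a)) x.
Proof.
move=> Bx sy; have [c [P [G [bc PF JG]]]] := adapted_spray_exists.
exact: (adapted_spray_at bc PF JG a (coneP Bx sy)).
Qed.

(** The fraction in front is the flag curvature as a function of [k], its two
    derivatives with respect to [s], and [ds(y)]. *)
Theorem adapted_curvature x y i j : B x -> 0 < sD y s x ->
  riemann_curvature F i j x y =
  (3 * k1 x ^+ 2 * sD y s x ^+ 4 / (2 * F x y) - k2 x * sD y s x ^+ 3)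
    / (2 * F x y ^+ 3) * F x y ^+ 2 *
    ((i == j)%:R - (F x y ^+ 2)^-1 * y 0 i * ell F j x y).
Proof.
move=> Bx sy; have [c [P [G [bc PF JG]]]] := adapted_spray_exists.
exact: (adapted_curvature_at bc PF JG i j (coneP Bx sy)).
Qed.

End CurvatureInAdaptedCoordinates.

(** * The Hamel equation *)

Section SmoothForms.
Context {R : realType} {n : nat}.
Local Notation V := 'rV[R]_n.
Variable B : domain V.

Record smooth_form := SmoothForm {
  sform :> V -> V -> smfun B;
  sformC : forall u v, sform u v = sform v u;
  sform_lin : forall a u v w,
    sform (a *: u + v) w = smfun_cst B a * sform u w + sform v w }.

Variable Q : smooth_form.
Local Notation e i := (delta_mx 0 i : V).

Lemma sform_at a u v w x : B x -> Q (a *: u + v) w x = a * Q u w x + Q v w x.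
Proof.
by move=> Bx; rewrite sform_lin (smfun_addE _ _ Bx) (smfun_mulE _ _ Bx) smfun_cstE.
Qed.

Lemma sform_atr a u v w x : B x -> Q w (a *: u + v) x = a * Q w u x + Q w v x.
Proof. by move=> Bx; rewrite !(sformC Q w) sform_at. Qed.

Lemma sD_cst v a : sD v (smfun_cst B a) = 0.
Proof.
apply: smfunP => x Bx; rewrite -(derive_agree (g := cst a : V -> R^o) v Bx).
  by rewrite derive_cst [RHS](smfun_natE 0 Bx).
by move=> z Bz; rewrite smfun_cstE.
Qed.

Lemma sD_sform z a u v w x : B x ->
  sD z (Q (a *: u + v) w) x = a * sD z (Q u w) x + sD z (Q v w) x.
Proof.
move=> Bx; rewrite sform_lin sD_add sD_mul sD_cst mul0r add0r.
by rewrite (smfun_addE _ _ Bx) (smfun_mulE _ _ Bx) smfun_cstE.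
Qed.

Lemma sD_sformr z a u v w x : B x ->
  sD z (Q w (a *: u + v)) x = a * sD z (Q w u) x + sD z (Q w v) x.
Proof. by move=> Bx; rewrite !(sformC Q w) sD_sform. Qed.

Lemma sum_row (f : V -> R) u :
  (forall a u v, f (a *: u + v) = a * f u + f v) ->
  f u = \sum_i u 0 i * f (e i).
Proof.
move=> fl; have f0 : f 0 = 0.
  by have := fl 1 0 0; rewrite scaler0 addr0 mul1r => /esym/eqP; rewrite -subr_eq0 addrK => /eqP.
rewrite {1}(row_sum_delta u).
suff H (r : seq 'I_n) : f (\sum_(j <- r) u 0 j *: e j) = \sum_(j <- r) u 0 j * f (e j).
  exact: H.
elim: r => [|i r ih]; first by rewrite !big_nil.
by rewrite !big_cons fl ih.
Qed.

Lemma sform_sum u v x : B x -> Q u v x = \sum_i u 0 i * Q (e i) v x.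
Proof. by move=> Bx; apply: (sum_row (f := fun u => Q u v x)) => *; exact: sform_at. Qed.

Lemma sform_sumr u v x : B x -> Q u v x = \sum_i v 0 i * Q u (e i) x.
Proof. by move=> Bx; apply: (sum_row (f := fun v => Q u v x)) => *; exact: sform_atr. Qed.

Lemma sD_sform_sum z u v x : B x ->
  sD z (Q u v) x = \sum_i u 0 i * sD z (Q (e i) v) x.
Proof. by move=> Bx; apply: (sum_row (f := fun u => sD z (Q u v) x)) => *; exact: sD_sform. Qed.

Lemma sD_sform_sumr z u v x : B x ->
  sD z (Q u v) x = \sum_i v 0 i * sD z (Q u (e i)) x.
Proof. by move=> Bx; apply: (sum_row (f := fun v => sD z (Q u v) x)) => *; exact: sD_sformr. Qed.

End SmoothForms.

Section HamelEquation.
Context {R : realType} {n : nat}.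
Local Notation V := 'rV[R]_n.
Variables (B : domain V) (s : smfun B) (Q : smooth_form B).
Local Notation U := (cone s).
Local Notation lift := (base (@cone_over _ _ B s)).
Local Notation dX := (@sX R n U).
Local Notation dY := (@sY R n U).
Local Notation fib := (@fibre R n U).
Local Notation e i := (delta_mx 0 i : V).

Variables (k k1 : smfun B) (F P : V -> V -> R).
Hypothesis k_pos : forall x, B x -> 0 < k x.
Hypothesis kD : forall v, sD v k = k1 * sD v s.
Hypothesis FE : forall x y, B x -> 0 < sD y s x ->
  F x y = k x * sD y s x + Q y y x / sD y s x.
Hypothesis Q_ge0 : forall x v, B x -> 0 <= Q v v x.
Hypothesis Q_def : forall x v, B x -> Q v v x = 0 -> sD v s x = 0 -> v = 0.
Hypothesis projective : forall x y i, B x -> 0 < sD y s x ->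
  spray F i x y = P x y * y 0 i.

Let q : smfun U := \sum_i \sum_j lift (Q (e i) (e j)) * (fib i * fib j).

Let dYq l : dY l q = 2 * \sum_j lift (Q (e l) (e j)) * fib j.
Proof.
rewrite der_sum.
have E i : dY l (\sum_j lift (Q (e i) (e j)) * (fib i * fib j)) =
    (l == i)%:R * (\sum_j lift (Q (e i) (e j)) * fib j) + lift (Q (e i) (e l)) * fib i.
  rewrite der_sum mulr_sumr -[X in _ = _ + X](sum_delta (fun j => lift (Q (e i) (e j)) * fib i) l).
  rewrite -big_split /=; apply: eq_bigr => j _.
  by rewrite derM dY_lift derM !sY_fibre; ring.
under eq_bigr => i _ do rewrite E.
rewrite big_split /= sum_delta [2 * _](_ : _ = \sum_j lift (Q (e l) (e j)) * fib j
  + \sum_j lift (Q (e l) (e j)) * fib j); last by ring.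
by congr (_ + _); apply: eq_bigr => i _; rewrite sformC.
Qed.

Let dYYq i l : dY i (dY l q) = 2 * lift (Q (e l) (e i)).
Proof.
rewrite dYq derMn; congr (_ * _).
by rewrite (dY_linear (@sY_fibre _ _ U))// => i' j'; rewrite dY_lift.
Qed.

Let qH : euler (dY := dY) (y := fib) q = 2 * q.
Proof.
rewrite /euler /= /q mulr_sumr; apply: eq_bigr => i _.
rewrite dYq mulrCA; congr (_ * _); rewrite mulr_sumr; apply: eq_bigr => j _; ring.
Qed.

Section AtPoint.
Variables (x y : V).
Hypothesis Uxy : U (row_mx x y).
Local Notation z := (row_mx x y).
Let Bx : B x. Proof. exact: inB Uxy. Qed.
Let M f g : (f * g : smfun U) z = f z * g z. Proof. exact: smfun_mulE. Qed.
Let S (I : finType) (f : I -> smfun U) : (\sum_i f i) z = \sum_i f i z.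
Proof. exact: smfun_sumE. Qed.

Lemma q_at : q z = Q y y x.
Proof.
rewrite S (sform_sum _ _ _ Bx); apply: eq_bigr => i _.
rewrite S (sform_sumr _ _ _ Bx) mulr_sumr; apply: eq_bigr => j _.
by rewrite !M (liftE _ Uxy) !(fibE _ Uxy) mulrC -mulrA.
Qed.

Lemma dY_q_at l : dY l q z = 2 * Q (e l) y x.
Proof.
rewrite dYq M (smfun_natE 2 Uxy) S; congr (_ * _).
rewrite (sform_sumr _ _ _ Bx); apply: eq_bigr => j _.
by rewrite M (liftE _ Uxy) (fibE _ Uxy) mulrC.
Qed.

Lemma dX_q_at l : dX l q z = sD (e l) (Q y y) x.
Proof.
rewrite der_sum S (sD_sform_sum _ _ _ _ Bx); apply: eq_bigr => i _.
rewrite der_sum S (sD_sform_sumr _ _ _ _ Bx) mulr_sumr; apply: eq_bigr => j _.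
rewrite derM derM !sX_fibre mul0r mulr0 addr0 mulr0 addr0 dX_lift.
by rewrite !M (liftE _ Uxy) !(fibE _ Uxy) mulrC -mulrA.
Qed.

Lemma along_q_at : along (dX := dX) (y := fib) q z = sD y (Q y y) x.
Proof.
rewrite alongE S (sD_row _ _ Bx); apply: eq_bigr => i _.
by rewrite M (fibE _ Uxy) dX_q_at.
Qed.

Lemma along_dY_q_at l : along (dX := dX) (y := fib) (dY l q) z = 2 * sD y (Q (e l) y) x.
Proof.
rewrite dYq derMn M (smfun_natE 2 Uxy); congr (_ * _).
rewrite der_sum S (sD_sform_sumr _ _ _ _ Bx); apply: eq_bigr => j _.
rewrite derM along_y; last exact: sX_fibre.
by rewrite mulr0 addr0 M (along_liftE _ Uxy) (fibE _ Uxy) mulrC.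
Qed.

End AtPoint.

Section WithSlopeInverse.
Variable c : smfun U.
Hypothesis bc : rate s s * c = 1.
Local Notation Fs := (kropina_fun k c q).

Let FsP : represents F Fs.
Proof.
move=> x y Uxy; have Bx := inB Uxy; rewrite FE//; last exact: slope_gt0 Uxy.
by rewrite kropina_funE// q_at.
Qed.

Let hess_unit x y : U (row_mx x y) ->
  \matrix_(i, l) dY i (dY l (Fs * Fs)) (row_mx x y) \in unitmx.
Proof.
move=> Uxy; have Bx := inB Uxy.
pose Qm : 'M[R]_n := \matrix_(i, j) Q (e i) (e j) x.
have yQ v l : (v *m Qm) 0 l = Q v (e l) x.
  by rewrite mxE (sform_sum _ _ _ Bx); apply: eq_bigr => i _; rewrite mxE.
have QE v : bform Qm v v = Q v v x.
  rewrite /bform mxE (sform_sumr _ _ _ Bx); apply: eq_bigr => i _.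
  by rewrite yQ mxE mulrC.
apply: (@kropina_fun_hessian_unit _ _ _ _ k c q k_pos bc qH x y Qm) => //.
- by apply/matrixP => i j; rewrite !mxE sformC.
- by rewrite QE q_at.
- by move=> l; rewrite dY_q_at// yQ sformC.
- move=> i l; rewrite dYYq (smfun_mulE _ _ Uxy) (smfun_natE 2 Uxy) (liftE _ Uxy).
  by rewrite mxE sformC.
- by move=> v; rewrite QE; exact: Q_ge0.
- by move=> v; rewrite QE; exact: Q_def.
Qed.

(** If [G = P y], contracting with the fundamental tensor gives
    [F_(x^k y^l) y^k - F_(x^l) = m F_(y^l)] for some factor [m]. Contracting with
    [y^l] kills the left side, while [y^l F_(y^l) = F] is positive, so [m = 0]. *)
Lemma hamel_equation l : along (dX := dX) (y := fib) (dY l Fs) = dX l Fs.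
Proof.
have FH := euler_kropina_fun k bc qH.
apply: smfunP => z Uz; rewrite -(hsubmxK z) in Uz *.
set x := lsubmx z in Uz *; set y := rsubmx z in Uz *.
have Bx := inB Uz; have sy := slope_gt0 Uz.
have M f g : (f * g : smfun U) (row_mx x y) = f (row_mx x y) * g (row_mx x y).
  exact: smfun_mulE.
have F0 : 0 < Fs (row_mx x y) by rewrite kropina_fun_gt0// q_at// Q_ge0.
have EL i : along (dX := dX) (y := fib) (dY i Fs) (row_mx x y) - dX i Fs (row_mx x y) =
    (2 * P x y - along (dX := dX) (y := fib) Fs (row_mx x y) / Fs (row_mx x y))
      * dY i Fs (row_mx x y).
  have := euler_lagrange_spray FsP Uz (hess_unit Uz) i.
  have -> : \sum_i0 spray F i0 x y * (\matrix_(i1, l0) dY i1 (dY l0 (Fs * Fs)) (row_mx x y)) i0 i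
      = P x y * (2 * (Fs (row_mx x y) * dY i Fs (row_mx x y))).
    have := congr1 (fun g : smfun U => g (row_mx x y))
      (euler_hessian (@sYY _ _ U) (@sY_fibre _ _ U) FH i).
    rewrite (smfun_sumE _ _ _ Uz) !M (smfun_natE 2 Uz) => <-.
    rewrite mulr_sumr; apply: eq_bigr => j _.
    by rewrite projective// mxE M (fibE _ Uz) mulrA.
  rewrite euler_lagrangeE M (smfun_natE 2 Uz) (smfun_addE (along Fs * _) _ Uz) !M.
  rewrite (smfun_subE _ _ Uz).
  move: (smfun_val (along (dY i Fs)) _) (smfun_val (dX i Fs) _) (smfun_val (along Fs) _)
    (smfun_val (dY i Fs) _) F0; move: (smfun_val Fs _) (P x y) => f p a b c' d f0 H.
  have fn : f != 0 by rewrite gt_eqF.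
  apply: (mulfI fn); apply: (mulfI (_ : 2 != 0 :> R)); first by rewrite pnatr_eq0.
  have -> : 2 * (f * ((2 * p - c' / f) * d)) = 2 * (p * (2 * (f * d))) - 2 * (c' * d).
    by field.
  by rewrite -H; ring.
have := congr1 (fun g : smfun U => g (row_mx x y)) (hamel_contract (@sX_fibre _ _ U) FH).
rewrite (smfun_sumE _ _ _ Uz) [RHS](smfun_natE 0 Uz).
under eq_bigr => i _ do rewrite M (fibE _ Uz) (smfun_subE _ _ Uz) EL mulrCA.
rewrite -mulr_sumr.
have -> : \sum_(i < n) y 0 i * dY i Fs (row_mx x y) = Fs (row_mx x y).
  have := congr1 (fun g : smfun U => g (row_mx x y)) FH.
  rewrite /euler /= (smfun_sumE _ _ _ Uz) => E; rewrite -[RHS]E.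
  by apply: eq_bigr => i _; rewrite M (fibE _ Uz).
move/eqP; rewrite mulf_eq0 (gt_eqF F0) orbF => /eqP E0.
by apply/eqP; rewrite -subr_eq0 EL E0 mul0r.
Qed.

End WithSlopeInverse.

(** The Hamel equation is linear in the free index, which may therefore be
    replaced by a vector [w]. *)
Theorem hamel_at x y w : B x -> 0 < sD y s x ->
  sD w s x * (2 * Q y y x * sD y (sD y s) x - sD y s x * sD y (Q y y) x) =
  sD y s x * (2 * Q w y x * sD y (sD y s) x + sD y s x * sD w (Q y y) x
    - sD y s x * (2 * sD y (Q w y) x)).
Proof.
move=> Bx sy; have Uxy := coneP Bx sy.
have [c bc] := slope_unit s.
have M f g : (f * g : smfun U) (row_mx x y) = f (row_mx x y) * g (row_mx x y).
  exact: smfun_mulE.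
have H l : sD (e l) s x * (2 * Q y y x * sD y (sD y s) x - sD y s x * sD y (Q y y) x) =
  sD y s x * (2 * Q (e l) y x * sD y (sD y s) x + sD y s x * sD (e l) (Q y y) x
    - sD y s x * (2 * sD y (Q (e l) y) x)).
  have := congr1 (fun g : smfun U => g (row_mx x y))
    (hamel_polynomial (@sX_fibre _ _ U) (@sY_fibre _ _ U) (@dY_grad _ _ _ s s)
      (@dX_grad _ _ _ s s) (fun i => dY_lift s i k)
      (lift_kX kD) erefl bc (hamel_equation bc l)).
  rewrite !M (smfun_subE _ _ Uxy) (smfun_subE _ _ Uxy) (smfun_addE (dY l q * _) _ Uxy) !M.
  rewrite (smfun_natE 2 Uxy) (rate_E s Uxy) (along_rateE s Uxy) (gradE s l Uxy).
  by rewrite (q_at Uxy) (along_q_at Uxy) (dY_q_at Uxy) (dX_q_at Uxy) (along_dY_q_at Uxy).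
set K := (2 * Q y y x * _ - _) in H *.
move: (sD y s x) (sD y (sD y s) x) H => a b H.
rewrite (sD_row s w Bx) mulr_suml; under eq_bigr => l _ do rewrite -(mulrA _ _ K) H.
rewrite (sform_sum _ w y Bx) (sD_row (Q y y) w Bx) (sD_sform_sum Q y w y Bx).
rewrite !(mulr_sumr, mulr_suml) -big_split -sumrB mulr_sumr /=.
by apply: eq_bigr => l _; ring.
Qed.

End HamelEquation.

(** * The Weyl one-form *)

Section PointwiseHamel.
Context {R : realFieldType} {V : lmodType R}.
Variables (b : V -> R) (S q : V -> V -> R) (T : V -> V -> V -> R).
Hypothesis bl : forall a u v, b (a *: u + v) = a * b u + b v.
Hypothesis Sl : forall a u v w, S (a *: u + v) w = a * S u w + S v w.
Hypothesis SC : forall u v, S u v = S v u.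
Hypothesis ql : forall a u v w, q (a *: u + v) w = a * q u w + q v w.
Hypothesis qC : forall u v, q u v = q v u.
Hypothesis T1 : forall a u v w z, T (a *: u + v) w z = a * T u w z + T v w z.
Hypothesis T2 : forall a u v w z, T z (a *: u + v) w = a * T z u w + T z v w.
Hypothesis TC : forall u v w, T u v w = T u w v.
Hypothesis hamel : forall y w, 0 < b y ->
  b w * (2 * q y y * S y y - b y * T y y y) =
  b y * (2 * q w y * S y y + b y * T w y y - b y * (2 * T y w y)).
Variable n0 : V.
Hypothesis bn : b n0 = 1.
Hypothesis qn : forall v, q n0 v = 0.
Hypothesis Tn : forall y, T n0 y y = 2 * T y n0 y.
Hypothesis q_pos : forall v, b v = 0 -> v != 0 -> 0 < q v v.

Let Sr a u v w : S w (a *: u + v) = a * S w u + S w v.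
Proof. by rewrite !(SC w) Sl. Qed.
Let qr a u v w : q w (a *: u + v) = a * q w u + q w v.
Proof. by rewrite !(qC w) ql. Qed.
Let T3 a u v w z : T z w (a *: u + v) = a * T z w u + T z w v.
Proof. by rewrite !(TC z w) T2. Qed.
Let b0 : b 0 = 0.
Proof. by have := bl (-1) 0 0; rewrite scaler0 addr0; lra. Qed.
Let S0 v : S 0 v = 0.
Proof. by have := Sl (-1) 0 0 v; rewrite scaler0 addr0; lra. Qed.

Let step1 y : 0 < b y -> 2 * q y y * S y y = b y * T y y y.
Proof.
move=> y0; have := hamel n0 y0; rewrite bn qn Tn.
rewrite mul1r mulr0 mul0r add0r subrr mulr0 => /eqP.
by rewrite subr_eq0 => /eqP.
Qed.

Let S_ker w : b w = 0 -> S w w = 0.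
Proof.
move=> bw; have [->|w0] := eqVneq w 0; first exact: S0.
have qw := q_pos bw w0.
pose c1 := 4 * q w w * S w n0 - T w w w.
pose c2 := 2 * q w w * S n0 n0 - (T n0 w w + T w n0 w + T w w n0).
pose c3 := - (T n0 n0 w + T n0 w n0 + T w n0 n0).
pose c4 := - T n0 n0 n0.
(* Along [r n0 + w] the relation of [step1] is a polynomial in [r] of degree 4
   that vanishes for every positive [r]; its constant term is what is wanted. *)
have H (r : R) : 0 < r ->
    2 * q w w * S w w + c1 * r + c2 * r ^+ 2 + c3 * r ^+ 3 + c4 * r ^+ 4 = 0.
  move=> r0; have br : b (r *: n0 + w) = r by rewrite bl bn bw mulr1 addr0.
  have := step1 (y := r *: n0 + w); rewrite br => /(_ r0).
  rewrite !(ql, qr) !(Sl, Sr) !(T1, T2, T3) qn (qC w) qn (SC w n0).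
  by rewrite /c1 /c2 /c3 /c4 (SC w n0); lra.
have q0 : 2 * q w w * S w w = 0.
  have e1 := H 1 ltr01; have e2 := H 2 (ltr0n _ 2); have e3 := H 3 (ltr0n _ 3).
  have e4 := H 4 (ltr0n _ 4); have e5 := H 5 (ltr0n _ 5); lra.
by move: q0 => /eqP; rewrite !mulf_eq0 pnatr_eq0 /= (gt_eqF qw) => /eqP.
Qed.

Let S_ker2 u v : b u = 0 -> b v = 0 -> S u v = 0.
Proof.
move=> bu bv; have : S (1 *: u + v) (1 *: u + v) = 0.
  by apply: S_ker; rewrite bl bu bv mulr0 addr0.
by rewrite !(Sl, Sr) !S_ker// (SC v u); lra.
Qed.

Variable v0 : V.
Hypothesis bv0 : b v0 = 1.
(** At a point, [b] stands for [ds], [S] for the Hessian of [s], [q] for the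
    quadratic form and [T z] for its derivative along [z]. Normalizing by a
    vector [v0] with [b v0 = 1] selects the one-form such that [S] is its
    symmetric product with [b]. *)
Definition weyl u := S u v0 - S v0 v0 / 2 * b u.

(** [S] vanishes on [ker b] because [q] is positive there, and a symmetric form
    that vanishes on [ker b] is the symmetric product of [b] with a one-form. *)
Lemma weyl_hessian u v : S u v = weyl u * b v + weyl v * b u.
Proof.
have := @S_ker2 (- b u *: v0 + u) (- b v *: v0 + v).
rewrite !bl bv0 !mulr1 !addNr => /(_ erefl erefl).
by rewrite !(Sl, Sr) /weyl (SC v0 v) => H; lra.
Qed.

Let weyll a u v : weyl (a *: u + v) = a * weyl u + weyl v.
Proof. by rewrite /weyl Sl bl; lra. Qed.

Let step4 y : 0 < b y -> T y y y = 4 * weyl y * q y y.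
Proof.
move=> y0; have := step1 y0; rewrite weyl_hessian => H.
by apply: (mulfI (lt0r_neq0 y0)); rewrite -H; ring.
Qed.

Let E w y := T w y y - 2 * T y w y + 4 * weyl y * q w y.

Let E0 w y : 0 < b y -> E w y = 0.
Proof.
move=> y0; have := hamel w y0; rewrite step4// weyl_hessian => H.
apply: (mulfI (lt0r_neq0 y0)); apply: (mulfI (lt0r_neq0 y0)).
rewrite mulr0 mulr0 /E.
have -> : b y * (b y * (T w y y - 2 * T y w y + 4 * weyl y * q w y)) =
  b y * (2 * q w y * (weyl y * b y + weyl y * b y) + b y * T w y y
    - b y * (2 * T y w y)) by ring.
by rewrite -H; ring.
Qed.

Let Eall w y : E w y = 0.
Proof.
(* Shifting [y] by [r n0] makes [b] positive for large [r]; as [E w n0 = 0], the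
   shifted [E] is affine in [r], hence zero for every [r]. *)
pose c := T w n0 y + T w y n0 - 2 * (T n0 w y + T y w n0)
  + 4 * (weyl n0 * q w y + weyl y * q w n0).
have H r : 0 < r + b y -> E w y + r * c = 0.
  move=> ry; have br : b (r *: n0 + y) = r + b y by rewrite bl bn mulr1.
  have := @E0 w (r *: n0 + y); rewrite br => /(_ ry).
  have := @E0 w n0; rewrite bn => /(_ ltr01).
  rewrite /E !(T1, T2, T3) !qr weyll /c => H1 H2.
  rewrite -[RHS]H2 -[RHS]subr0 -[in RHS](mulr0 (r ^+ 2)) -H1; ring.
have p1 : 0 < 1 - b y + b y by lra.
have p2 : 0 < 2 - b y + b y by lra.
have h1 := H _ p1; have h2 := H _ p2.
have c0 : c = 0 by lra.
by move: h1; rewrite c0 mulr0 addr0.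
Qed.

(** With [S] known, the Hamel equation becomes
    [T w y y - 2 T y w y + 4 psi(y) q w y = 0], first where [b y] is positive and
    then everywhere. It is solved for [T] by permuting the arguments, as one
    solves for Christoffel symbols. *)
Lemma weyl_form z y w :
  T z y w = 2 * weyl z * q y w + weyl y * q z w + weyl w * q z y.
Proof.
have P u v t : 2 * T u v t - 2 * T v u t - 2 * T t u v
    + 4 * weyl v * q u t + 4 * weyl t * q u v = 0.
  have := Eall u (1 *: v + t); have := Eall u v; have := Eall u t.
  rewrite /E !(T1, T2, T3) !qr weyll (TC u t v) => H1 H2 H3; lra.
have := P w y z; have := P y w z.
rewrite (TC z w y) (TC y w z) (TC w y z) (qC w y) (qC w z) (qC y z).
by rewrite (qC y w); lra.
Qed.

End PointwiseHamel.

Section Riccati.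
Context {R : realType} {n : nat}.
Local Notation V := 'rV[R]_n.
Variables (B : domain V) (s : smfun B) (Q : smooth_form B).
Local Notation e i := (delta_mx 0 i : V).
Hypothesis hamel : forall x y w, B x -> 0 < sD y s x ->
  sD w s x * (2 * Q y y x * sD y (sD y s) x - sD y s x * sD y (Q y y) x) =
  sD y s x * (2 * Q w y x * sD y (sD y s) x + sD y s x * sD w (Q y y) x
    - sD y s x * (2 * sD y (Q w y) x)).
Hypothesis kernel : forall x, B x -> exists v, [/\ sD v s x = 1,
  forall w, Q v w x = 0 & forall y, sD v (Q y y) x = 2 * sD y (Q v y) x].
Hypothesis Q_pos : forall x v, B x -> sD v s x = 0 -> v != 0 -> 0 < Q v v x.
Hypothesis level : forall x, B x -> exists2 w, w != 0 & sD w s x = 0.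

Lemma sD_at (f : smfun B) x a u v : B x ->
  sD (a *: u + v) f x = a * sD u f x + sD v f x.
Proof.
by move=> Bx; rewrite sD_dir (smfun_addE _ _ Bx) (smfun_mulE _ _ Bx) smfun_cstE.
Qed.

Let normsq : smfun B := \sum_i sD (e i) s * sD (e i) s.

Let normsq_gt0 x : B x -> 0 < normsq x.
Proof.
move=> Bx; rewrite (smfun_sumE _ _ _ Bx) lt_neqAle sumr_ge0 ?andbT; last first.
  by move=> i _; rewrite (smfun_mulE _ _ Bx) -expr2 sqr_ge0.
apply/eqP => /esym/eqP; rewrite psumr_eq0; last first.
  by move=> i _; rewrite (smfun_mulE _ _ Bx) -expr2 sqr_ge0.
move=> /allP s0; have [v [sv _ _]] := kernel Bx.
move: sv; rewrite (sD_row _ _ Bx) big1 => [/eqP|i _]; first by rewrite eq_sym oner_eq0.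
have := s0 i (mem_index_enum _).
by rewrite (smfun_mulE _ _ Bx) mulf_eq0 orbb => /eqP ->; rewrite mulr0.
Qed.

(** The gradient of [s] divided by its squared length is a smooth choice of the
    vector [v0] of [weyl]. *)
Lemma weyl_field : exists psi : V -> smfun B, [/\
  forall a u v x, B x -> psi (a *: u + v) x = a * psi u x + psi v x,
  forall a u v w x, B x -> sD w (psi (a *: u + v)) x = a * sD w (psi u) x + sD w (psi v) x,
  forall u v, sD u (sD v s) = psi u * sD v s + psi v * sD u s &
  forall z y w, sD z (Q y w) = 2 * psi z * Q y w + psi y * Q z w + psi w * Q z y].
Proof.
have [r nr] : exists r, normsq * r = 1.
  by apply: smfun_inv => x Bx; rewrite gt_eqF// normsq_gt0.
(* [v] is the normalized gradient of [s]; [svv] is the Hessian of [s] on it. *)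
pose v i := sD (e i) s * r.
pose svv := \sum_j (\sum_i sD (e j) (sD (e i) s) * v i) * v j.
pose psi u := \sum_i sD u (sD (e i) s) * v i - smfun_cst B 2^-1 * svv * sD u s.
pose v0 x : V := \row_i v i x.
have sv0 x : B x -> sD (v0 x) s x = 1.
  move=> Bx; have := congr1 (fun f : smfun B => f x) nr.
  have e1 : (1 : smfun B) x = 1 := smfun_natE 1 Bx.
  rewrite e1 (smfun_mulE _ _ Bx) (smfun_sumE _ _ _ Bx) => <-.
  rewrite (sD_row _ _ Bx) mulr_suml; apply: eq_bigr => i _.
  by rewrite mxE /v !(smfun_mulE _ _ Bx) mulrC mulrA.
have S1 x u : B x -> (\sum_i sD u (sD (e i) s) * v i) x = sD u (sD (v0 x) s) x.
  move=> Bx; rewrite (smfun_sumE _ _ _ Bx) sD_swap (sD_row _ _ Bx).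
  by apply: eq_bigr => i _; rewrite (smfun_mulE _ _ Bx) mxE mulrC sD_swap.
have psiE x u : B x -> psi u x =
    weyl (fun u => sD u s x) (fun u v => sD u (sD v s) x) (v0 x) u.
  move=> Bx; rewrite /psi /weyl (smfun_subE _ _ Bx) !(smfun_mulE _ _ Bx) S1//.
  rewrite (smfun_cstE _ Bx); congr (_ - _ * _); rewrite mulrC; congr (_ * _).
  rewrite (smfun_sumE _ _ _ Bx) (sD_row _ _ Bx); apply: eq_bigr => i _.
  by rewrite (smfun_mulE _ _ Bx) S1// mxE mulrC.
have psil a u w x : B x -> psi (a *: u + w) x = a * psi u x + psi w x.
  by move=> Bx; rewrite !psiE// /weyl !sD_at//; ring.
exists psi; split => //.
- move=> a u w z x Bx.
  have -> : psi (a *: u + w) = smfun_cst B a * psi u + psi w.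
    apply: smfunP => y By; rewrite (psil _ _ _ _ By) (smfun_addE (_ * _) _ By).
    by rewrite (smfun_mulE _ _ By) (smfun_cstE _ By).
  rewrite sD_add sD_mul sD_cst mul0r add0r (smfun_addE _ _ Bx) (smfun_mulE _ _ Bx).
  by rewrite (smfun_cstE _ Bx).
- move=> u w; apply: smfunP => x Bx; rewrite (smfun_addE _ _ Bx) !(smfun_mulE _ _ Bx) !psiE//.
  have [n0 [bn qn Tn]] := kernel Bx.
  apply: (@weyl_hessian R V (fun u => sD u s x) (fun u v => sD u (sD v s) x)
    (fun u v => Q u v x) (fun z u v => sD z (Q u v) x) _ _ _ _ _ _ _ _ _ n0) => //.
  + by move=> *; exact: sD_at.
  + by move=> *; exact: sD_at.
  + by move=> *; rewrite sD_swap.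
  + by move=> *; exact: sform_at.
  + by move=> *; rewrite sformC.
  + by move=> *; exact: sD_at.
  + by move=> *; exact: sD_sform.
  + by move=> *; rewrite sformC.
  + by move=> y w' sy; exact: hamel.
  + by move=> v' sv vn; exact: Q_pos.
  + exact: sv0.
- move=> z y w; apply: smfunP => x Bx.
  rewrite !(smfun_addE (_ + _) _ Bx) (smfun_addE _ (psi y * _) Bx) !(smfun_mulE _ _ Bx).
  rewrite !psiE// (smfun_natE 2 Bx).
  have [n0 [bn qn Tn]] := kernel Bx.
  apply: (@weyl_form R V (fun u => sD u s x) (fun u v => sD u (sD v s) x)
    (fun u v => Q u v x) (fun z u v => sD z (Q u v) x) _ _ _ _ _ _ _ _ _ n0) => //.
  + by move=> *; exact: sD_at.
  + by move=> *; exact: sD_at.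
  + by move=> *; rewrite sD_swap.
  + by move=> *; exact: sform_at.
  + by move=> *; rewrite sformC.
  + by move=> *; exact: sD_at.
  + by move=> *; exact: sD_sform.
  + by move=> *; rewrite sformC.
  + by move=> y' w' sy; exact: hamel.
  + by move=> v' sv vn; exact: Q_pos.
  + exact: sv0.
Qed.

(** Equality of the mixed derivatives of [s] and of [Q] amounts to two linear
    equations for [p = D psi - psi psi]. Evaluated on the vector [n0] that spans
    the kernel of [Q] and on [ker ds], which is nonzero and on which [Q] is
    positive, they have only the zero solution. *)
Lemma weyl_riccati (psi : V -> smfun B) :
  (forall a u v x, B x -> psi (a *: u + v) x = a * psi u x + psi v x) ->
  (forall a u v w x, B x -> sD w (psi (a *: u + v)) x = a * sD w (psi u) x + sD w (psi v) x) ->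
  (forall u v, sD u (sD v s) = psi u * sD v s + psi v * sD u s) ->
  (forall z y w, sD z (Q y w) = 2 * psi z * Q y w + psi y * Q z w + psi w * Q z y) ->
  forall u v, sD u (psi v) = psi u * psi v.
Proof.
move=> psil dpsil hs hQ.
have hyp_s a b c : (sD a (psi b) - sD b (psi a)) * sD c s
    + (sD a (psi c) - psi a * psi c) * sD b s
    - (sD b (psi c) - psi b * psi c) * sD a s = 0.
  have := sD_swap a b (sD c s); rewrite !hs !sD_add !sD_mul !hs => /eqP.
  by rewrite -subr_eq0 => /eqP <-; ring.
have hyp_Q a b c d : 2 * (sD a (psi b) - sD b (psi a)) * Q c d
    + (sD a (psi c) - psi a * psi c) * Q b d - (sD b (psi c) - psi b * psi c) * Q a d
    + (sD a (psi d) - psi a * psi d) * Q c b - (sD b (psi d) - psi b * psi d) * Q c a = 0.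
  have := sD_swap a b (Q c d); rewrite !hQ !sD_add !sD_mul !hQ => /eqP.
  have two v : sD v (2 : smfun B) = 0.
    by rewrite -[2]/(smfun_cst B 1 + smfun_cst B 1) sD_add !sD_cst addr0.
  rewrite -subr_eq0 !two (sformC Q c b) (sformC Q c a) => /eqP <-.
  rewrite (sformC Q b a); ring.
move=> u v; apply: smfunP => x Bx; rewrite (smfun_mulE _ _ Bx).
pose p a b := sD a (psi b) x - psi a x * psi b x.
have at_s a b c : (p a b - p b a) * sD c s x + p a c * sD b s x - p b c * sD a s x = 0.
  have := congr1 (fun f : smfun B => f x) (hyp_s a b c).
  rewrite (smfun_subE _ _ Bx) (smfun_addE _ _ Bx) !(smfun_mulE _ _ Bx) !(smfun_subE _ _ Bx).
  by rewrite !(smfun_mulE _ _ Bx) [RHS](smfun_natE 0 Bx) /p => H; lra.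
have at_Q a b c d : 2 * (p a b - p b a) * Q c d x + p a c * Q b d x - p b c * Q a d x
   + p a d * Q c b x - p b d * Q c a x = 0.
  have := congr1 (fun f : smfun B => f x) (hyp_Q a b c d).
  rewrite (smfun_subE _ _ Bx) (smfun_addE (_ - _) _ Bx) (smfun_subE _ _ Bx).
  rewrite (smfun_addE (2 * _ * _) _ Bx) !(smfun_mulE _ _ Bx) !(smfun_subE _ _ Bx).
  by rewrite !(smfun_mulE _ _ Bx) (smfun_natE 2 Bx) [RHS](smfun_natE 0 Bx) /p => H; lra.
have p1 a b c d : p (a *: b + c) d = a * p b d + p c d.
  by rewrite /p sD_at// psil//; ring.
have p2 a b c d : p d (a *: b + c) = a * p d b + p d c.
  by rewrite /p dpsil// psil//; ring.
have [n0 [bn qn _]] := kernel Bx; have [w w0 sw] := level Bx.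
have qnr a : Q a n0 x = 0 by rewrite sformC qn.
have pw a b : sD a s x = 0 -> sD b s x = 0 -> p a b = 0.
  by move=> sa sb; have := at_s n0 a b; rewrite sa sb bn; lra.
have pnw a : sD a s x = 0 -> p n0 a = 0 /\ p a n0 = 0.
  move=> sa; have [->|a0] := eqVneq a 0.
    have := p1 (-1) 0 0 n0; have := p2 (-1) 0 0 n0.
    by rewrite scaler0 addr0 => H1 H2; split; lra.
  have qa := Q_pos Bx sa a0; have aa := pw a a sa sa.
  have h1 := at_s n0 a n0; have h2 := at_Q n0 a a a.
  rewrite sa bn in h1; rewrite aa !qn !qnr in h2.
  have h3 : p n0 a = 2 * p a n0 by lra.
  have h4 : Q a a x * (4 * p n0 a - 2 * p a n0) = 0 by rewrite -h2; ring.
  move: h4 => /eqP; rewrite mulf_eq0 (gt_eqF qa) /= => /eqP h4.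
  by split; lra.
have pnn : p n0 n0 = 0.
  have [h1 h2] := pnw w sw; have := at_Q n0 w n0 w.
  rewrite h1 h2 (pw w w sw sw) !qn => h.
  have : p n0 n0 * Q w w x = 0 by rewrite -h; ring.
  by move=> /eqP; rewrite mulf_eq0 (gt_eqF (Q_pos Bx sw w0)) orbF => /eqP.
have dec a : exists2 a', a = sD a s x *: n0 + a' & sD a' s x = 0.
  exists (- sD a s x *: n0 + a); first by rewrite addrA -scalerDl subrr scale0r add0r.
  by rewrite sD_at// bn mulr1 addNr.
suff : p u v = 0 by rewrite /p => /eqP; rewrite subr_eq0 => /eqP.
have [u' ue su] := dec u; have [v' ve sv] := dec v.
rewrite ue ve p1 !p2 pnn (pw _ _ su sv) (pnw _ sv).1 (pnw _ su).2.
by rewrite !(mulr0, addr0).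
Qed.

End Riccati.

(** * Integration along segments *)

Section OneVariable.
Context {R : realType}.

Local Notation deriv t f l := (is_derive (t : R^o) (1 : R^o) (f : R^o -> R^o) (l : R^o)).

Lemma is_derive1M (f g : R -> R) (t a b : R) :
  deriv t f a -> deriv t g b -> deriv t (fun r => f r * g r) (a * g t + f t * b).
Proof.
move=> df dg; apply: (is_derive_eq (is_deriveM df dg)).
by rewrite addrC /GRing.scale /= (mulrC (g t)).
Qed.

Lemma is_derive1D (f g : R -> R) (t a b : R) :
  deriv t f a -> deriv t g b -> deriv t (fun r => f r + g r) (a + b).
Proof. by move=> df dg; exact: is_deriveD. Qed.

Lemma is_derive1B (f g : R -> R) (t a b : R) :
  deriv t f a -> deriv t g b -> deriv t (fun r => f r - g r) (a - b).
Proof. by move=> df dg; exact: is_deriveB. Qed.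

Lemma is_derive1_affine (a b t : R) : deriv t (fun r => a + b * r) b.
Proof.
have := is_derive1D (is_derive_cst (a : R^o) t 1)
  (is_derive1M (is_derive_cst (b : R^o) t 1) (is_derive_id (t : R^o) 1)).
by rewrite mul0r mulr1 !add0r.
Qed.

Lemma mean_value_unit (f f' : R -> R) (t : R) : 0 < t ->
  (forall r : R, 0 <= r <= t -> is_derive r 1 (f : R -> R^o) (f' r)) ->
  exists2 r, 0 < r < t & f t - f 0 = f' r * t.
Proof.
move=> t0 df; have [|||r] := @MVT R f f' 0 t.
- by [].
- move=> r; rewrite in_itv /= => /andP[r0 r1]; apply: df.
  by rewrite !ltW.
- apply: derivable_within_continuous => r; rewrite in_itv /= => /df H.
  exact: ex_derive.
- by rewrite in_itv /= subr0 => r01 E; exists r.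
Qed.

Lemma derive0_eq (f f' : R -> R) :
  (forall r : R, 0 <= r <= 1 -> is_derive r 1 (f : R -> R^o) (f' r)) ->
  (forall r : R, 0 <= r <= 1 -> f' r = 0) -> forall t : R, 0 <= t <= 1 -> f t = f 0.
Proof.
move=> df f0 t /andP[]; rewrite le_eqVlt => /orP[/eqP <-//|t0] t1.
have [|r /andP[r0 rt]] := @mean_value_unit f f' t t0.
  by move=> r /andP[r0 rt]; apply: df; rewrite r0 (le_trans rt).
rewrite f0 ?mul0r => [/eqP|]; last by rewrite (ltW r0) (le_trans (ltW rt)).
by rewrite subr_eq0 => /eqP.
Qed.

(** If [C] is an upper bound of [p], then [g^2 exp(- 2 C t)] is nonincreasing,
    nonnegative and zero at the origin. *)
Lemma linear_ode_eq0 (g p : R -> R) :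
  (forall r : R, 0 <= r <= 1 -> is_derive r 1 (g : R -> R^o) (p r * g r)) ->
  {within `[0, 1], continuous p} -> g 0 = 0 -> forall t : R, 0 <= t <= 1 -> g t = 0.
Proof.
move=> dg cp g0 t t01.
have [c c01 cM] := EVT_max ler01 cp.
pose C := p c.
pose E r : R := g r * g r * expR (- (2 * C) * r).
pose E' r : R := (2 * (p r - C) * g r ^+ 2) * expR (- (2 * C) * r).
have dE (r : R) : 0 <= r <= 1 -> is_derive r 1 (E : R -> R^o) (E' r).
  move=> r01; have dgr := dg r r01.
  have dx : deriv r (fun r => expR (- (2 * C) * r)) (expR (- (2 * C) * r) * - (2 * C)).
    have := is_derive1_affine 0 (- (2 * C)) r.
    have -> : (fun r => 0 + - (2 * C) * r) = (fun r => - (2 * C) * r).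
      by apply/funext => x; rewrite add0r.
    by move=> da; exact: (is_derive1_comp (is_derive_expR _) da).
  apply: (is_derive_eq (is_derive1M (is_derive1M dgr dgr) dx)).
  by rewrite /E'; ring.
have Ele : E t <= E 0.
  have [/andP[]] := (t01, t01); rewrite le_eqVlt => /orP[/eqP <-//|t0 t1 _].
  have [|r /andP[r0 rt] H] := @mean_value_unit E E' t t0.
    by move=> r /andP[r0 rt]; apply: dE; rewrite r0 (le_trans rt).
  rewrite -subr_le0 H mulr_le0_ge0 ?(ltW t0)// /E' mulr_le0_ge0 ?expR_ge0//.
  rewrite mulr_le0_ge0 -?expr2 ?sqr_ge0// mulr_ge0_le0// subr_le0 cM// in_itv /=.
  by rewrite (ltW r0) (le_trans (ltW rt)).
have : E t <= 0 by rewrite (le_trans Ele)// /E g0 !mul0r.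
rewrite /E pmulr_lle0 ?expR_gt0// -expr2 => H.
by apply/eqP; rewrite -sqrf_eq0 eq_le H sqr_ge0.
Qed.

End OneVariable.

Section Segment.
Context {R : realType} {n : nat}.
Local Notation V := 'rV[R]_n.
Local Notation deriv t f l := (is_derive (t : R^o) (1 : R^o) (f : R^o -> R^o) (l : R^o)).
Variables (B : domain V) (s : smfun B) (Q : smooth_form B) (psi : V -> smfun B).
Hypothesis psi_lin : forall a u v x, B x -> psi (a *: u + v) x = a * psi u x + psi v x.
Hypothesis hess_s : forall u v, sD u (sD v s) = psi u * sD v s + psi v * sD u s.
Hypothesis hess_Q : forall z y w,
  sD z (Q y w) = 2 * psi z * Q y w + psi y * Q z w + psi w * Q z y.
Hypothesis riccati : forall u v, sD u (psi v) = psi u * psi v.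
Variables (z0 w : V).
Hypothesis seg : forall t : R, 0 <= t <= 1 -> B (z0 + t *: w).

Local Notation z t := (z0 + (t : R) *: w).
Let m (t : R) : R := 1 - t * psi w z0.

Let t0 : 0 <= (0 : R) <= 1. Proof. by rewrite lexx ler01. Qed.
Let t1 : 0 <= (1 : R) <= 1. Proof. by rewrite lexx ler01. Qed.
Let z0E : z 0 = z0. Proof. by rewrite scale0r addr0. Qed.
Let z1E : z 1 = z0 + w. Proof. by rewrite scale1r. Qed.

Let derf (f : smfun B) (t : R) : 0 <= t <= 1 ->
  deriv t (fun r : R => f (z r)) (sD w f (z t)).
Proof.
move=> t01; have Bz := seg t01; rewrite (sDE _ _ Bz).
exact: (is_derive_line (smfun_diff f Bz)).
Qed.

Let derm (t : R) : deriv t m (- psi w z0).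
Proof.
have := is_derive1_affine 1 (- psi w z0) t; congr is_derive.
by apply/funext => r; rewrite /m mulNr mulrC.
Qed.

Let psiw0 (t : R) : 0 <= t <= 1 -> psi w (z t) * m t = psi w z0.
Proof.
move=> t01; apply/eqP; rewrite -subr_eq0; apply/eqP; move: t t01.
apply: (@linear_ode_eq0 R (fun t => psi w (z t) * m t - psi w z0) (fun t => psi w (z t))).
- move=> t t01; apply: (is_derive_eq (is_derive1B (is_derive1M (derf (psi w) t01) (derm t))
    (is_derive_cst (psi w z0 : R^o) (t : R^o) 1))).
  by rewrite riccati (smfun_mulE _ _ (seg t01)); ring.
- apply: derivable_within_continuous => r; rewrite in_itv /= => /(derf (psi w)) H.
  exact: ex_derive.
- by rewrite z0E /m mul0r subr0 mulr1 subrr.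
Qed.

Let m0 : m 0 = 1. Proof. by rewrite /m mul0r subr0. Qed.
Let m1 : m 1 = 1 - psi w z0. Proof. by rewrite /m mul1r. Qed.
Let mE (t : R) : m t = 1 - t * psi w z0. Proof. by []. Qed.

Let psiv0 v (t : R) : 0 <= t <= 1 -> psi v (z t) * m t = psi v z0.
Proof.
move=> t01; have := @derive0_eq R (fun t => psi v (z t) * m t)
  (fun t => (psi w (z t) * psi v (z t)) * m t + psi v (z t) * - psi w z0) _ _ t t01.
rewrite m0 z0E mulr1; apply.
- move=> r r01; apply: (is_derive_eq (is_derive1M (derf (psi v) r01) (derm r))).
  by rewrite riccati (smfun_mulE _ _ (seg r01)).
- by move=> r r01; rewrite -(psiw0 r01); ring.
Qed.

(** Along the segment [z0 + t w] the Riccati equation gives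
    [(psi(v) m)' = psi(v) (psi(w) m - psi0(w))] for [m = 1 - t psi0(w)]. The last
    factor satisfies a linear equation with zero initial value, by the case
    [v = w]. *)
Lemma psi_along v : psi v (z0 + w) * (1 - psi w z0) = psi v z0.
Proof. by rewrite -m1 -z1E psiv0. Qed.

Lemma psi_along_neq0 : 1 - psi w z0 != 0.
Proof.
apply/eqP => p0; have := psi_along w; rewrite p0 mulr0 => p1.
by move: p0; rewrite -p1 subr0 => /eqP; rewrite oner_eq0.
Qed.

(** The rate [r] of [s] along the segment satisfies [r' = 2 psi(w) r], so that
    [r m^2] is constant and [s] is projective: its increment is
    [ds0(w) / (1 - psi0(w))]. *)
Lemma level_function_along : (s (z0 + w) - s z0) * (1 - psi w z0) = sD w s z0.
Proof.
pose r t := sD w s (z t).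
have dr (t : R) : 0 <= t <= 1 -> deriv t r (2 * psi w (z t) * r t).
  move=> t01; apply: (is_derive_eq (derf (sD w s) t01)).
  by rewrite hess_s (smfun_addE _ _ (seg t01)) (smfun_mulE _ _ (seg t01)) /r; ring.
have E1 : r 1 * (m 1 * m 1) = r 0.
  have := @derive0_eq R (fun t => r t * (m t * m t)) (fun t => 2 * psi w (z t) * r t * (m t * m t)
    + r t * (- psi w z0 * m t + m t * - psi w z0)) _ _ 1 t1.
  rewrite m0 !mulr1; apply.
  - by move=> t t01; exact: is_derive1M (dr t t01) (is_derive1M (derm t) (derm t)).
  - by move=> t t01; rewrite -(psiw0 t01); ring.
have r0E : r 0 = sD w s z0 by rewrite /r z0E.
rewrite -r0E -E1 -m1 mulrA; congr (_ * _).
have := @derive0_eq R (fun t => s (z t) - (0 + 1 * t) * (r t * m t))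
  (fun t => r t - (1 * (r t * m t) +
    (0 + 1 * t) * (2 * psi w (z t) * r t * m t + r t * - psi w z0))) _ _ 1 t1.
rewrite z1E z0E !add0r !mul1r mul0r subr0 => H.
suff H0 : s (z0 + w) - r 1 * m 1 = s z0 by rewrite -H0 subKr.
apply: H.
- move=> t t01; exact: is_derive1B (derf s t01)
    (is_derive1M (is_derive1_affine 0 1 t) (is_derive1M (dr t t01) (derm t))).
- move=> t t01; have mt := mE t; move: mt; rewrite -(psiw0 t01).
  move: (m t) (r t) (psi w (z t)) => M r' p mt.
  have -> : r' - (1 * (r' * M) + (0 + 1 * t) * (2 * p * r' * M + r' * - (p * M)))
    = r' * ((1 - t * (p * M)) - M) by ring.
  by rewrite -mt subrr mulr0.
Qed.

(** In the left-hand side [Q] is evaluated, by bilinearity, on the vectors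
    [(1 - psi0(w)) (u - psi0(u) w)] for [u = a, b]. These are the images of [a],
    [b] under the differential of the projective map [perspective], so the
    identity says that this map is an isometry for [Q]. *)
Lemma form_along a b :
  (1 - psi w z0) ^+ 2 * (Q a b (z0 + w) - psi a z0 * Q w b (z0 + w)
    - psi b z0 * Q a w (z0 + w) + psi a z0 * psi b z0 * Q w w (z0 + w)) = Q a b z0.
Proof.
pose id t : R := 0 + 1 * t.
have di (t : R) : deriv t id 1 := is_derive1_affine 0 1 t.
have dQ (u v : V) (t : R) : 0 <= t <= 1 -> deriv t (fun t => Q u v (z t))
    (2 * psi w (z t) * Q u v (z t) + psi u (z t) * Q w v (z t) + psi v (z t) * Q w u (z t)).
  move=> t01; apply: (is_derive_eq (derf (Q u v) t01)); have Bz := seg t01.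
  rewrite hess_Q !(smfun_addE _ (psi v * _) Bz) !(smfun_addE _ _ Bz).
  by rewrite !(smfun_mulE _ _ Bz) (smfun_natE 2 Bz).
have dc (c : R) (t : R) := is_derive_cst (c : R^o) (t : R^o) 1.
pose f t := m t * m t * (Q a b (z t) - psi a z0 * (id t * Q w b (z t))
  - psi b z0 * (id t * Q a w (z t)) + psi a z0 * psi b z0 * (id t * id t * Q w w (z t))).
have i1 : id 1 = 1 by rewrite /id add0r mul1r.
have i0 : id 0 = 0 by rewrite /id mulr0 addr0.
have f0 : f 0 = Q a b z0.
  by rewrite /f m0 i0 z0E !mul1r !mul0r !mulr0 !subr0 addr0.
rewrite -f0 -m1 -z1E -[LHS](_ : f 1 = _); last first.
  by rewrite /f i1 !mul1r expr2.
refine (@derive0_eq R f (fun=> 0) _ (fun _ _ => erefl) 1 t1) => t t01.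
have H := is_derive1M (is_derive1M (derm t) (derm t))
  (is_derive1D (is_derive1B (is_derive1B (dQ a b t t01)
    (is_derive1M (dc (psi a z0) t) (is_derive1M (di t) (dQ w b t t01))))
    (is_derive1M (dc (psi b z0) t) (is_derive1M (di t) (dQ a w t t01))))
    (is_derive1M (dc (psi a z0 * psi b z0) t)
      (is_derive1M (is_derive1M (di t) (di t)) (dQ w w t t01)))).
apply: (is_derive_eq H); rewrite {H}.
have ma := psiv0 a t01; have mb := psiv0 b t01; have mw := psiw0 t01.
have mt : m t = 1 - id t * psi w z0 by rewrite mE /id add0r mul1r.
rewrite (sformC Q a w) !cstE.
move: ma mb mw mt.
move: (psi a z0) (psi b z0) (psi w z0) (psi a (z t)) (psi b (z t)) (psi w (z t)).
move: (m t) (id t) => M i pa pb pw pat pbt pwt.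
move: (Q a b (z t)) (Q w b (z t)) (Q w a (z t)) (Q w w (z t)) => A0 B0 C0 D0 <- <- <- mt.
rewrite [LHS](_ : _ = M * (2 * i * (pat * M) * (pbt * M) * D0 - pat * M * B0 - pbt * M * C0)
  * (M - (1 - i * (pwt * M)))); last by ring.
by rewrite -mt subrr mulr0.
Qed.

End Segment.

(** * Cholesky factorization *)

Section Cholesky.
Context {R : rcfType}.

(** Induction on the size: completing the square in the first variable leaves
    the Schur complement, which is again positive definite. *)
Lemma cholesky n (A : 'M[R]_n) : A^T = A ->
  (forall v : 'rV[R]_n, v != 0 -> 0 < (v *m A *m v^T) 0 0) ->
  exists C : 'M[R]_n, A = C *m C^T.
Proof.
elim: n A => [|n ih] A As Ap.
  by exists 0; apply/matrixP => -[].
pose A' : 'M[R]_(1 + n) := A; pose al := ulsubmx A' 0 0.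
pose b := ursubmx A'; pose D := drsubmx A'.
have AE : A' = block_mx al%:M b b^T D.
  rewrite -[LHS]submxK; congr block_mx; first by rewrite [LHS]mx11_scalar.
  by rewrite /b trmx_ursub [A'^T]As.
have Ap' (v : 'rV[R]_(1 + n)) : v != 0 -> 0 < (v *m A' *m v^T) 0 0 := Ap v.
have Ds : D^T = D by rewrite /D trmx_drsub [A'^T]As.
have qE (x : R) (v : 'rV[R]_n) :
    ((row_mx x%:M v : 'rV_(1 + n)) *m A' *m (row_mx x%:M v : 'rV_(1 + n))^T) 0 0 =
    al * x ^+ 2 + 2 * x * (v *m b^T) 0 0 + (v *m D *m v^T) 0 0.
  rewrite AE mul_row_block tr_row_mx mul_row_col tr_scalar_mx mulmxDl !mulmxDl.
  rewrite !(mul_mx_scalar, mul_scalar_mx) -scalemxAl.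
  have -> : b *m v^T = (v *m b^T)^T by rewrite trmx_mul trmxK.
  move: (v *m b^T) (v *m D *m v^T) => p q; rewrite !mxE /= mulr1n; ring.
have al0 : 0 < al.
  have := Ap' (row_mx 1%:M 0 : 'rV_(1 + n)); rewrite qE.
  rewrite !mul0mx !mxE !mulr0 !addr0 expr1n mulr1; apply.
  apply/eqP => /(congr1 (fun u : 'rV_(1 + n) => lsubmx u 0 0)).
  by rewrite row_mxKl !mxE => /eqP; rewrite oner_eq0.
have alN : al != 0 by rewrite lt0r_neq0.
pose S := D - al^-1 *: (b^T *m b).
have Sq (v : 'rV[R]_n) : (v *m S *m v^T) 0 0 =
    (v *m D *m v^T) 0 0 - al^-1 * (v *m b^T) 0 0 ^+ 2.
  rewrite /S mulmxBr mulmxBl -scalemxAr -scalemxAl mulmxA -[_ *m b *m v^T]mulmxA.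
  have -> : b *m v^T = (v *m b^T)^T by rewrite trmx_mul trmxK.
  rewrite mxE [X in _ + X]mxE [X in _ - X]mxE [(v *m b^T *m _) 0 0]mxE big_ord1.
  by rewrite [((v *m b^T)^T) 0 0]mxE expr2.
have [|v v0|C CE] := ih S.
- by rewrite /S linearB linearZ /= trmx_mul trmxK Ds.
- have := Ap' (row_mx (- al^-1 * (v *m b^T) 0 0)%:M v : 'rV_(1 + n)).
  rewrite qE Sq.
  have -> : (row_mx (- al^-1 * (v *m b^T) 0 0)%:M v : 'rV_(1 + n)) != 0.
    by apply: contra_neq v0 => /(congr1 rsubmx); rewrite row_mxKr raddf0.
  move=> /(_ isT); move: (_ 0 0) ((v *m b^T) 0 0) => q p; congr (0 < _).
  by field.
have sq : Num.sqrt al * Num.sqrt al = al by rewrite -expr2 sqr_sqrtr// ltW.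
have sN : Num.sqrt al != 0 by rewrite sqrtr_eq0 -ltNge.
suff [C' CE'] : exists C' : 'M[R]_(1 + n), A' = C' *m C'^T by exists C'.
exists (block_mx (Num.sqrt al)%:M 0 ((Num.sqrt al)^-1 *: b^T) C).
rewrite tr_block_mx mulmx_block AE; congr block_mx.
- by rewrite trmx0 mulmx0 addr0 tr_scalar_mx -scalar_mxM sq.
- by rewrite mul0mx addr0 linearZ /= trmxK mul_scalar_mx scalerA mulfV// scale1r.
- by rewrite trmx0 mulmx0 addr0 tr_scalar_mx mul_mx_scalar scalerA mulfV// scale1r.
- rewrite linearZ /= trmxK -scalemxAl -scalemxAr scalerA -invfM sq -CE /S.
  by rewrite addrC subrK.
Qed.

Lemma posdef_factor n (A : 'M[R]_n) : A^T = A ->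
  (forall v : 'rV[R]_n, v != 0 -> 0 < (v *m A *m v^T) 0 0) ->
  exists2 C : 'M[R]_n, A = C *m C^T & C \in unitmx.
Proof.
move=> As Ap; have [C CE] := cholesky As Ap; exists C => //.
rewrite -row_free_unit; apply/inj_row_free => v vC; apply/eqP/negPn/negP => /Ap.
by rewrite CE mulmxA vC !mul0mx mxE ltxx.
Qed.

End Cholesky.

(** * Charts and the metric of the factor *)

Section SmoothMaps.
Context {R : realType}.

Lemma smooth_compv (V : normedModType R) m p (U : set V) (U' : set 'rV[R]_m) (g : V -> 'rV[R]_m)
    (f : 'rV[R]_m -> 'rV[R]_p) : open U -> open U' -> (forall x, U x -> U' (g x)) ->
  smooth_on U g -> smooth_on U' f -> smooth_on U (f \o g).
Proof.
move=> oU oU' UU' cg cf k; apply: class_C_row => // j.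
by apply: (@class_C_comp _ _ _ _ U U' g (fun y => f y 0 j)) => //; exact: class_C_entry.
Qed.

Lemma smooth_agree (V W : normedModType R) (U : set V) (f g : V -> W) : open U ->
  (forall x, U x -> f x = g x) -> smooth_on U f -> smooth_on U g.
Proof. by move=> oU fg sf k; exact: class_C_ext (sf k). Qed.

Lemma smooth_sub (V W : normedModType R) (U U' : set V) (f : V -> W) : U' `<=` U ->
  smooth_on U f -> smooth_on U' f.
Proof. by move=> UU sf k; exact: class_C_sub UU (sf k). Qed.

Lemma smooth_diff (V W : normedModType R) (U : set V) (f : V -> W) x :
  smooth_on U f -> U x -> differentiable f x.
Proof. by move=> sf Ux; exact: (sf 1%N).1. Qed.

End SmoothMaps.

Section Charts.
Context {R : realType} {n : nat}.

Lemma overlapP (M : topologicalType) (c c' : @chart R M n) x :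
  overlap c c' x <-> chart_cod c x /\ chart_dom c' (point c x).
Proof.
split=> [[p [cp c'p] <-]|[[p cp <-]]]; first by rewrite coordK//; split=> //; exists p.
by rewrite coordK// => c'p; exists p.
Qed.

Lemma chart_cod_point (M : topologicalType) (c : @chart R M n) x : chart_cod c x ->
  chart_dom c (point c x) /\ coord c (point c x) = x.
Proof. by move=> [p cp <-]; rewrite coordK. Qed.

Lemma overlap_sym (M : topologicalType) (c c' : @chart R M n) x :
  overlap c c' x -> overlap c' c (transition c c' x).
Proof.
move=> /overlapP[/chart_cod_point[cx cxE] c'x]; apply/overlapP.
by rewrite /transition /= coordK//; split=> //; exists (point c x).
Qed.

Lemma transitionK (M : topologicalType) (c c' : @chart R M n) x :
  overlap c c' x -> transition c' c (transition c c' x) = x.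
Proof.
by move=> /overlapP[/chart_cod_point[cx cxE] c'x]; rewrite /transition /= coordK.
Qed.

Lemma preimage_point_open (M : topologicalType) (c : @chart R M n) (A : set M) : open A ->
  open [set x | chart_cod c x /\ A (point c x)].
Proof.
move=> oA; rewrite openE => x [cx Ax]; apply: filterI.
  by apply: open_nbhs_nbhs; split=> //; exact: chart_cod_open.
by apply: (point_continuous cx); apply: open_nbhs_nbhs.
Qed.

Lemma preimage_coord_open (M : topologicalType) (c : @chart R M n) (A : set 'rV[R]_n) : open A ->
  open [set p | chart_dom c p /\ A (coord c p)].
Proof.
move=> oA; rewrite openE => x [cx Ax]; apply: filterI.
  by apply: open_nbhs_nbhs; split=> //; exact: chart_dom_open.
by apply: (coord_continuous cx); apply: open_nbhs_nbhs.
Qed.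

Lemma overlap_open (M : topologicalType) (c c' : @chart R M n) : open (overlap c c').
Proof.
rewrite [overlap c c'](_ : _ = [set x | chart_cod c x /\ chart_dom c' (point c x)]).
  exact/preimage_point_open/chart_dom_open.
by apply/seteqP; split=> x /overlapP.
Qed.

Lemma derive_transitionK (M : topologicalType) (c c' : @chart R M n) x v :
  compatible c c' -> overlap c c' x ->
  'D_('D_v (transition c c') x) (transition c' c) (transition c c' x) = v.
Proof.
move=> [sc sc'] ox; rewrite -derive_comp.
- rewrite [LHS](_ : _ = 'D_v id x); first exact: derive_id.
  apply: near_eq_derive; near=> z; rewrite /= transitionK//; near: z.
  by apply: open_nbhs_nbhs; split=> //; exact: overlap_open.
- exact: smooth_diff ox.
- exact: smooth_diff (overlap_sym ox).
Unshelve. all: by end_near. Qed.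

(** Near each point the change of coordinates factors through a chart of the
    atlas. *)
Lemma compatible_trans (M : @manifold R n) (c c' : chart M n) :
  local_coordinates c -> local_coordinates c' -> compatible c c'.
Proof.
suff H (a b : chart M n) : local_coordinates a -> local_coordinates b ->
    smooth_on (overlap a b) (transition a b) by move=> lc lc'; split; exact: H.
move=> la lb k; apply: class_C_local => x /overlapP[ax bx].
have [e [ae ex]] := atlas_cover (point a x).
pose U := overlap a b `&` overlap a e.
have oU : open U by apply: openI; exact: overlap_open.
have Ux : U x by split; apply/overlapP.
exists U => //; apply: (@smooth_agree _ _ _ U (transition e b \o transition a e)) => //.
  move=> z [_ /overlapP[az ez]].
  by rewrite /transition /= coordK.
refine (smooth_compv oU (@overlap_open _ e b) _ _ (lb e ae).2).
  move=> z [/overlapP[_ bz] oz]; have /overlapP[ez az] := overlap_sym oz.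
  by apply/overlapP; split=> //; move: oz => /overlapP[? ?]; rewrite /transition /= coordK.
by apply: (smooth_sub _ (la e ae).1) => z [].
Qed.

Lemma atlas_local (M : @manifold R n) (c : chart M n) : atlas c -> local_coordinates c.
Proof. by move=> ac c' ac'; exact: atlas_compatible. Qed.

End Charts.

Section MetricPullback.
Context {R : realType} {d : nat} {N : @manifold R d} (a : riemannian_metric N).

(** The transformation law of the metric frees the norm from the chart that its
    definition selects. *)
Lemma sqnorm_diffE (V : normedModType R) (f : V -> N) (e : chart N d) x y :
  local_coordinates e -> (\near x, chart_dom e (f x)) -> differentiable (coord e \o f) x ->
  sqnorm_diff a f x y =
  ('D_y (coord e \o f) x *m a e (coord e (f x)) *m ('D_y (coord e \o f) x)^T) 0 0.
Proof.
move=> le ne df; rewrite /sqnorm_diff /chart_at; case: cid => c [ac cx] /=.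
have ex : chart_dom e (f x) := nbhs_singleton ne.
have lc := atlas_local ac.
have ox : overlap e c (coord e (f x)) by apply/overlapP; rewrite coordK//; split=> //; exists (f x).
rewrite (metric_transition a le lc ox).
have -> : transition e c (coord e (f x)) = coord c (f x) by rewrite /transition /= coordK.
suff -> : 'D_('D_y (coord e \o f) x) (transition e c) (coord e (f x)) = 'D_y (coord c \o f) x by [].
rewrite -(@derive_comp _ _ _ _ (coord e \o f) (transition e c)) //; last first.
  exact: smooth_diff (compatible_trans le lc).1 ox.
apply: near_eq_derive; near=> z; rewrite /transition /= coordK//; near: z; exact: ne.
Unshelve. all: by end_near. Qed.

End MetricPullback.

Section ProductCharts.
Context {R : realType} {d : nat} {N : @manifold R d}.
Variables (c : @chart R (line_product N) (1 + d)) (e : @chart R N d).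
Hypotheses (lc : local_coordinates c) (le : local_coordinates e).

Local Notation W := (overlap c (line_chart e)).
Local Notation T := (transition c (line_chart e)).
Definition factor_coord (x : 'rV[R]_(1 + d)) : 'rV[R]_d := coord e (point c x).2.
Local Notation X := factor_coord.

Lemma product_overlapP x : W x <-> chart_cod c x /\ chart_dom e (point c x).2.
Proof. exact: overlapP. Qed.

Lemma line_chart_local : local_coordinates (M := line_product N) (line_chart e).
Proof. by move=> _ [b ab <-]; exact/line_compatible/le. Qed.

Lemma product_compatible : compatible c (line_chart e).
Proof. exact: compatible_trans lc line_chart_local. Qed.

Lemma transition_line x : T x = row_mx (x1 c x)%:M (X x).
Proof. by []. Qed.

Lemma smooth_factor_coord : smooth_on W X.
Proof.
apply: (smooth_agree (f := rsubmx \o T) (@overlap_open _ _ _ _ _)) => [x _|].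
  exact: row_mxKr.
refine (smooth_compv (@overlap_open _ _ _ _ _) (U' := setT) openT _ product_compatible.1 _) => //.
by move=> k; apply: class_C_linear; exact: continuous_rsubmx.
Qed.

Lemma smooth_x1_overlap : smooth_on W (x1 c : _ -> R^o).
Proof.
move=> k; apply: (class_C_ext (f := fun x => T x 0 (lshift d 0) : R^o) (@overlap_open _ _ _ _ _)).
  by move=> x _; rewrite transition_line row_mxEl mxE eqxx.
by apply: class_C_entry; [exact: overlap_open|exact: product_compatible.1].
Qed.

Lemma derive_transition_line x v : W x ->
  'D_v T x = row_mx ('D_v (x1 c : _ -> R^o) x)%:M ('D_v X x).
Proof.
move=> Wx; have dT := smooth_diff product_compatible.1 Wx.
have dX := smooth_diff smooth_factor_coord Wx.
apply/rowP => j; rewrite -derive_entry//; case: (split_ordP j) => i ->.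
  rewrite row_mxEl mxE (ord1 i) eqxx mulr1n.
  by congr ('D_v _ x); apply/funext => z; rewrite transition_line row_mxEl mxE eqxx.
rewrite row_mxEr -derive_entry//.
by congr ('D_v _ x); apply/funext => z; rewrite transition_line row_mxEr.
Qed.

Lemma product_coord_inj x v : W x ->
  'D_v (x1 c : _ -> R^o) x = 0 -> 'D_v X x = 0 -> v = 0.
Proof.
move=> Wx v1 vX; rewrite -(derive_transitionK v product_compatible Wx).
rewrite derive_transition_line// v1 vX raddf0 row_mx0 deriveE ?linear0//.
exact: smooth_diff product_compatible.2 (overlap_sym Wx).
Qed.

Lemma product_coord_surj x t u : W x -> exists v,
  'D_v (x1 c : _ -> R^o) x = t /\ 'D_v X x = u.
Proof.
move=> Wx; have Wy := overlap_sym Wx.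
have cc : compatible (line_chart e) c by case: product_compatible.
have := derive_transitionK (row_mx t%:M u) cc Wy; rewrite transitionK//.
rewrite derive_transition_line// => E.
exists ('D_(row_mx t%:M u) (transition (line_chart e) c) (T x)).
split; last by have := congr1 rsubmx E; rewrite !row_mxKr.
by have := congr1 (fun M => lsubmx M 0 0) E; rewrite !row_mxKl !mxE eqxx.
Qed.

Lemma alpha_tilde_sqE (a : riemannian_metric N) x y : W x ->
  alpha_tilde_sq a c x y = ('D_y X x *m a e (X x) *m ('D_y X x)^T) 0 0.
Proof.
move=> Wx; apply: sqnorm_diffE => //; last exact: smooth_diff smooth_factor_coord Wx.
near=> z; apply: (proj2 (iffLR (product_overlapP z) _)); near: z.
by apply: open_nbhs_nbhs; split=> //; exact: overlap_open.
Unshelve. all: by end_near. Qed.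

End ProductCharts.

Section ProductCoordinate.
Context {R : realType} {d : nat} {N : @manifold R d}.
Variables (c : @chart R (line_product N) (1 + d)) (lc : local_coordinates c).

Lemma smooth_x1 : smooth_on (chart_cod c) (x1 c : _ -> R^o).
Proof.
move=> k; apply: class_C_local => x cx.
have [e [ae ex]] := atlas_cover (point c x).2.
exists (overlap c (line_chart e)); first exact/product_overlapP.
exact: (smooth_x1_overlap lc (atlas_local ae)).
Qed.

Lemma alpha_tilde_sq_ge0 (a : riemannian_metric N) x y : chart_cod c x ->
  0 <= alpha_tilde_sq a c x y.
Proof.
move=> cx; have [e [ae ex]] := atlas_cover (point c x).2; have le := atlas_local ae.
rewrite (alpha_tilde_sqE lc le); last exact/product_overlapP.
set v := 'D_y _ _; have [->|v0] := eqVneq v 0; first by rewrite !mul0mx mxE.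
by rewrite ltW// metric_posdef//; exists (point c x).2.
Qed.

End ProductCoordinate.

(** * Functions of one real variable *)

Section Primitive.
Context {R : realType}.
Local Notation deriv t f l := (is_derive (t : R^o) (1 : R^o) (f : R^o -> R^o) (l : R^o)).
Local Notation mu := (@lebesgue_measure R).

(** Restricting to a bounded interval makes the integrand integrable. *)
Lemma bounded_primitive (f : R -> R) (M : R) : (forall t : R, {for t, continuous f}) ->
  exists G : R -> R, G 0 = 0 /\ forall t : R, - M < t < M -> deriv t G (f t).
Proof.
move=> cf; pose F (t : R) : R := (\int[mu]_(u in `[(- M)%R, t]) f u)%R.
have int (u : R) : mu.-integrable `[- M, u] (EFin \o f).
  apply: continuous_compact_integrable; first exact: segment_compact.
  by apply: continuous_subspaceT.
exists (fun t => F t - F 0); split=> [|t /andP[Mt tM]]; first by rewrite subrr.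
have [dF Fe] := @continuous_FTC1_closed R f (- M) t M tM (int M) Mt (cf t).
rewrite -[f t]subr0; apply: is_derive1B (is_derive_cst _ _ _).
by rewrite derive1E in Fe; exact: (DeriveDef dF Fe).
Qed.

(** The primitives on bounded intervals that vanish at [0] agree wherever two of
    them are defined, so they glue. *)
Lemma primitive (f : R -> R) : (forall t : R, {for t, continuous f}) ->
  exists F : R -> R, forall t : R, deriv t F (f t).
Proof.
move=> cf; have [G HG] := choice (fun M => bounded_primitive M cf).
have agree (M M' t : R) : - M < t < M -> - M' < t < M' -> G M t = G M' t.
  move=> tM tM'; pose D (r : R) : R := G M (0 + t * r) - G M' (0 + t * r).
  have inM (K r : R) : - K < t < K -> 0 <= r <= 1 -> - K < 0 + t * r < K.
    move=> /andP[] h1 h2 /andP[r0 r1]; rewrite add0r.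
    have [t0|t0] := leP 0 t; apply/andP; split; nra.
  have dG (K r : R) : - K < t < K -> 0 <= r <= 1 ->
      deriv r (fun r => G K (0 + t * r)) (f (0 + t * r) * t).
    move=> tK r01;
    exact: (@is_derive1_comp R (G K) _ r _ _
      ((HG K).2 _ (inM K r tK r01)) (is_derive1_affine 0 t r)).
  have : D 1 = D 0.
    refine (@derive0_eq R D (fun r => f (0 + t * r) * t - f (0 + t * r) * t) _ _ 1 _).
    - by move=> r r01; exact: is_derive1B (dG M r tM r01) (dG M' r tM' r01).
    - by move=> r r01; rewrite subrr.
    - by rewrite ler01 lexx.
  rewrite /D !add0r mulr1 mulr0 (HG M).1 (HG M').1 subrr => /eqP.
  by rewrite subr_eq0 => /eqP.
(* Near [t] the glued function agrees with the single primitive on the interval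
   of half-length [`|t| + 2]. *)
exists (fun t => G (`|t| + 1) t) => t.
have tin (K r : R) : `|r| < K -> - K < r < K by rewrite ltr_norml.
have t2 : `|t| < `|t| + 2 by rewrite ltrDl.
have dt := (HG (`|t| + 2)).2 t (tin _ _ t2).
have : \forall r \near (t : R^o), G (`|t| + 2) r = G (`|r| + 1) r.
  near=> r; apply: agree; apply: tin; last by rewrite ltrDl.
  have : `|r - t| < 1.
    by rewrite distrC; near: r; exact: (nbhsx_ballx (t : R^o) 1 ltr01).
  by have := ler_normD (r - t) t; rewrite subrK; lra.
move=> near_eq.
exact: near_eq_is_derive.
Unshelve. all: by end_near. Qed.

End Primitive.

Section SmoothOneVariable.
Context {R : realType}.
Local Notation deriv t f l := (is_derive (t : R^o) (1 : R^o) (f : R^o -> R^o) (l : R^o)).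

Lemma derive1_dir (f : R -> R) (t l v : R) : deriv t f l ->
  differentiable (f : R^o -> R^o) (t : R^o) /\ 'D_(v : R^o) (f : R^o -> R^o) (t : R^o) = v * l.
Proof.
move=> df; have dd : differentiable (f : R^o -> R^o) (t : R^o).
  by apply/derivable1_diffP; exact: ex_derive.
split=> //; have <- : 'D_(1 : R^o) (f : R^o -> R^o) (t : R^o) = l by exact: derive_val.
rewrite !deriveE//; have -> : (v : R^o) = v *: (1 : R^o) by rewrite /GRing.scale /= mulr1.
by rewrite linearZ /GRing.scale /= mulr1.
Qed.

Lemma class_C_of_derive k (U : set R) (f f' : R -> R) : open (U : set R^o) ->
  (forall t, U t -> deriv t f (f' t)) -> class_C k (U : set R^o) (f' : R^o -> R^o) ->
  class_C k.+1 (U : set R^o) (f : R^o -> R^o).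
Proof.
move=> oU df cf'; split=> [t /df/(derive1_dir 0)[]//|v].
apply: (class_C_ext oU (f := fun t : R^o => (v * f' t : R) : R^o)).
  by move=> t Ut; rewrite (derive1_dir v (df t Ut)).2.
by apply: class_C_mul => //; exact: class_C_cst.
Qed.

Lemma class_C0_of_derive (U : set R) (f f' : R -> R) :
  (forall t, U t -> deriv t f (f' t)) -> class_C 0 (U : set R^o) (f : R^o -> R^o).
Proof.
move=> df t Ut; apply: differentiable_continuous.
exact: (derive1_dir 0 (df t Ut)).1.
Qed.

Lemma smooth_of_derive (U : set R) (f f' : R -> R) : open (U : set R^o) ->
  (forall t, U t -> deriv t f (f' t)) -> smooth_on (U : set R^o) (f' : R^o -> R^o) ->
  smooth_on (U : set R^o) (f : R^o -> R^o).
Proof.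
move=> oU df sf [|k]; first exact: class_C0_of_derive df.
exact: class_C_of_derive df (sf k).
Qed.

Lemma smooth_derive1 (h : R -> R) : smooth_on [set: R^o] (h : R^o -> R^o) ->
  smooth_on [set: R^o] ((h^`())%classic : R^o -> R^o) /\
  forall t, deriv t h ((h^`())%classic t).
Proof.
move=> sh; split=> [k|t].
  apply: (class_C_ext openT (f := 'D_(1 : R^o) (h : R^o -> R^o))).
    by move=> t _; rewrite derive1E.
  exact: (sh k.+1).2.
apply: DeriveDef; last by rewrite derive1E.
by apply/derivable1_diffP; exact: (smooth_diff sh).
Qed.

Lemma increasing_of_derive (f f' : R -> R) : (forall t, deriv t f (f' t)) ->
  (forall t, 0 < f' t) -> forall a b, a < b -> f a < f b.
Proof.
move=> df f0 a b ab; have [|t _ E] := MVT ab (fun t _ => df t).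
  by apply: derivable_within_continuous => t _; exact: ex_derive.
by rewrite -subr_gt0 E mulr_gt0// subr_gt0.
Qed.

(** The range is open by monotonicity and the intermediate value theorem. The
    derivative of the inverse is [1 / f'] composed with the inverse, so its
    regularity improves by one order at a time. *)
Lemma smooth_inverse (f f' : R -> R) : (forall t, deriv t f (f' t)) ->
  (forall t, 0 < f' t) -> smooth_on [set: R^o] (f' : R^o -> R^o) ->
  open (range f : set R^o) /\ exists g : R -> R, (forall t, g (f t) = t) /\
    smooth_on (range f : set R^o) (g : R^o -> R^o).
Proof.
move=> df f0 sf; have mono := increasing_of_derive df f0.
have cf t : {for t, continuous f}.
  exact/differentiable_continuous/(derive1_dir 0 (df t)).1.
have injf a b : f a = f b -> a = b.
  by have [/mono|/mono|//] := ltgtP a b => H E; move: H; rewrite E ltxx.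
have oI : open (range f : set R^o).
  rewrite openE => _ [t _ <-].
  have lt1 : f (t - 1) < f t by apply: mono; rewrite ltrBlDr ltrDl.
  have lt2 : f t < f (t + 1) by apply: mono; rewrite ltrDl.
  have : nbhs (f t : R^o) (`]f (t - 1), f (t + 1)[%classic : set R^o).
    by apply: open_nbhs_nbhs; split; [exact: interval_open|rewrite /= in_itv /= lt1 lt2].
  apply: filterS => y /=; rewrite in_itv /= => /andP[y1 y2].
  have [| | |r _ ry] := @IVT R f (t - 1) (t + 1) y; last by exists r.
  - by rewrite lerD2l; lra.
  - by apply: continuous_subspaceT => r; exact: cf.
  - rewrite min_l ?max_r ?(ltW y1) ?(ltW y2)//; by rewrite ltW// (lt_trans lt1).
split=> //; pose g y := xget 0 [set t | f t = y].
have gK t : g (f t) = t.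
  by apply: injf; rewrite /g; case: xgetP => [r -> //|/(_ t)]; case.
exists g; split=> //.
have dg y : range f y -> deriv y g (f' (g y))^-1.
  move=> [t _ <-]; rewrite gK; apply: is_derive_inverse (df t) (lt0r_neq0 (f0 t)).
  - by near=> r; exact: gK.
  - by near=> r; exact: cf.
have cinv : forall k, class_C k [set: R^o] (fun t : R^o => (f' t)^-1 : R^o).
  by move=> k; apply: (class_C_inv openT) => // t _; rewrite lt0r_neq0.
elim=> [|k ih]; first exact: class_C0_of_derive dg.
refine (class_C_of_derive oI dg _).
exact: (class_C_comp1 (f := fun t : R => (f' t)^-1 : R^o) (U' := setT) oI
  (fun _ _ => I) ih (cinv k)).
Unshelve. all: by end_near. Qed.

End SmoothOneVariable.

(** * Kropina metrics on the product *)

Lemma unitmx_of_kernel (F : fieldType) n (A : 'M[F]_n) :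
  (forall v : 'rV[F]_n, A *m v^T = 0 -> v = 0) -> A \in unitmx.
Proof.
move=> A0; rewrite -unitmx_tr -row_free_unit; apply/inj_row_free => v vA.
by apply: A0; rewrite -[A]trmxK -trmx_mul vA trmx0.
Qed.

Section Profile.
Context {R : realType} {d : nat} {N : @manifold R d}.
Local Notation deriv t f l := (is_derive (t : R^o) (1 : R^o) (f : R^o -> R^o) (l : R^o)).
Variables (c : @chart R (line_product N) (1 + d)) (lc : local_coordinates c).
Local Notation V := 'rV[R]_(1 + d).
Variables (B : domain V) (Bc : forall x, B x -> chart_cod c x).

Lemma pull_exists (f : R -> R) : smooth_on [set: R^o] (f : R^o -> R^o) ->
  exists F : smfun B, forall x, B x -> F x = f (x1 c x).
Proof.
move=> sf; have s1 : smooth_on B (x1 c : V -> R^o) := smooth_sub Bc (smooth_x1 lc).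
have sF : smooth_on B (fun x => f (x1 c x) : R^o).
  by move=> k; apply: (class_C_comp1 (U' := setT) (domain_open B) (fun _ _ => I) (s1 k) (sf k)).
by exists (to_smfun sF) => x Bx; rewrite to_smfunE.
Qed.

Lemma sD_pull (F : smfun B) (f : R -> R) (l : R) x v :
  (forall x, B x -> F x = f (x1 c x)) -> B x -> deriv (x1 c x) f l ->
  sD v F x = l * beta c x v.
Proof.
move=> FE Bx df; have [dd DE] := derive1_dir (beta c x v) df.
rewrite -(derive_agree (g := (f : R^o -> R^o) \o (x1 c : V -> R^o)) v Bx).
  rewrite derive_comp ?DE 1?mulrC//.
  by apply: smooth_diff (smooth_x1 lc) _; exact: Bc.
by move=> z Bz; rewrite FE.
Qed.

Variables (h sig : R -> R).
Hypothesis h_smooth : smooth_on [set: R^o] (h : R^o -> R^o).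
Hypothesis h_neq0 : forall t, h t != 0.
Hypothesis sigD : forall t, deriv t sig (h t ^+ 2)^-1.
Local Notation h1 := (h^`())%classic.
Local Notation h2 := (h^`(2))%classic.

Let hh (t : R) : deriv t h (h1 t).
Proof. exact: (smooth_derive1 h_smooth).2. Qed.
Let sh1 : smooth_on [set: R^o] (h1 : R^o -> R^o).
Proof. exact: (smooth_derive1 h_smooth).1. Qed.
Let hh1 (t : R) : deriv t h1 (h2 t).
Proof. exact: (smooth_derive1 sh1).2. Qed.
Let sh2 : smooth_on [set: R^o] (h2 : R^o -> R^o).
Proof. exact: (smooth_derive1 sh1).1. Qed.

Let smM (f g : R -> R) : smooth_on [set: R^o] (f : R^o -> R^o) ->
  smooth_on [set: R^o] (g : R^o -> R^o) ->
  smooth_on [set: R^o] ((fun t => f t * g t) : R^o -> R^o).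
Proof. by move=> sf sg k; apply: class_C_mul; [exact: openT|exact: sf|exact: sg]. Qed.
Let smA (f g : R -> R) : smooth_on [set: R^o] (f : R^o -> R^o) ->
  smooth_on [set: R^o] (g : R^o -> R^o) ->
  smooth_on [set: R^o] ((fun t => f t + g t) : R^o -> R^o).
Proof. by move=> sf sg k; apply: class_C_add; [exact: openT|exact: sf|exact: sg]. Qed.
Let smC (r : R) : smooth_on [set: R^o] ((fun=> r) : R^o -> R^o).
Proof. by move=> k; exact: class_C_cst. Qed.

Lemma smooth_sig : smooth_on [set: R^o] (sig : R^o -> R^o).
Proof.
apply: (smooth_of_derive openT (fun t _ => sigD t)) => k.
apply: (class_C_inv openT) => [t _|]; first by rewrite expf_neq0.
exact: (smM h_smooth h_smooth).
Qed.

(** Here [k = h^2], and [k1], [k2] are its derivatives with respect to the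
    parameter [s = sig(x1)], computed with [dt/ds = h^2]. *)
Lemma kropina_profile : exists s k k1 k2 : smfun B,
  [/\ forall v, sD v k = k1 * sD v s, forall v, sD v k1 = k2 * sD v s &
  forall x, B x -> [/\ s x = sig (x1 c x), k x = h (x1 c x) ^+ 2,
     k1 x = 2 * h (x1 c x) ^+ 3 * h1 (x1 c x),
     k2 x = 6 * h (x1 c x) ^+ 4 * h1 (x1 c x) ^+ 2 + 2 * h (x1 c x) ^+ 5 * h2 (x1 c x) &
     forall v, sD v s x = beta c x v / h (x1 c x) ^+ 2]].
Proof.
have [s sE] := pull_exists smooth_sig.
have sh3 := smM h_smooth (smM h_smooth h_smooth).
have [k kE] := pull_exists (smM h_smooth h_smooth).
have [k1 k1E] := pull_exists (smM (smM (smC 2) sh3) sh1).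
have [k2 k2E] := pull_exists (smA
  (smM (smM (smC 6) (smM h_smooth sh3)) (smM sh1 sh1))
  (smM (smM (smC 2) (smM (smM h_smooth h_smooth) sh3)) sh2)).
have bE v x : B x -> sD v s x = beta c x v / h (x1 c x) ^+ 2.
  by move=> Bx; rewrite (sD_pull v sE Bx (sigD _)) mulrC.
exists s, k, k1, k2; split.
- move=> v; apply: smfunP => x Bx; rewrite (smfun_mulE _ _ Bx) bE// k1E//.
  rewrite (sD_pull v kE Bx (is_derive1M (hh _) (hh _))).
  by field.
- move=> v; apply: smfunP => x Bx; rewrite (smfun_mulE _ _ Bx) bE// k2E//.
  rewrite (sD_pull v k1E Bx (is_derive1M (is_derive1M (is_derive_cst (2 : R^o) _ _)
    (is_derive1M (hh _) (is_derive1M (hh _) (hh _)))) (hh1 _))).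
  by rewrite cstE; field.
- move=> x Bx; split=> [|||| v]; rewrite ?sE ?kE ?k1E ?k2E ?bE//; ring.
Qed.

End Profile.

Section Adapted.
Context {R : realType} {d : nat} {N : @manifold R d} (a : riemannian_metric N).
Local Notation V := 'rV[R]_(1 + d).
Local Notation deriv t f l := (is_derive (t : R^o) (1 : R^o) (f : R^o -> R^o) (l : R^o)).
Variables (c : @chart R (line_product N) (1 + d)) (lc : local_coordinates c).
Variables (h sig : R -> R).
Hypothesis h_smooth : smooth_on [set: R^o] (h : R^o -> R^o).
Hypothesis h_neq0 : forall t, h t != 0.
Hypothesis sigD : forall t, deriv t sig (h t ^+ 2)^-1.
Local Notation h1 := (h^`())%classic.
Local Notation h2 := (h^`(2))%classic.

Lemma alpha_sq_ge0 x y : chart_cod c x -> 0 <= alpha_sq a h c x y.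
Proof.
by move=> cx; rewrite /alpha_sq addr_ge0 ?sqr_ge0// mulr_ge0 ?sqr_ge0 ?alpha_tilde_sq_ge0.
Qed.

Lemma kropina_slopeE x y b : chart_cod c x -> 0 < b -> b = beta c x y / h (x1 c x) ^+ 2 ->
  kropina a h c x y = h (x1 c x) ^+ 2 * b + alpha_tilde_sq a c x y / b.
Proof.
move=> cx b0 bE; have h0 := h_neq0 (x1 c x).
have -> : kropina a h c x y = alpha_sq a h c x y / beta c x y.
  by rewrite /kropina /alpha sqr_sqrtr// alpha_sq_ge0.
have betaE : beta c x y = h (x1 c x) ^+ 2 * b by rewrite bE; field.
rewrite /alpha_sq betaE; move: (alpha_tilde_sq _ _ _ _) (h _) h0 b0 => q r r0 /lt0r_neq0 b0.
by field; rewrite r0 b0.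
Qed.

Variables (e : @chart R N d) (le : local_coordinates e).
Local Notation X := (factor_coord c e).
Definition overlap_domain : domain V := Domain (@overlap_open _ _ _ c (line_chart e)).
Local Notation B := overlap_domain.

Let Bc x : B x -> chart_cod c x.
Proof. by move=> /product_overlapP[]. Qed.

Lemma factor_coord_entries (U : domain V) : (forall x, U x -> B x) ->
  exists u : 'I_d -> smfun U,
  (forall j x, U x -> u j x = X x 0 j) /\
  forall v j x, U x -> sD v (u j) x = ('D_v X x) 0 j.
Proof.
move=> UB; have sX : smooth_on U X by apply: (smooth_sub _ (smooth_factor_coord lc le)).
have sXj j : smooth_on U (fun x => X x 0 j : R^o).
  by move=> k; apply: class_C_entry; [exact: domain_open|exact: sX].
exists (fun j => to_smfun (sXj j)); split=> [j x Bx|v j x Bx]; first exact: to_smfunE.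
rewrite -derive_entry; last exact: smooth_diff sX Bx.
by rewrite -(derive_agree (g := fun x => X x 0 j : R^o) v Bx)// => z Bz; rewrite to_smfunE.
Qed.

Hypothesis flat : forall x, chart_cod e x -> a e x = 1%:M.

(** The functions [w] are [s] and the flat coordinates of the factor; they are
    coordinates because those of a product chart are, [sig] having nonzero
    derivative. *)
Lemma adapted_functions : exists (w : 'I_(1 + d) -> smfun B) (k k1 k2 : smfun B),
  let s := w (lshift d 0) in
  [/\ [/\ forall x, B x -> 0 < k x, forall v, sD v k = k1 * sD v s &
       forall v, sD v k1 = k2 * sD v s],
    forall x, B x -> \matrix_(i, j) sD (delta_mx 0 j) (w i) x \in unitmx,
    forall x y, B x -> 0 < sD y s x -> kropina a h c x y =
      k x * sD y s x + (\sum_(i | i != lshift d 0) sD y (w i) x ^+ 2) / sD y s x,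
    (forall x, B x -> s x = sig (x1 c x)) /\
    (forall j x, B x -> w (rshift 1 j) x = X x 0 j) &
    forall x, B x -> [/\ k x = h (x1 c x) ^+ 2, k1 x = 2 * h (x1 c x) ^+ 3 * h1 (x1 c x),
     k2 x = 6 * h (x1 c x) ^+ 4 * h1 (x1 c x) ^+ 2 + 2 * h (x1 c x) ^+ 5 * h2 (x1 c x) &
     forall v, sD v s x = beta c x v / h (x1 c x) ^+ 2]].
Proof.
have [s [k [k1 [k2 [kD k1D val]]]]] := kropina_profile lc Bc h_smooth h_neq0 sigD.
have [u [uE uD]] := @factor_coord_entries B (fun x Bx => Bx).
pose w (i : 'I_(1 + d)) := match fintype.split i with inl _ => s | inr j => u j end.
have ws : w (lshift d 0) = s by rewrite /w (unsplitK (inl 0)).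
have wu j : w (rshift 1 j) = u j by rewrite /w (unsplitK (inr j)).
have qE x y : B x -> \sum_(i | i != lshift d 0) sD y (w i) x ^+ 2 = alpha_tilde_sq a c x y.
  move=> Bx; rewrite (alpha_tilde_sqE lc le _ _ Bx) flat; last first.
    by exists (point c x).2 => //; have [_ ?] := iffLR (product_overlapP c e x) Bx.
  rewrite mulmx1 mxE big_mkcond big_split_ord /= big_ord1 eqxx add0r.
  by apply: eq_bigr => j _; rewrite mxE wu uD// expr2.
exists w, k, k1, k2; rewrite /= ws; split.
- split=> // x Bx; have [_ -> _ _ _] := val x Bx.
  by rewrite lt_neqAle sqr_ge0 andbT eq_sym expf_neq0.
- move=> x Bx0; apply: unitmx_of_kernel => v Mv; have Bx : B x := Bx0.
  have wv i : sD v (w i) x = 0.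
    rewrite (sD_row _ _ Bx); transitivity ((\matrix_(i, j) sD (delta_mx 0 j) (w i) x *m v^T) i 0).
      by rewrite mxE; apply: eq_bigr => j _; rewrite !mxE mulrC.
    by rewrite Mv mxE.
  apply: (product_coord_inj lc le Bx).
    have := wv (lshift d 0); rewrite ws; have [_ _ _ _ ->] := val x Bx.
    by move=> /eqP; rewrite mulf_eq0 invr_eq0 expf_eq0 (negPf (h_neq0 _)) andbF orbF => /eqP.
  by apply/rowP => j; rewrite -uD// -wu wv mxE.
- move=> x y Bx; have [_ kE _ _ bE] := val x Bx; rewrite qE// kE => s0.
  by apply: kropina_slopeE => //; exact: Bc.
- by split=> [x /val[]//|j x Bx]; rewrite wu uE.
- by move=> x /val[].
Qed.

(** The formula of [adapted_curvature], rewritten with [ds(y) = beta / h^2]. *)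
Lemma kropina_curvature x y i j : overlap c (line_chart e) x -> 0 < beta c x y ->
  riemann_curvature (kropina a h c) i j x y =
  - (beta c x y / alpha a h c x y) ^+ 6 *
         (h2 (x1 c x) / h (x1 c x) +
          3 * h1 (x1 c x) ^+ 2 * (alpha_tilde a c x y / alpha a h c x y) ^+ 2)
   * kropina a h c x y ^+ 2 *
    ((i == j)%:R - (kropina a h c x y ^+ 2)^-1 * y 0 i * ell (kropina a h c) j x y).
Proof.
move=> Bx b0; have [w [k [k1 [k2 [[k_pos kD k1D] w_unit FE _ val]]]]] := adapted_functions.
have [kE k1E k2E sE] := val x Bx.
have cx := Bc Bx; have h0 := h_neq0 (x1 c x).
have s0 : 0 < sD y (w (lshift d 0)) x.
  by rewrite sE divr_gt0// lt_neqAle sqr_ge0 andbT eq_sym expf_neq0.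
rewrite (adapted_curvature k_pos kD k1D w_unit FE)//; congr (_ * _ * _).
have A0 : alpha a h c x y ^+ 2 = alpha_sq a h c x y by rewrite /alpha sqr_sqrtr// alpha_sq_ge0.
have q0 : alpha_tilde a c x y ^+ 2 = alpha_tilde_sq a c x y.
  by rewrite /alpha_tilde sqr_sqrtr// alpha_tilde_sq_ge0.
have qge := alpha_tilde_sq_ge0 lc a y cx.
rewrite k1E k2E sE {w k k1 k2 k_pos kD k1D w_unit FE val kE k1E k2E sE s0}.
have FE : kropina a h c x y = alpha_sq a h c x y / beta c x y by rewrite /kropina A0.
rewrite FE !expr_div_n q0 A0 (_ : alpha a h c x y ^+ 6 = alpha_sq a h c x y ^+ 3); last first.
  by rewrite -A0 -exprM.
rewrite /alpha_sq.
have pos : 0 < beta c x y ^+ 2 + h (x1 c x) ^+ 2 * alpha_tilde_sq a c x y.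
  by apply: ltr_wpDr; [rewrite mulr_ge0 ?sqr_ge0|rewrite exprn_gt0].
move: pos b0 h0; move: (beta c x y) (alpha_tilde_sq a c x y) (h (x1 c x)) (h1 _) (h2 _).
move=> b q r r1 r2 /lt0r_neq0 pos /lt0r_neq0 b0 r0.
by field; rewrite r0 b0 pos.
Qed.

(** In the chart formed by [sig(x1)] and the flat coordinates the functions [w]
    are linear, so the second-order term of [adapted_spray] is zero. *)
Lemma kropina_spray_flat x y (i : 'I_(1 + d)) :
  (forall z, chart_cod c z -> lsubmx z 0 0 = sig (x1 c z) /\ rsubmx z = X z) ->
  overlap c (line_chart e) x -> 0 < beta c x y ->
  spray (kropina a h c) i x y =
    (h (x1 c x))^-1 * h1 (x1 c x) * beta c x y ^+ 2 / kropina a h c x y * y 0 i.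
Proof.
move=> cE Bx b0; have [w [k [k1 [k2 [[k_pos kD k1D] w_unit FE [wl wr] val]]]]] := adapted_functions.
have [kE k1E k2E sE] := val x Bx.
have cx := Bc Bx; have h0 := h_neq0 (x1 c x).
have s0 : 0 < sD y (w (lshift d 0)) x.
  by rewrite sE divr_gt0// lt_neqAle sqr_ge0 andbT eq_sym expf_neq0.
have wE z l : B z -> w l z = z 0 l.
  move=> Bz; have [zl zr] := cE z (Bc Bz); case: (split_ordP l) => m ->.
    by rewrite (ord1 m) wl// -zl mxE.
  by rewrite wr// -zr mxE.
have wD z l v : B z -> sD v (w l) z = v 0 l.
  move=> Bz; rewrite -(derive_agree (g := fun z : V => z 0 l : R^o) v Bz); last first.
    by move=> z' Bz'; rewrite wE.
  by rewrite derive_entry// derive_id.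
have wDD z l u v : B z -> sD u (sD v (w l)) z = 0.
  move=> Bz; rewrite -(derive_agree (g := fun z : V => v 0 l : R^o) u Bz); last first.
    by move=> z' Bz'; rewrite wD.
  by rewrite derive_cst.
have := adapted_spray k_pos kD w_unit FE i Bx s0.
rewrite wDD// mulr0 addr0 (bigD1 i)//= big1 ?addr0 => [|l li]; last first.
  by rewrite wD// !mxE eq_sym (negPf li) mul0r.
rewrite (wD x i (delta_mx 0 i) Bx) mxE !eqxx mul1r => ->.
rewrite k1E sE (wD x i y Bx); congr (_ * _).
have F0 : kropina a h c x y != 0.
  rewrite FE// gt_eqF// ltr_wpDr ?mulr_gt0 ?k_pos// divr_ge0 ?(ltW s0)//.
  by rewrite sumr_ge0// => l _; exact: sqr_ge0.
move: (kropina _ _ _ _ _) F0 (beta _ _ _) (h _) h0 (h1 _) => F F0 b r r0 r1.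
by field; rewrite F0 r0.
Qed.

End Adapted.

(** * Flat factors *)

Section NewCharts.
Context {R : realType} {n : nat} (M : @manifold R n).

(** A chart is tested against the atlas through a chart [c0] that covers its
    domain. *)
Lemma local_of_compatible (c0 c : chart M n) : local_coordinates c0 ->
  chart_dom c `<=` chart_dom c0 -> compatible c c0 -> local_coordinates c.
Proof.
move=> l0 cc0 [s10 s01] b ab; have [s0b sb0] := l0 b ab; split.
- apply: (smooth_agree (@overlap_open _ _ _ c b) (f := transition c0 b \o transition c c0)).
    move=> x /overlapP[/chart_cod_point[cx _] bx].
    by rewrite /transition /= coordK//; exact: cc0.
  refine (smooth_compv (@overlap_open _ _ _ c b) (@overlap_open _ _ _ c0 b) _ _ s0b).
    move=> x /overlapP[/chart_cod_point[cx _] bx]; apply/overlapP.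
    by rewrite /transition /= coordK; [split=> //; exists (point c x) => //|]; exact: cc0.
  apply: (smooth_sub _ s10) => x /overlapP[/[dup] ? /chart_cod_point[cx _] bx]; apply/overlapP.
  by split=> //; exact: cc0.
- apply: (smooth_agree (@overlap_open _ _ _ b c) (f := transition c0 c \o transition b c0)).
    move=> x /overlapP[bx cx].
    by rewrite /transition /= coordK//; exact: cc0.
  refine (smooth_compv (@overlap_open _ _ _ b c) (@overlap_open _ _ _ c0 c) _ _ s01).
    move=> x /overlapP[bx cx]; apply/overlapP.
    by rewrite /transition /= coordK; [split=> //; exists (point b x) => //|]; exact: cc0.
  apply: (smooth_sub _ sb0) => x /overlapP[bx cx]; apply/overlapP.
  by split=> //; exact: cc0.
Qed.

Variables (c0 : @chart R M n) (A : set 'rV[R]_n) (phi psi : 'rV[R]_n -> 'rV[R]_n).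
Hypotheses (l0 : local_coordinates c0) (oA : open A) (A0 : A `<=` chart_cod c0).
Hypotheses (oI : open (phi @` A)) (phiK : forall x, A x -> psi (phi x) = x).
Hypotheses (sphi : smooth_on A phi) (spsi : smooth_on (phi @` A) psi).

Let dom : set M := [set p | chart_dom c0 p /\ A (coord c0 p)].

Let image_dom : (phi \o coord c0) @` dom = phi @` A.
Proof.
apply/seteqP; split=> [_ [p [cp Ap] <-]|_ [x Ax <-]]; first by exists (coord c0 p).
by have [cx xE] := chart_cod_point (A0 Ax); exists (point c0 x); rewrite /dom /= xE.
Qed.

Let cod_open : open ((phi \o coord c0) @` dom). Proof. by rewrite image_dom. Qed.

Let cK p : dom p -> (point c0 \o psi) ((phi \o coord c0) p) = p.
Proof. by move=> [cp Ap]; rewrite /= phiK// coordK. Qed.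

Let c_cont p : dom p -> {for p, continuous (phi \o coord c0)}.
Proof.
move=> [cp Ap]; apply: continuous_comp; first exact: coord_continuous.
exact/differentiable_continuous/(smooth_diff sphi).
Qed.

Let p_cont x : ((phi \o coord c0) @` dom) x -> {for x, continuous (point c0 \o psi)}.
Proof.
rewrite image_dom => Ix; apply: continuous_comp.
  exact/differentiable_continuous/(smooth_diff spsi).
by apply: point_continuous; case: Ix => z Az <-; rewrite phiK//; exact: A0.
Qed.

(** Composing a chart, restricted to a part of its range, with a
    diffeomorphism gives a chart; both flat and projective coordinates are
    constructed in this way. *)
Lemma reparametrized_chart : exists c : chart M n,
  [/\ local_coordinates c, chart_cod c = phi @` A,
      forall p, chart_dom c p <-> chart_dom c0 p /\ A (coord c0 p),
      forall p, coord c p = phi (coord c0 p) &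
      forall x, point c x = point c0 (psi x)].
Proof.
pose c := Chart (@preimage_coord_open _ _ _ c0 _ oA) cod_open cK c_cont p_cont.
have cc : chart_cod c = phi @` A by exact: image_dom.
exists c; split=> //.
apply: (local_of_compatible l0) => [p []//|]; split.
- apply: (smooth_agree (@overlap_open _ _ _ c c0) (f := psi)).
    move=> x /overlapP[]; rewrite cc => -[z Az <-] _.
    by rewrite /transition /= phiK//; have [] := chart_cod_point (A0 Az).
  by apply: (smooth_sub _ spsi) => x /overlapP[]; rewrite cc.
- apply: (smooth_agree (@overlap_open _ _ _ c0 c) (f := phi)).
    by move=> x /overlapP[/chart_cod_point[_ xE] _]; rewrite /transition /= xE.
  by apply: (smooth_sub _ sphi) => x /overlapP[/chart_cod_point[_ xE] []]; rewrite xE.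
Qed.

End NewCharts.

Section Homogeneity.
Context {R : realType} {d : nat} {N : @manifold R d} (a : riemannian_metric N) (h : R -> R).
Variables (c : @chart R (line_product N) (1 + d)) (lc : local_coordinates c).

Lemma betaZ x l y : chart_cod c x -> beta c x (l *: y) = l * beta c x y.
Proof.
move=> cx; have df := smooth_diff (smooth_x1 lc) cx.
by rewrite /beta !deriveE// linearZ.
Qed.

Lemma alpha_tilde_sqZ x l y : chart_cod c x ->
  alpha_tilde_sq a c x (l *: y) = l ^+ 2 * alpha_tilde_sq a c x y.
Proof.
move=> cx; have [e [ae ex]] := atlas_cover (point c x).2; have le := atlas_local ae.
have ox : overlap c (line_chart e) x by apply/product_overlapP.
rewrite !(alpha_tilde_sqE lc le _ _ ox).
have df := smooth_diff (smooth_factor_coord lc le) ox.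
rewrite !(deriveE _ df) linearZ [(_ *: _)^T]linearZ /= -!scalemxAl -scalemxAr mxE mxE.
by rewrite mulrA expr2.
Qed.

Lemma alpha_sqZ x l y : chart_cod c x ->
  alpha_sq a h c x (l *: y) = l ^+ 2 * alpha_sq a h c x y.
Proof. by move=> cx; rewrite /alpha_sq betaZ// alpha_tilde_sqZ//; ring. Qed.

Lemma kropinaE x y : chart_cod c x ->
  kropina a h c x y = alpha_sq a h c x y / beta c x y.
Proof. by move=> cx; rewrite /kropina /alpha sqr_sqrtr// alpha_sq_ge0. Qed.

Lemma alpha_sq_gt0 x y : chart_cod c x -> 0 < beta c x y -> 0 < alpha_sq a h c x y.
Proof.
move=> cx b0; apply: ltr_wpDr; last by rewrite exprn_gt0.
by rewrite mulr_ge0 ?sqr_ge0 ?alpha_tilde_sq_ge0.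
Qed.

End Homogeneity.

Section FlatCase.
Context {R : realType} {d : nat} {N : @manifold R d} (a : riemannian_metric N) (h : R -> R).
Local Notation V := 'rV[R]_(1 + d).
Local Notation deriv t f l := (is_derive (t : R^o) (1 : R^o) (f : R^o -> R^o) (l : R^o)).
Hypothesis h_smooth : smooth_on [set: R] (h : R -> R^o).
Hypothesis h_neq0 : forall t, h t != 0.

(** The parameter [sig] of the line for which [beta = h^2 d(sig)]. *)
Lemma projective_parameter_exists : exists sig : R -> R, forall t, deriv t sig (h t ^+ 2)^-1.
Proof.
apply: primitive => t; apply: (@cvgV R R^o); first by rewrite expf_neq0.
have ch : {for t, continuous (h : R -> R)}.
  exact/differentiable_continuous/(smooth_diff h_smooth).
exact: (cvgM ch ch).
Qed.

Lemma smooth_row_fst (U : set R) (f : R -> R) : open (U : set R^o) ->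
  smooth_on (U : set R^o) (f : R^o -> R^o) ->
  let W := [set x : V | U (lsubmx x 0 0)] in
  open W /\ smooth_on W (fun x : V => row_mx (f (lsubmx x 0 0))%:M (rsubmx x)).
Proof.
move=> oU sf W.
have sl : smooth_on [set: V] (fun x : V => x 0 (lshift d 0) : R^o).
  move=> k; apply: class_C_entry; first exact: openT.
  by apply: (@class_C_linear _ _ _ _ _ idfun) => x; exact: cvg_id.
have lE (x : V) : lsubmx x 0 0 = x 0 (lshift d 0) by rewrite mxE.
have lfE : (fun x : V => lsubmx x 0 0 : R^o) = (fun x : V => x 0 (lshift d 0) : R^o).
  by apply/funext.
have oW : open W.
  apply: (@open_comp _ _ (fun x : V => lsubmx x 0 0 : R^o)) oU => x _.
  by rewrite lfE; exact: (differentiable_continuous (smooth_diff sl (I : [set: V] x))).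
split=> // k; apply: class_C_row => // j; case: (split_ordP j) => i ->.
  apply: (class_C_ext oW (f := fun x : V => f (x 0 (lshift d 0)) : R^o)) => [x _|].
    by rewrite row_mxEl (ord1 i) mxE eqxx lE.
  refine (class_C_comp1 (U' := U) oW _ _ (sf k)) => [x|].
    by rewrite /W /= lE.
  exact: class_C_sub (sl k).
apply: (class_C_ext oW (f := fun x : V => x 0 (rshift 1 i) : R^o)) => [x _|].
  by rewrite row_mxEr mxE.
apply: class_C_entry => //.
by apply: (@class_C_linear _ _ _ _ _ idfun) => x; exact: cvg_id.
Qed.

(** The projective chart replaces the coordinate of the line by [sig] and uses
    flat coordinates on the factor. *)
Lemma flat_projectively_flat : locally_flat a ->
  locally_projectively_flat (@kropina_domain R d N) (kropina a h).
Proof.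
move=> flat p; have [e [le ep ae]] := flat p.2.
have [sig sigD] := projective_parameter_exists.
have h2pos t : 0 < (h t ^+ 2)^-1.
  by rewrite invr_gt0 lt_neqAle sqr_ge0 andbT eq_sym expf_neq0.
have ssig := smooth_sig h_smooth h_neq0 sigD.
have sh2 : smooth_on [set: R^o] (fun t : R^o => (h t ^+ 2)^-1 : R^o).
  move=> k; apply: (class_C_inv openT) => [t _|]; first by rewrite expf_neq0.
  exact: (class_C_mul openT (h_smooth k) (h_smooth k)).
have [oI [g [gK sg]]] := smooth_inverse sigD h2pos sh2.
pose phi (x : V) : V := row_mx (sig (lsubmx x 0 0))%:M (rsubmx x).
pose psi (x : V) : V := row_mx (g (lsubmx x 0 0))%:M (rsubmx x).
have sphi : smooth_on setT phi := (smooth_row_fst openT ssig).2.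
have oW := (smooth_row_fst oI sg).1.
have spsi : smooth_on [set x : V | range sig (lsubmx x 0 0)] psi := (smooth_row_fst oI sg).2.
pose A : set V := chart_cod (line_chart e).
have oA : open A by exact: chart_cod_open.
have AE x : A x <-> chart_cod e (rsubmx x).
  by have -> : A = [set x | chart_cod e (rsubmx x)] := line_image e (chart_dom e).
have phiK x : psi (phi x) = x.
  rewrite /psi /phi row_mxKl row_mxKr mxE eqxx mulr1n gK.
  by rewrite -mx11_scalar hsubmxK.
have imE : phi @` A = [set x | range sig (lsubmx x 0 0)] `&` A.
  apply/seteqP; split=> [_ [x /AE Ax <-]|x [[t _ tx] /AE Ax]].
    split; last by apply/AE; rewrite /phi row_mxKr.
    by rewrite /phi /= row_mxKl mxE eqxx; exists (lsubmx x 0 0).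
  exists (row_mx t%:M (rsubmx x)); first by apply/AE; rewrite row_mxKr.
  rewrite /phi row_mxKl row_mxKr mxE eqxx mulr1n tx.
  by rewrite -mx11_scalar hsubmxK.
have [c [lc cc cd cE pE]] : exists c : chart (line_product N) (1 + d),
  [/\ local_coordinates c, chart_cod c = phi @` A,
      forall p, chart_dom c p <-> chart_dom (line_chart e) p /\ A (coord (line_chart e) p),
      forall p, coord c p = phi (coord (line_chart e) p) &
      forall x, point c x = point (line_chart e) (psi x)].
  apply: reparametrized_chart => //.
  - exact: line_chart_local.
  - by rewrite imE; apply: openI.
  - exact: smooth_sub sphi.
  - by apply: (smooth_sub _ spsi); rewrite imE => x [].
exists c; split=> //; first by apply/cd; split=> //; exists p.
exists (fun x y => (h (x1 c x))^-1 * (h^`())%classic (x1 c x) * beta c x y ^+ 2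
  / kropina a h c x y).
move=> x y cx Dxy; have cxE z : chart_cod c z ->
    lsubmx z 0 0 = sig (x1 c z) /\ rsubmx z = factor_coord c e z.
  rewrite cc => -[w /AE[q eq qw] <-]; rewrite /x1 /factor_coord pE phiK /=.
  by rewrite /phi row_mxKl row_mxKr mxE eqxx mulr1n -qw coordK.
have ox z : chart_cod c z -> overlap c (line_chart e) z.
  move=> cz; apply/overlapP; split=> //.
  by have [/cd[] ] := chart_cod_point cz.
split=> [i|l l0]; first
  exact: (kropina_spray_flat lc h_smooth h_neq0 sigD le ae i cxE (ox x cx) Dxy).
rewrite !kropinaE// betaZ// alpha_sqZ//.
have A2p := alpha_sq_gt0 a h lc cx Dxy; move: A2p Dxy; rewrite /kropina_domain.
move: (alpha_sq _ _ _ _ _) (beta _ _ _) (h _) (h_neq0 (x1 c x)) (_^`()%classic _).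
move=> A2 b r r0 r1 /lt0r_neq0 A20 /lt0r_neq0 b0.
by field; rewrite A20 b0 r0 lt0r_neq0.
Qed.

End FlatCase.

Section FlagCurvature.
Context {R : realType} {d : nat} {N : @manifold R d} (a : riemannian_metric N) (h : R -> R).
Hypothesis hn : (2 <= 1 + d)%N.
Hypothesis h_smooth : smooth_on [set: R] (h : R -> R^o).
Hypothesis h_neq0 : forall t, h t != 0.

(** The identity matrix of size at least 2 does not have rank one. Applied to
    [delta^i_k - F^-2 y^i l_k], it makes the flag curvature unique. *)
Lemma projector_neq0 n (u v : 'I_n -> R) : (2 <= n)%N ->
  exists i k, (i == k)%:R - u i * v k != 0.
Proof.
move=> n2; pose i0 : 'I_n := Ordinal (ltnW n2); pose i1 : 'I_n := Ordinal n2.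
apply/not_existsP => H; have E i k : u i * v k = (i == k)%:R.
  have [/eqP|nz] := boolP ((i == k)%:R - u i * v k == 0); last by case: (H i); exists k.
  by move=> /eqP; rewrite subr_eq0 => /eqP.
have := E i0 i1; have := E i0 i0; have := E i1 i1.
rewrite !eqxx (_ : (i0 == i1) = false)// => e1 e0 /eqP.
rewrite mulf_eq0 => /orP[/eqP z|/eqP z]; [move: e0|move: e1]; rewrite z ?mul0r ?mulr0 => /eqP.
  by rewrite eq_sym oner_eq0.
by rewrite eq_sym oner_eq0.
Qed.

Lemma flag_curvature_of_flat : locally_flat a ->
  forall K : tangent_fun (line_product N) R,
     is_flag_curvature (@kropina_domain R d N) (kropina a h) K <->
     forall c x y, local_coordinates c -> chart_cod c x ->
       kropina_domain c x y ->
       K c x y =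
       - (beta c x y / alpha a h c x y) ^+ 6 *
         (((h^`(2))%classic (x1 c x) : R) / h (x1 c x) +
          3 * ((h^`())%classic (x1 c x) : R) ^+ 2 *
            (alpha_tilde a c x y / alpha a h c x y) ^+ 2).
Proof.
move=> flat K; have [sig sigD] := projective_parameter_exists h_smooth h_neq0.
have RE c x y : local_coordinates c -> chart_cod c x -> kropina_domain c x y ->
    forall i j, riemann_curvature (kropina a h c) i j x y = _ :=
  fun lc cx Dxy i j =>
  let: ex_intro e (And3 le ep ae) := flat (point c x).2 in
  kropina_curvature lc h_smooth h_neq0 sigD le ae i j
    (iffRL (product_overlapP c e x) (conj cx ep)) Dxy.
split=> H c x y lc cx Dxy; last by move=> i k; rewrite H// RE.
set K0 := RHS.
pose F := kropina a h c x y.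
have F0 : F ^+ 2 != 0.
  rewrite expf_neq0// /F kropinaE// mulf_neq0 ?invr_eq0//.
    by rewrite gt_eqF// alpha_sq_gt0.
  by rewrite gt_eqF.
have [i [k]] := projector_neq0 (fun i => (F ^+ 2)^-1 * y 0 i)
  (fun k => ell (kropina a h c) k x y) hn.
move=> m0; have := H c x y lc cx Dxy i k; rewrite RE//.
by move=> /(mulIf m0) /(mulIf F0).
Qed.

End FlagCurvature.

(** * The Weyl structure of a projectively flat Kropina metric *)

Lemma sD_sum {R : realType} {V : normedModType R} (B : domain V) (v : V) (I : Type)
    (r : seq I) (f : I -> smfun B) : sD v (\sum_(i <- r) f i) = \sum_(i <- r) sD v (f i).
Proof.
have sD0 : sD v (0 : smfun B) = 0.
  by apply: (addrI (sD v 0)); rewrite -sD_add !addr0.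
by elim/big_rec2: _ => // i f1 f2 _ <-; exact: sD_add.
Qed.

Section ProjectiveChart.
Context {R : realType} {d : nat} {N : @manifold R d} (a : riemannian_metric N).
Local Notation V := 'rV[R]_(1 + d).
Local Notation deriv t f l := (is_derive (t : R^o) (1 : R^o) (f : R^o -> R^o) (l : R^o)).
Variables (c : @chart R (line_product N) (1 + d)) (lc : local_coordinates c).
Variables (h sig : R -> R).
Hypothesis d_gt0 : (0 < d)%N.
Hypothesis h_smooth : smooth_on [set: R] (h : R -> R^o).
Hypothesis h_neq0 : forall t, h t != 0.
Hypothesis sigD : forall t, deriv t sig (h t ^+ 2)^-1.
Variables (e : @chart R N d) (le : local_coordinates e).
Local Notation X := (factor_coord c e).
Variables (B : domain V) (BW : forall x, B x -> overlap c (line_chart e) x).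

Definition pullback_metric (x u v : V) : R :=
  ('D_u X x *m a e (X x) *m ('D_v X x)^T) 0 0.

Let cod_X x : B x -> chart_cod e (X x).
Proof. by move=> /BW/product_overlapP[_ ex]; exists (point c x).2. Qed.

(** Vectors tangent to the line annihilate the differential of [X], so they
    lie in the kernel of the form; the second clause is the derivative of this
    fact, and holds because the components of the metric are constant along such
    vectors. *)
Lemma pullback_form : exists Q : smooth_form B,
  (forall x u v, B x -> Q u v x = pullback_metric x u v) /\
  forall x n y, B x -> 'D_n X x = 0 -> sD n (Q y y) x = 2 * sD y (Q n y) x.
Proof.
have [w [wE wD]] := factor_coord_entries lc le BW.
have sg i j : smooth_on B (fun x => a e (X x) i j : R^o).
  move=> k; apply: (@class_C_comp _ _ _ _ _ (chart_cod e) X (fun z => a e z i j : R^o)).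
  - exact: domain_open.
  - exact: cod_X.
  - exact: (class_C_sub BW (smooth_factor_coord lc le k)).
  - exact: metric_smooth.
pose g i j := to_smfun (sg i j).
have gE i j x : B x -> g i j x = a e (X x) i j by move=> Bx; rewrite to_smfunE.
have gC i j : g i j = g j i.
  by apply: smfunP => x Bx; rewrite !gE// -[in LHS](metric_sym a le (cod_X Bx)) mxE.
pose q u v : smfun B := \sum_i \sum_j g i j * (sD u (w i) * sD v (w j)).
have qC u v : q u v = q v u.
  rewrite /q exchange_big; apply: eq_bigr => i _; apply: eq_bigr => j _.
  by rewrite gC (mulrC (sD u _)).
have ql r u v z : q (r *: u + v) z = smfun_cst B r * q u z + q v z.
  rewrite /q mulr_sumr -big_split; apply: eq_bigr => i _.
  rewrite mulr_sumr -big_split; apply: eq_bigr => j _ /=.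
  by rewrite sD_dir; ring.
exists (SmoothForm qC ql); split=> [x u v Bx|x n y Bx Xn] /=.
  rewrite /pullback_metric /q (smfun_sumE _ _ _ Bx) mxE.
  transitivity (\sum_i \sum_j g i j x * (sD u (w i) x * sD v (w j) x)).
    apply: eq_bigr => i _; rewrite (smfun_sumE _ _ _ Bx); apply: eq_bigr => j _.
    by rewrite !(smfun_mulE _ _ Bx).
  rewrite exchange_big; apply: eq_bigr => j _; rewrite !mxE mulr_suml.
  by apply: eq_bigr => i _; rewrite !wD// gE//; ring.
have n0 i : sD n (w i) x = 0 by rewrite wD// Xn mxE.
have ng i j : sD n (g i j) x = 0.
  rewrite -(derive_agree (g := (fun z => a e z i j : R^o) \o X) n Bx); last first.
    by move=> z Bz; rewrite gE.
  have dX : differentiable X x by apply: (smooth_diff (smooth_factor_coord lc le)); exact: BW.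
  have dg := smooth_diff (metric_smooth a le i j) (cod_X Bx).
  by rewrite derive_comp// Xn deriveE// linear0.
have M f1 f2 := smfun_mulE f1 f2 Bx.
pose p i j : R := g i j x * (sD n (sD y (w i)) x * sD y (w j) x).
have E1 : sD y (q n y) x = \sum_i \sum_j p i j.
  rewrite sD_sum (smfun_sumE _ _ _ Bx); apply: eq_bigr => i _.
  rewrite sD_sum (smfun_sumE _ _ _ Bx); apply: eq_bigr => j _.
  rewrite !sD_mul (smfun_addE _ (g i j * _) Bx) !M (smfun_addE _ _ Bx) !M !n0 (sD_swap y n).
  by rewrite !(mul0r, mulr0, addr0, add0r).
have E2 : sD n (q y y) x = \sum_i \sum_j (p i j + p j i).
  rewrite sD_sum (smfun_sumE _ _ _ Bx); apply: eq_bigr => i _.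
  rewrite sD_sum (smfun_sumE _ _ _ Bx); apply: eq_bigr => j _.
  rewrite !sD_mul (smfun_addE _ (g i j * _) Bx) !M (smfun_addE _ _ Bx) !M ng /p (gC j i).
  by move: (sD n (sD y (w i)) x) (sD n (sD y (w j)) x) => *; ring.
rewrite E1 E2; under eq_bigr => i _ do rewrite big_split.
by rewrite big_split /= [X in _ + X = _]exchange_big /= mulr_natl mulr2n.
Qed.

Variable P : V -> V -> R.
Hypothesis projective : forall x y i, chart_cod c x -> 0 < beta c x y ->
  spray (kropina a h c) i x y = P x y * y 0 i.

(** The differential system that is integrated below: [hamel_at], its algebraic
    solution [weyl_field] and the integrability condition [weyl_riccati], on any
    domain where both charts are defined. *)
Lemma weyl_structure : exists (s : smfun B) (Q : smooth_form B) (psi : V -> smfun B),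
  [/\ [/\ (forall r u v x, B x -> psi (r *: u + v) x = r * psi u x + psi v x),
      (forall u v, sD u (sD v s) = psi u * sD v s + psi v * sD u s),
      (forall z y w, sD z (Q y w) = 2 * psi z * Q y w + psi y * Q z w + psi w * Q z y) &
      (forall u v, sD u (psi v) = psi u * psi v)],
    forall x, B x -> s x = sig (x1 c x),
    forall x v, B x -> sD v s x = beta c x v / h (x1 c x) ^+ 2 &
    forall x u v, B x -> Q u v x = pullback_metric x u v].
Proof.
have Bc x : B x -> chart_cod c x by move=> /BW/product_overlapP[].
have [s [k [k1 [k2 [kD _ val]]]]] := kropina_profile lc Bc h_smooth h_neq0 sigD.
have [Q [QE Qn]] := pullback_form.
have h2pos t : 0 < h t ^+ 2 by rewrite lt_neqAle sqr_ge0 andbT eq_sym expf_neq0.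
have sE x v : B x -> sD v s x = beta c x v / h (x1 c x) ^+ 2 by move=> /val[].
have s_gt0 x y : B x -> 0 < sD y s x -> 0 < beta c x y.
  by move=> Bx; rewrite sE// pmulr_lgt0 ?invr_gt0.
have s_eq0 x y : B x -> sD y s x = 0 -> beta c x y = 0.
  move=> Bx /eqP; rewrite sE// mulf_eq0 invr_eq0 (gt_eqF (h2pos _)) orbF.
  by move/eqP.
have Qpos x v : B x -> 'D_v X x != 0 -> 0 < Q v v x.
  by move=> Bx v0; rewrite QE//; apply: metric_posdef => //; exact: cod_X.
have Qge0 x v : B x -> 0 <= Q v v x.
  move=> Bx; have [v0|v0] := eqVneq ('D_v X x) 0; last exact/ltW/Qpos.
  by rewrite QE// /pullback_metric v0 !mul0mx mxE.
have inj x v : B x -> sD v s x = 0 -> 'D_v X x = 0 -> v = 0.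
  by move=> Bx sv; apply: (product_coord_inj lc le (BW Bx)); exact: s_eq0.
have hamel x y w : B x -> 0 < sD y s x ->
  sD w s x * (2 * Q y y x * sD y (sD y s) x - sD y s x * sD y (Q y y) x) =
  sD y s x * (2 * Q w y x * sD y (sD y s) x + sD y s x * sD w (Q y y) x
    - sD y s x * (2 * sD y (Q w y) x)).
  move=> Bx sy; apply: (@hamel_at _ _ B s Q k k1 (kropina a h c) P) => //.
  - by move=> z Bz; have [_ -> _ _ _] := val z Bz.
  - move=> z v Bz sv; have [_ -> _ _ _] := val z Bz.
    rewrite (kropina_slopeE a lc h_neq0 (Bc z Bz) sv (sE z v Bz)).
    by rewrite (alpha_tilde_sqE lc le) ?QE//; exact: BW.
  - move=> z v Bz Q0 sv; apply: (inj z) => //; apply/eqP/negPn/negP => /(Qpos z v Bz).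
    by rewrite Q0 ltxx.
  - move=> z v i Bz sv; apply: projective; [exact: Bc|exact: s_gt0].
have kernel x : B x -> exists v, [/\ sD v s x = 1,
    forall w, Q v w x = 0 & forall y, sD v (Q y y) x = 2 * sD y (Q v y) x].
  move=> Bx; have [v [v1 vX]] := product_coord_surj lc le (h (x1 c x) ^+ 2) 0 (BW Bx).
  exists v; split=> [|w|y]; last exact: Qn.
    by rewrite sE// /beta v1 divff// gt_eqF.
  by rewrite QE// /pullback_metric vX !mul0mx mxE.
have level x : B x -> exists2 w, w != 0 & sD w s x = 0.
  move=> Bx; have [v [v1 vX]] := product_coord_surj lc le 0 (delta_mx 0 (Ordinal d_gt0)) (BW Bx).
  exists v; last by rewrite sE// /beta v1 mul0r.
  apply/eqP => v0; move: vX; rewrite v0.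
  have dX : differentiable X x by apply: (smooth_diff (smooth_factor_coord lc le)); exact: BW.
  rewrite deriveE// linear0 => /rowP/(_ (Ordinal d_gt0)) /eqP.
  by rewrite !mxE !eqxx eq_sym oner_eq0.
have Q_pos x v : B x -> sD v s x = 0 -> v != 0 -> 0 < Q v v x.
  by move=> Bx sv v0; apply: Qpos => //; apply: contra_neq v0; exact: inj.
have [psi [psil dpsil hs hQ]] := weyl_field hamel kernel Q_pos.
exists s, Q, psi; split=> //; last by move=> x /val[].
split=> //; exact: (weyl_riccati kernel Q_pos level psil dpsil hs hQ).
Qed.

End ProjectiveChart.

(** * The projective development of the factor *)

Section SmoothVectors.
Context {R : realType}.

Lemma preimage_open (T T' : topologicalType) (U : set T) (W : set T') (f : T -> T') :
  open U -> open W -> (forall x, U x -> {for x, continuous f}) ->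
  open [set x | U x /\ W (f x)].
Proof.
move=> oU oW cf; rewrite openE => x [Ux Wx]; apply: filterI.
  by apply: open_nbhs_nbhs.
by apply: (cf x Ux); apply: open_nbhs_nbhs.
Qed.

Lemma smooth_id (V : normedModType R) (U : set V) : smooth_on U (fun x : V => x).
Proof. by move=> k; apply: (@class_C_linear _ _ _ _ _ idfun) => x; exact: cvg_id. Qed.

Lemma smooth_mulmx (V : normedModType R) (U : set V) m p (g : V -> 'rV[R]_m) (A : 'M[R]_(m, p)) :
  open U -> smooth_on U g -> smooth_on U (fun x => g x *m A).
Proof.
move=> oU sg k; apply: class_C_row => // j.
apply: (class_C_ext oU (f := fun x => \sum_i (g x 0 i * A i j : R) : R^o)).
  by move=> x _; rewrite mxE.
apply: class_C_sum => // i; apply: class_C_mul => //; last exact: class_C_cst.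
exact: class_C_entry.
Qed.

Lemma smooth_scale (V : normedModType R) (U : set V) m (f : V -> R) (g : V -> 'rV[R]_m) :
  open U -> smooth_on U (f : V -> R^o) -> smooth_on U g -> smooth_on U (fun x => f x *: g x).
Proof.
move=> oU sf sg k; apply: class_C_row => // j.
apply: (class_C_ext oU (f := fun x => (f x * g x 0 j : R) : R^o)).
  by move=> x _; rewrite mxE.
by apply: class_C_mul => //; exact: class_C_entry.
Qed.

Lemma smooth_translate (V W : normedModType R) (U : set V) (w : W) (g : V -> W) :
  open U -> smooth_on U g -> smooth_on U (fun x => w + g x).
Proof.
move=> oU sg k; apply: (class_C_add (f := fun=> w)) => //; exact: class_C_cst.
Qed.

Lemma derive_mulmx m p (A : 'M[R]_(m, p)) i (x u : 'rV[R]_m) :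
  'D_u (fun y : 'rV[R]_m => (y *m A) 0 i : R^o) x = (u *m A) 0 i.
Proof.
have lin : linear (fun y : 'rV[R]_m => (y *m A) 0 i : R^o).
  by move=> r v w; rewrite mulmxDl -scalemxAl !mxE.
pose L : {linear 'rV[R]_m -> R^o} :=
  HB.pack (fun y : 'rV[R]_m => (y *m A) 0 i : R^o) (GRing.isLinear.Build _ _ _ _ _ lin).
have cL : continuous L.
  move=> y; have sL := smooth_mulmx A openT (@smooth_id 'rV[R]_m setT).
  apply: (differentiable_continuous (f := L)).
  have sE : class_C 1 setT (L : _ -> R^o) by apply: class_C_entry (sL 1%N); exact: openT.
  exact: sE.1.
rewrite -[fun _ => _]/(L : _ -> _) deriveE ?diff_lin//.
exact: linear_differentiable.
Qed.

End SmoothVectors.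

Section Perspective.
Context {R : realType} {m p : nat}.
Variables (z0 : 'rV[R]_p) (E : 'M[R]_(m, p)) (pm : 'cV[R]_p).

Definition denom (y : 'rV[R]_m) : R := 1 + (y *m (E *m pm)) 0 0.
(** The inverse of the projective change of variables [w / (1 - psi0(w))] on a
    hyperplane, parametrized by [y |-> y E]; [pm] stands for the matrix
    of [psi0]. *)
Definition perspective (y : 'rV[R]_m) : 'rV[R]_p := z0 + (denom y)^-1 *: (y *m E).

Variable Y : domain 'rV[R]_m.
Hypothesis Y0 : forall y, Y y -> denom y != 0.

Lemma smooth_denom (U : set 'rV[R]_m) : open U -> smooth_on U (denom : _ -> R^o).
Proof.
move=> oU k; apply: (class_C_add (f := fun=> (1 : R^o))) => //; first exact: class_C_cst.
by apply: class_C_entry => //; apply: smooth_mulmx => //; exact: smooth_id.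
Qed.

Lemma smooth_perspective : smooth_on Y perspective.
Proof.
have oY := domain_open Y; apply: smooth_translate => //; apply: smooth_scale => //.
  by move=> k; apply: class_C_inv => //; exact: smooth_denom.
by apply: smooth_mulmx => //; exact: smooth_id.
Qed.

Lemma derive_perspective u y : Y y ->
  'D_u perspective y = (denom y)^-1 *: (u *m E - (u *m (E *m pm)) 0 0 *: (perspective y - z0)).
Proof.
move=> Yy; have oY := domain_open Y; have sP := smooth_perspective.
have sZ j : smooth_on Y (fun y => (perspective y - z0) 0 j : R^o).
  move=> k; apply: class_C_entry => //.
  by apply: (class_C_ext oY (f := fun y => - z0 + perspective y)) => [z _|];
    [rewrite addrC|apply: smooth_translate].
have sL j : smooth_on Y (fun y => (y *m E) 0 j : R^o).
  by move=> k; apply: class_C_entry => //; apply: smooth_mulmx => //; exact: smooth_id.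
pose D := to_smfun (smooth_denom oY).
apply/rowP => j; rewrite -derive_entry; last exact: smooth_diff sP Yy.
pose Z := to_smfun (sZ j); pose L := to_smfun (sL j).
(* The product rule is applied to [D * Z = L], where [Z] is a component of
   [perspective - z0] and [L] one of [y E]. *)
have DZ : D * Z = L.
  apply: smfunP => z Yz; rewrite (smfun_mulE _ _ Yz) !to_smfunE//.
  by rewrite /perspective addrC addKr !mxE mulrA divff ?mul1r ?Y0.
have D1 : sD u D y = (u *m (E *m pm)) 0 0.
  rewrite -(derive_agree (g := denom : _ -> R^o) u Yy); last by move=> z Yz; rewrite to_smfunE.
  rewrite deriveD ?derive_cst ?add0r ?derive_mulmx//.
  have : smooth_on Y (fun y => (y *m (E *m pm)) 0 0 : R^o).
    by move=> k; apply: class_C_entry => //; apply: smooth_mulmx => //; exact: smooth_id.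
  by move=> /smooth_diff/(_ Yy)/diff_derivable.
have L1 : sD u L y = (u *m E) 0 j.
  rewrite -(derive_agree (g := fun y => (y *m E) 0 j : R^o) u Yy) ?derive_mulmx//.
  by move=> z Yz; rewrite to_smfunE.
have Z1 : sD u Z y = 'D_u (fun y => perspective y 0 j : R^o) y.
  rewrite -(derive_agree (g := (fun y => perspective y 0 j : R^o) + cst (- z0 0 j)) u Yy).
    rewrite deriveD ?derive_cst ?addr0//.
    have : smooth_on Y (fun y => perspective y 0 j : R^o) by move=> k; apply: class_C_entry.
    by move=> /smooth_diff/(_ Yy)/diff_derivable.
  by move=> z Yz; rewrite [RHS]to_smfunE// [RHS]mxE [X in _ = _ + X]mxE.
have := congr1 (fun f : smfun Y => f y) (congr1 (sD u) DZ).
rewrite sD_mul (smfun_addE _ _ Yy) !(smfun_mulE _ _ Yy) D1 L1 Z1 !to_smfunE//.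
have scE (r q : R) (v w : 'rV[R]_p) : (r *: (v - q *: w)) 0 j = r * (v 0 j - q * w 0 j).
  by rewrite !mxE.
rewrite scE => <-.
by rewrite addrAC subrr add0r mulrA mulVf ?mul1r ?Y0.
Qed.

End Perspective.

Section ProjectiveDevelopment.
Context {R : realType} {d : nat} {N : @manifold R d} (a : riemannian_metric N).
Local Notation V := 'rV[R]_(1 + d).
Local Notation eV i := (delta_mx 0 i : V).
Variables (c : @chart R (line_product N) (1 + d)) (lc : local_coordinates c).
Variables (e : @chart R N d) (le : local_coordinates e).
Local Notation X := (factor_coord c e).
Variables (B : domain V) (BW : forall x, B x -> overlap c (line_chart e) x).
Variables (s : smfun B) (Q : smooth_form B) (psi : V -> smfun B).
Hypothesis psi_lin : forall r u v x, B x -> psi (r *: u + v) x = r * psi u x + psi v x.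
Hypothesis hess_s : forall u v, sD u (sD v s) = psi u * sD v s + psi v * sD u s.
Hypothesis hess_Q : forall z y w,
  sD z (Q y w) = 2 * psi z * Q y w + psi y * Q z w + psi w * Q z y.
Hypothesis riccati : forall u v, sD u (psi v) = psi u * psi v.
Hypothesis QE : forall x u v, B x -> Q u v x = pullback_metric a c e x u v.
Variables (sig : R -> R) (sig_inj : injective sig).
Hypothesis sE : forall x, B x -> s x = sig (x1 c x).
Hypothesis s_inj : forall x v, B x -> sD v s x = 0 -> 'D_v X x = 0 -> v = 0.
Variable z0 : V.
Hypotheses (Bz0 : B z0) (z00 : x1 c z0 = 0).
Hypothesis star : forall x (t : R), B x -> 0 <= t <= 1 -> B (z0 + t *: (x - z0)).

Let pm : 'cV[R]_(1 + d) := \col_i psi (eV i) z0.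
Let ds : 'cV[R]_(1 + d) := \col_i sD (eV i) s z0.
Let DX : 'M[R]_(1 + d, d) := \matrix_(i, j) ('D_(eV i) X z0) 0 j.

Let pmE v : psi v z0 = (v *m pm) 0 0.
Proof.
rewrite (sum_row (f := fun v => psi v z0)) => [|r u w]; last exact: psi_lin.
by rewrite mxE; apply: eq_bigr => i _; rewrite mxE.
Qed.

Let dsE v : sD v s z0 = (v *m ds) 0 0.
Proof. by rewrite (sD_row _ _ Bz0) mxE; apply: eq_bigr => i _; rewrite mxE. Qed.

Let dX x : B x -> differentiable X x.
Proof. by move=> Bx; apply: (smooth_diff (smooth_factor_coord lc le)); exact: BW. Qed.

Let DXE v : 'D_v X z0 = v *m DX.
Proof.
apply/rowP => j; rewrite (derive_row _ (dX Bz0)) summxE mxE.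
by apply: eq_bigr => i _; rewrite !mxE.
Qed.

Let cod_X x : B x -> chart_cod e (X x).
Proof. by move=> /BW/product_overlapP[_ ex]; exists (point c x).2. Qed.

(** [K] is an orthonormal coframe of the form [Q] at [z0] and [E] the dual frame
    of the hyperplane [ker ds]. *)
Let frame_exists : exists (E : 'M[R]_(d, 1 + d)) (K : 'M[R]_(1 + d, d)),
  [/\ E *m K = 1%:M, E *m ds = 0, forall w : V, w *m ds = 0 -> w = w *m K *m E &
      forall u v : V, Q u v z0 = ((u *m K) *m (v *m K)^T) 0 0].
Proof.
have [C CE Cu] : exists2 C : 'M[R]_d, a e (X z0) = C *m C^T & C \in unitmx.
  apply: posdef_factor; first exact: metric_sym le _ (cod_X Bz0).
  by move=> v v0; exact: metric_posdef le _ (cod_X Bz0) v v0.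
pose K := DX *m C; pose M : 'M[R]_(1 + d) := row_mx ds K.
have Mu : M \in unitmx.
  rewrite -row_free_unit; apply/inj_row_free => v; rewrite mul_mx_row => vM.
  have v1 : v *m ds = 0 by have := congr1 lsubmx vM; rewrite row_mxKl raddf0.
  have v2 : v *m K = 0 by have := congr1 rsubmx vM; rewrite row_mxKr raddf0.
  apply: (s_inj Bz0); first by rewrite dsE v1 mxE.
  by rewrite DXE -[v *m DX]mulmx1 -(mulmxV Cu) mulmxA -(mulmxA v) v2 mul0mx.
pose E := dsubmx (invmx M).
have MM : invmx M = col_mx (usubmx (invmx M)) E by rewrite vsubmxK.
have := mulVmx Mu; rewrite [in LHS]MM mul_col_row scalar_mx_block => /eq_block_mx[_ _ Eds EK].
exists E, K; split=> // [w wds|u v].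
  by rewrite -[LHS]mulmx1 -(mulmxV Mu) mulmxA mul_mx_row wds MM mul_row_col mul0mx add0r.
by rewrite QE// /pullback_metric !DXE CE /K !trmx_mul !mulmxA.
Qed.

(** The slice [x1 = 0] through [z0] is a level set of [s]. By
    [level_function_along] it lies in [z0 + ker ds], and
    [y = w K / (1 - psi0(w))] is a coordinate system on it, with inverse
    [perspective]; by [form_along] the metric has the constant matrix [1] in the
    coordinates [y]. The point [q] of the factor is viewed in the slice through
    [zeta]. *)
Lemma developed_chart : exists f : @chart R N d,
  [/\ local_coordinates f, chart_dom f (point c z0).2 &
      forall y, chart_cod f y -> a f y = 1%:M].
Proof.
have [E [K [EK Eds dsK QK]]] := frame_exists.
pose l (w : V) : R := 1 - (w *m pm) 0 0.
have lE w : l w = 1 + (w *m (- pm)) 0 0 by rewrite mulmxN [in RHS]mxE.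
have seg x : B x -> forall t : R, 0 <= t <= 1 -> B (z0 + t *: (x - z0)).
  by move=> Bx t; exact: star.
have zD x : z0 + (x - z0) = x by rewrite addrC subrK.
have l_neq0 x : B x -> l (x - z0) != 0.
  by move=> Bx; rewrite /l -pmE; exact: (psi_along_neq0 riccati (seg x Bx)).
have s_along x : B x -> (s x - s z0) * l (x - z0) = ((x - z0) *m ds) 0 0.
  move=> Bx; rewrite /l -pmE -dsE -(level_function_along hess_s riccati (seg x Bx)).
  by rewrite zD.
have Q_along x u v : B x -> l (x - z0) ^+ 2 *
    Q (u - psi u z0 *: (x - z0)) (v - psi v z0 *: (x - z0)) x = Q u v z0.
  move=> Bx; rewrite -(form_along hess_Q riccati (seg x Bx)) /l -pmE zD; congr (_ * _).
  set w := x - z0.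
  have uE (t : V) : t - psi t z0 *: w = - psi t z0 *: w + t by rewrite scaleNr addrC.
  rewrite !uE !(sform_at _ _ _ _ _ Bx) !(sform_atr _ _ _ _ _ Bx).
  by rewrite (sformC Q u w); ring.
pose j (q : 'rV[R]_d) : V := row_mx 0 q.
have jl q : lsubmx (j q) 0 0 = 0 by rewrite row_mxKl mxE.
have jr q : rsubmx (j q) = q by rewrite row_mxKr.
have pj q : point (line_chart e) (j q) = (0, point e q).
  by rewrite /= /line_point jl jr.
have sj : smooth_on setT j.
  move=> k; apply: class_C_row => [|i]; first exact: openT.
  case: (split_ordP i) => i' ->.
    apply: (class_C_ext openT (f := fun=> 0 : R^o)); last exact: class_C_cst.
    by move=> q _; rewrite row_mxEl mxE.
  apply: (class_C_ext openT (f := fun q : 'rV[R]_d => q 0 i' : R^o)).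
    by move=> q _; rewrite row_mxEr.
  by apply: class_C_entry; [exact: openT|exact: smooth_id].
have cj q : chart_cod (line_chart e) (j q) <-> chart_cod e q.
  have -> : chart_cod (line_chart e) = [set x | chart_cod e (rsubmx x)] :=
    line_image e (chart_dom e).
  by rewrite /= jr.
pose A0 : set 'rV[R]_d := [set q | setT q /\ overlap (line_chart e) c (j q)].
have oA0 : open A0.
  apply: preimage_open; [exact: openT|exact: overlap_open|move=> q _].
  exact: (differentiable_continuous (smooth_diff sj (I : [set: 'rV[R]_d] q))).
pose zeta q := transition (line_chart e) c (j q).
have zetaE q : zeta q = coord c (0, point e q).
  by rewrite /zeta /transition /= -[line_point _ _]/(point (line_chart e) (j q)) pj.
have szeta : smooth_on A0 zeta.
  refine (smooth_compv oA0 (@overlap_open _ _ _ (line_chart e) c) _ (smooth_sub _ sj) _) => //.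
    by move=> q [].
  exact: (product_compatible lc le).2.
pose A : set 'rV[R]_d := [set q | A0 q /\ B (zeta q)].
have oA : open A.
  apply: (preimage_open oA0 (domain_open B)) => q A0q.
  exact: (differentiable_continuous (smooth_diff szeta A0q)).
have A0P q : A0 q -> [/\ chart_cod e q, point c (zeta q) = (0, point e q) & X (zeta q) = q].
  move=> [_ /overlapP[/cj eq]]; rewrite pj => cq.
  have pz : point c (zeta q) = (0, point e q).
    by rewrite zetaE coordK.
  by split=> //; rewrite /factor_coord pz; have [] := chart_cod_point eq.
pose phi q := (l (zeta q - z0))^-1 *: ((zeta q - z0) *m K).
pose den := denom E pm; pose per := perspective z0 E pm.
have odom : open [set y : 'rV[R]_d | setT y /\ [set r : R^o | r != 0] (den y)].
  apply: preimage_open; [exact: openT|exact: open_neq|move=> y _].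
  exact: (differentiable_continuous
    (smooth_diff (smooth_denom E pm openT) (I : [set: 'rV[R]_d] y))).
pose Y1 : domain 'rV[R]_d := Domain odom.
have Y10 y : Y1 y -> denom E pm y != 0 by move=> [].
have sper1 : smooth_on Y1 per := smooth_perspective z0 Y10.
have oY : open [set y | Y1 y /\ B (per y)].
  apply: preimage_open; [exact: domain_open|exact: domain_open|move=> y Y1y].
  exact: (differentiable_continuous (smooth_diff sper1 Y1y)).
pose Y : domain 'rV[R]_d := Domain oY.
have Y0 y : Y y -> denom E pm y != 0 by move=> [/Y10].
have YB y : Y y -> B (per y) by case.
have sper : smooth_on Y per := smooth_perspective z0 Y0.
have sc00 (r : R) (M : 'M[R]_1) : (r *: M) 0 0 = r * M 0 0 by rewrite mxE.
have perE y : per y - z0 = (den y)^-1 *: (y *m E) by rewrite /per /perspective addrC addKr.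
have lper y : Y y -> l (per y - z0) = (den y)^-1.
  move=> Yy; have d0 := Y0 y Yy; rewrite /l perE.
  rewrite -scalemxAl sc00 -mulmxA.
  have -> : (y *m (E *m pm)) 0 0 = den y - 1 by rewrite /den /denom addrC addKr.
  by rewrite mulrBr mulVf// mulr1 opprB addrCA subrr addr0.
have perds y : (per y - z0) *m ds = 0.
  by rewrite perE -scalemxAl -mulmxA Eds mulmx0 scaler0.
have denphi q : A q -> den (phi q) = (l (zeta q - z0))^-1 /\ per (phi q) = zeta q.
  move=> [A0q Bq]; have l0 := l_neq0 _ Bq; have [_ pz _] := A0P q A0q.
  have wds : (zeta q - z0) *m ds = 0.
    apply/matrixP => i i'; rewrite (ord1 i) (ord1 i') -s_along// !sE// z00 /x1 pz.
    by rewrite subrr mul0r mxE.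
  have phiE : phi q *m E = (l (zeta q - z0))^-1 *: (zeta q - z0).
    by rewrite /phi -scalemxAl -dsK.
  have dE : den (phi q) = (l (zeta q - z0))^-1.
    rewrite /den /denom mulmxA phiE -scalemxAl sc00.
    have -> : ((zeta q - z0) *m pm) 0 0 = 1 - l (zeta q - z0) by rewrite /l subKr.
    by rewrite mulrBr mulVf// mulr1 addrCA subrr addr0.
  split=> //; rewrite /per /perspective -/den dE invrK phiE scalerA mulfV// scale1r.
  exact: zD.
have imE : phi @` A = Y.
  apply/seteqP; split=> [_ [q Aq <-]|y Yy].
    have [dE pE] := denphi q Aq; have [A0q Bq] := Aq.
    by split; [split=> //; rewrite /= dE invr_eq0 l_neq0|rewrite pE].
  have By := YB y Yy; have [cy ey] := iffLR (product_overlapP c e (per y)) (BW By).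
  have x0 : x1 c (per y) = 0.
    apply: sig_inj; rewrite -sE// -z00 -sE//; apply/eqP; rewrite -subr_eq0.
    have := s_along _ By; rewrite perds mxE => /eqP.
    by rewrite mulf_eq0 (negPf (l_neq0 _ By)) orbF.
  have Xq : point c (per y) = (0, point e (X (per y))).
    by rewrite /factor_coord coordK// -x0 /x1; case: (point c _).
  have [pcy pcyE] := chart_cod_point cy.
  have zE : zeta (X (per y)) = per y.
    by rewrite zetaE -Xq.
  exists (X (per y)).
    split; last by rewrite zE.
    split=> //; apply/overlapP; split; first by apply/cj; exact: cod_X.
    by rewrite pj -Xq.
  rewrite /phi zE lper// invrK perE -scalemxAl scalerA.
  by rewrite mulfV ?Y0// scale1r -mulmxA EK mulmx1.
have phiK q : A q -> X (per (phi q)) = q.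
  by move=> Aq; rewrite (denphi q Aq).2; case: Aq => /A0P[].
have sX : smooth_on Y (fun y => X (per y)).
  refine (smooth_compv (domain_open Y) (@overlap_open _ _ _ c (line_chart e)) _ sper _).
    by move=> y /YB/BW.
  exact: smooth_factor_coord.
have sdev : smooth_on A phi.
  have szA : smooth_on A (fun q => zeta q - z0).
    have szA0 : smooth_on A zeta by apply: (smooth_sub _ szeta) => q [].
    apply: (smooth_agree oA (f := fun q => - z0 + zeta q)); last exact: smooth_translate.
    by move=> q _; rewrite addrC.
  apply: smooth_scale => //; last exact: smooth_mulmx.
  move=> k; apply: class_C_inv => // [q [_ Bq]|]; first exact: l_neq0.
  apply: (class_C_ext oA (f := (fun=> 1 : R^o) + (fun q => ((zeta q - z0) *m (- pm)) 0 0 : R^o))).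
    by move=> q _; rewrite lE.
  apply: class_C_add => //; first exact: class_C_cst.
  by apply: class_C_entry => //; exact: smooth_mulmx.
have [f [lf cf df fE pE]] : exists f : @chart R N d,
  [/\ local_coordinates f, chart_cod f = phi @` A,
      forall p, chart_dom f p <-> chart_dom e p /\ A (coord e p),
      forall p, coord f p = phi (coord e p) &
      forall y, point f y = point e (X (per y))].
  apply: (reparametrized_chart le oA) => //.
  - by move=> q [/A0P[]].
  - by rewrite imE; exact: domain_open.
  - by rewrite imE.
have [cz0 ez0] := iffLR (product_overlapP c e z0) (BW Bz0).
exists f; split=> //.
  have pz0 : (0, (point c z0).2) = point c z0 by rewrite -z00 /x1; case: (point c z0).
  have [pcz pczE] := chart_cod_point cz0.
  apply/df; split=> //; split; last first.
    by rewrite zetaE coordK// pz0 pczE.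
  split=> //; apply/overlapP; split; first by apply/cj; exists (point c z0).2.
  by rewrite pj coordK// pz0.
move=> y cfy; have Yy : Y y by rewrite -imE -cf.
have By := YB y Yy.
have ov : overlap f e y.
  by apply/overlapP; split=> //; have [/df[]] := chart_cod_point cfy.
have trE z : Y z -> transition f e z = X (per z).
  by move=> Yz; rewrite /transition /= pE; have [] := chart_cod_point (cod_X (YB z Yz)).
have dtr u : 'D_u (transition f e) y = 'D_('D_u per y) X (per y).
  rewrite -(@derive_comp _ _ _ _ per X); [|exact: smooth_diff sper Yy|exact: dX].
  apply: near_eq_derive; near=> z; apply: trE; near: z.
  by apply: open_nbhs_nbhs; split=> //; exact: domain_open.
have QZ r u v x : B x -> Q (r *: u) (r *: v) x = r ^+ 2 * Q u v x.
  move=> Bx; rewrite (sform_sum Q u v Bx) (sform_sum Q (r *: u) _ Bx) mulr_sumr.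
  apply: eq_bigr => i _; rewrite mxE (sform_sumr Q _ (r *: v) Bx) (sform_sumr Q _ v Bx).
  rewrite !mulr_sumr; apply: eq_bigr => i' _; rewrite mxE.
  by move: (Q _ _ _) (u 0 i) (v 0 i') => q1 q2 q3; ring.
have dper u : 'D_u per y =
    l (per y - z0) *: (u *m E - psi (u *m E) z0 *: (per y - z0)).
  by rewrite /per (derive_perspective z0 Y0 u Yy) -/den -/per lper// pmE mulmxA.
have metricE (u v : 'rV[R]_d) : (u *m a f y *m v^T) 0 0 = (u *m v^T) 0 0.
  rewrite (metric_transition a lf le ov) !dtr trE//.
  rewrite -[LHS]/(pullback_metric a c e (per y) ('D_u per y) ('D_v per y)) -QE// !dper.
  by rewrite QZ// Q_along// QK -!(mulmxA _ E) EK !mulmx1.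
apply/matrixP => i i'; have := metricE (delta_mx 0 i) (delta_mx 0 i').
by rewrite trmx_delta -!rowE -colE !mxE eqxx andbT.
Unshelve. all: by end_near. Qed.

End ProjectiveDevelopment.

Section Converse.
Context {R : realType} {d : nat} {N : @manifold R d} (a : riemannian_metric N) (h : R -> R).
Local Notation V := 'rV[R]_(1 + d).
Hypothesis d_gt0 : (0 < d)%N.
Hypothesis h_smooth : smooth_on [set: R] (h : R -> R^o).
Hypothesis h_neq0 : forall t, h t != 0.

Lemma ball_star (z0 x : V) (r t : R) : ball z0 r x -> 0 <= t <= 1 ->
  ball z0 r (z0 + t *: (x - z0)).
Proof.
rewrite -!ball_normE /= => zx /andP[t0 t1]; rewrite opprD addNKr normrN normrZ ger0_norm//.
by rewrite distrC (le_lt_trans _ zx)// ler_piMl.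
Qed.

Lemma projectively_flat_flat :
  locally_projectively_flat (@kropina_domain R d N) (kropina a h) -> locally_flat a.
Proof.
move=> lpf p; have [c [lc cp [P HP]]] := lpf ((0 : R), p).
have [e [ae ep]] := atlas_cover p; have le := atlas_local ae.
have [sig sigD] := projective_parameter_exists h_smooth h_neq0.
have h2pos t : 0 < (h t ^+ 2)^-1.
  by rewrite invr_gt0 lt_neqAle sqr_ge0 andbT eq_sym expf_neq0.
have sig_inj : injective sig.
  move=> t u tu; have mono := increasing_of_derive sigD h2pos.
  by have [/mono|/mono|//] := ltgtP t u; rewrite tu ltxx.
pose z0 := coord c (0, p).
have pz0 : point c z0 = (0, p) by rewrite coordK.
have Wz0 : overlap c (line_chart e) z0.
  by apply/product_overlapP; rewrite pz0; split=> //; exists (0, p).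
have : nbhs z0 (overlap c (line_chart e)).
  by apply: open_nbhs_nbhs; split=> //; exact: overlap_open.
move=> /nbhs_ballP[r /= r0 rW].
pose B : domain V := Domain (ball_open z0 r).
have projective x y i : chart_cod c x -> 0 < beta c x y ->
  spray (kropina a h c) i x y = P x y * y 0 i by move=> cx b0; exact: (HP x y cx b0).1.
have [s [Q [psi [[psil hs hQ ric] sE sD QE]]]] :=
  weyl_structure lc d_gt0 h_smooth h_neq0 sigD le (B := B) rW projective.
have [||||f [lf fp fa]] :=
  developed_chart lc le (B := B) rW psil hs hQ ric QE sig_inj sE _ (z0 := z0).
- move=> x v Bx sv; apply: (product_coord_inj lc le (rW x Bx)).
  by move: sv => /eqP; rewrite sD// mulf_eq0 (gt_eqF (h2pos _)) orbF => /eqP.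
- exact: ballxx.
- by rewrite /x1 pz0.
- by move=> x t; exact: ball_star.
by exists f; split=> //; move: fp; rewrite pz0.
Qed.

End Converse.

(** * Projective flatness and flag curvature *)

(* The factor [N] has dimension [d] = n - 1. *)
Theorem proposition6p2 (R : realType) (d : nat) (hn : (2 <= 1 + d)%N)
    (N : @manifold R d) (a : riemannian_metric N) (h : R -> R)
    (h_smooth : smooth_on [set: R] (h : R -> R^o))
    (h_neq0 : forall t, h t != 0) :
  (locally_projectively_flat (@kropina_domain R d N) (kropina a h) <->
   locally_flat a) /\
  (locally_projectively_flat (@kropina_domain R d N) (kropina a h) ->
   forall K : tangent_fun (line_product N) R,
     is_flag_curvature (@kropina_domain R d N) (kropina a h) K <->
     forall c x y, local_coordinates c -> chart_cod c x ->
       kropina_domain c x y ->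
       K c x y =
       - (beta c x y / alpha a h c x y) ^+ 6 *
         (((h^`(2))%classic (x1 c x) : R) / h (x1 c x) +
          3 * ((h^`())%classic (x1 c x) : R) ^+ 2 *
            (alpha_tilde a c x y / alpha a h c x y) ^+ 2)).
Proof.
have flat_iff : locally_projectively_flat (@kropina_domain R d N) (kropina a h) <->
    locally_flat a.
  by split; [exact: projectively_flat_flat|exact: flat_projectively_flat].
by split=> // /flat_iff flat K; exact: flag_curvature_of_flat.
Qed.
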